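(* Let $T>0$, $d\ge1$, and suppose $b,\varphi\in\mathfrak{C}([0,T]\times\mathbb{R}^d\times\mathbb{R}^d)$. For $x\in\mathbb{R}^d$ let $(X_t^x)_{t\in[0,T]}$ be the unique strong solution of the mean-field SDE $$dX_t^x=b\Big(t,X_t^x,\int_{\mathbb{R}^d}\varphi(t,X_t^x,z)\,\mathbb{P}_{X_t^x}(dz)\Big)dt+dB_t,\quad t\in[0,T],\quad X_0^x=x.$$ Then for every compact subset $K\subset\mathbb{R}^d$ there exists a constant $C>0$ such that for every $t\in[0,T]$ and $x,y\in K$ $$\mathbb{E}\big[\|\partial_xX_t^x-\partial_yX_t^y\|\big]\le C\|x-y\|.$$ In particular, the map $x\mapsto X_t^x$ is continuously differentiable for every $t\in[0,T]$, and for every compact $K\subset\mathbb{R}^d$ and every $1\le p<\infty$ $$\sup_{t\in[0,T]}\sup_{x\in K}\mathbb{E}\big[\|\partial_xX_t^x\|^p\big]^{1/p}<\infty.$$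
   Context: $B$ is $d$-dimensional Brownian motion, $\mathbb{P}_{X_t^x}$ is the law of $X_t^x$, and $\|\cdot\|$ is the Euclidean norm (also for matrices). All functions are measurable. For $C>0$, $\mathcal{C}^{1,1}_{b,C}(\mathbb{R}^d)$ is the space of continuously differentiable $f:\mathbb{R}^d\to\mathbb{R}^d$ with Jacobian $f'$ satisfying $\sup_y\|f'(y)\|\le C$ and $\|f'(y_1)-f'(y_2)\|\le C\|y_1-y_2\|$ for all $y_1,y_2$. $\mathfrak{C}([0,T]\times\mathbb{R}^d\times\mathbb{R}^d)$ is the space of functions $f:[0,T]\times\mathbb{R}^d\times\mathbb{R}^d\to\mathbb{R}^d$ for which there is a constant $C>0$ such that $(y\mapsto f(t,y,z))\in\mathcal{C}^{1,1}_{b,C}(\mathbb{R}^d)$ for all $t\in[0,T]$, $z\in\mathbb{R}^d$, and $(z\mapsto f(t,y,z))\in\mathcal{C}^{1,1}_{b,C}(\mathbb{R}^d)$ for all $t\in[0,T]$, $y\in\mathbb{R}^d$. The solutions $X^x$, $x\in\mathbb{R}^d$, are all driven by the same Brownian motion on the same probability space; strong solution means adapted to the $\mathbb{P}$-augmented filtration of $B$, and unique means pathwise unique and unique in law. $\partial_xX_t^x$ denotes the first variation process, i.e. the Jacobian (a priori the weak/Sobolev derivative, for a suitable choice in its equivalence class) of $x\mapsto X_t^x$; continuous differentiability of $x\mapsto X_t^x$ is meant almost surely, for a suitable version of the random field. *)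

(* Defs.v *)
From HB Require Import structures.
From mathcomp Require Import all_boot all_order all_algebra.
From mathcomp Require Import all_classical all_reals all_analysis.

Set Implicit Arguments.
Unset Strict Implicit.
Unset Printing Implicit Defensive.

Import Order.TTheory GRing.Theory Num.Theory.
Import numFieldNormedType.Exports.

Local Open Scope classical_set_scope.
Local Open Scope ring_scope.

(* The canonical norm of the library on matrices is the max norm; the estimates
   use the Euclidean (Frobenius) norm. *)
Definition enorm (R : realType) (m n : nat) (A : 'M[R]_(m, n)) : R :=
  Num.sqrt (\sum_(i < m) \sum_(j < n) A i j ^+ 2).

(* R^d with its Borel sigma-algebra; convertible to 'rV[R]_d. *)
Notation borel_rV R d := (g_sigma_algebraType (@open 'rV[R]_d)).

Section regularity.
Context {R : realType} {d : nat}.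

(* [jacobian] acts on row vectors: 'D_v f a = v *m jacobian f a, so it is the
   transpose of the matrix of partial derivatives (df_i/dx_j)_(i, j), with the
   same Euclidean norm. *)
Definition C1 (f : 'rV[R]_d -> 'rV[R]_d) : Prop :=
  (forall y, differentiable f y) /\ continuous (jacobian f).

Definition C11b (C : R) (f : 'rV[R]_d -> 'rV[R]_d) : Prop :=
  [/\ C1 f,
      (forall y, enorm (jacobian f y) <= C) &
      (forall y1 y2,
         enorm (jacobian f y1 - jacobian f y2) <= C * enorm (y1 - y2))].

(* The coefficient class on [0, T] x R^d x R^d, including the standing
   assumption of joint Borel measurability. *)
Definition coeff_class (T : R)
    (f : R -> 'rV[R]_d -> 'rV[R]_d -> 'rV[R]_d) : Prop :=
  measurable_fun
    ((`[0, T]%classic : set (measurableTypeR R)) `*`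
       [set: (borel_rV R d * borel_rV R d)%type])
    (fun u => f u.1 u.2.1 u.2.2 : borel_rV R d) /\
  exists2 C : R, 0 < C &
    (forall (t : R) z, t \in `[0, T] -> C11b C (fun y => f t y z)) /\
    (forall (t : R) y, t \in `[0, T] -> C11b C (fun z => f t y z)).

End regularity.

Section stochastics.
Context {R : realType} {disp : measure_display} {Omega : measurableType disp}.
Variables (P : probability Omega R) (d : nat).

Definition random_vector (Z : Omega -> 'rV[R]_d) : Prop :=
  measurable_fun [set: Omega] (Z : Omega -> borel_rV R d).

Definition law (Z : Omega -> 'rV[R]_d) : set (borel_rV R d) -> \bar R :=
  pushforward P (Z : Omega -> borel_rV R d).

Definition natural_filtration (B : R -> Omega -> 'rV[R]_d) (t : R) :
    set (set Omega) :=
  <<s [set A | exists (s : R) (D : set (borel_rV R d)),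
         [/\ s \in `[0, t], measurable D & A = B s @^-1` D] ] >>.

Definition augmented_filtration (B : R -> Omega -> 'rV[R]_d) (t : R) :
    set (set Omega) :=
  <<s natural_filtration B t `|` [set N | P.-negligible N] >>.

(* In the last clause, testing against past events A and boxes says that
   B t - B s is independent of the past up to time s and has law
   N(0, (t - s) I_d); [normal_prob] takes the standard deviation. *)
Definition brownian_motion (T : R) (B : R -> Omega -> 'rV[R]_d) : Prop :=
  [/\ (forall t : R, t \in `[0, T] -> random_vector (B t)),
      {ae P, forall w, B 0 w = 0},
      {ae P, forall w, {within `[0, T], continuous (fun t => B t w)}} &
      (forall (s t : R) (A : set Omega) (D : 'I_d -> set (measurableTypeR R)),
         0 <= s -> s < t -> t <= T ->
         natural_filtration B s A -> (forall i, measurable (D i)) ->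
         P (A `&` [set w | forall i, D i ((B t w - B s w) ord0 i)]) =
         (P A * \prod_(i < d) normal_prob 0 (Num.sqrt (t - s)) (D i))%E)].

(* y |-> \int phi(t, y, z) P_{X_t}(dz) *)
Definition mean_field (phi : R -> 'rV[R]_d -> 'rV[R]_d -> 'rV[R]_d)
    (X : R -> Omega -> 'rV[R]_d) (t : R) (y : 'rV[R]_d) : 'rV[R]_d :=
  \row_i fine (\int[law (X t)]_z (phi t y z ord0 i)%:E).

Definition drift (b phi : R -> 'rV[R]_d -> 'rV[R]_d -> 'rV[R]_d)
    (X : R -> Omega -> 'rV[R]_d) (w : Omega) (s : R) : 'rV[R]_d :=
  b s (X s w) (mean_field phi X s (X s w)).

(* The noise is additive, so the SDE is a pathwise integral equation. *)
Definition strong_solution (T : R) (B : R -> Omega -> 'rV[R]_d)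
    (b phi : R -> 'rV[R]_d -> 'rV[R]_d -> 'rV[R]_d)
    (x : 'rV[R]_d) (X : R -> Omega -> 'rV[R]_d) : Prop :=
  [/\ (forall t : R, t \in `[0, T] -> random_vector (X t)),
      (forall (t : R) (D : set (borel_rV R d)), t \in `[0, T] -> measurable D ->
         augmented_filtration B t (X t @^-1` D)),
      {ae P, forall w, {within `[0, T], continuous (fun t => X t w)}},
      (forall (t : R) y i, t \in `[0, T] ->
         (law (X t)).-integrable [set: borel_rV R d]
           (fun z => (phi t y z ord0 i)%:E)) &
      {ae P, forall w,
         (forall i, lebesgue_measure.-integrable
            (`[0, T]%classic : set (measurableTypeR R))
            (fun s => (drift b phi X w s ord0 i)%:E)) /\
         (forall t : R, t \in `[0, T] ->
            X t w = x + (\row_i Rintegral lebesgue_measure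
                          (`[0, t]%classic : set (measurableTypeR R))
                          (fun s => drift b phi X w s ord0 i)) + B t w)}].

(* J is the Jacobian x |-> d_x X_t^x of the random field x |-> X_t^x, chosen as
   the classical Jacobian of an almost surely C^1 modification Y of the field. *)
Definition C1_first_variation (T : R) (X : 'rV[R]_d -> R -> Omega -> 'rV[R]_d)
    (J : 'rV[R]_d -> R -> Omega -> 'M[R]_d) : Prop :=
  exists Y : 'rV[R]_d -> R -> Omega -> 'rV[R]_d,
    [/\ (forall x (t : R), t \in `[0, T] ->
           random_vector (Y x t) /\ {ae P, forall w, Y x t w = X x t w}),
        (forall x (t : R) i j, t \in `[0, T] ->
           measurable_fun [set: Omega]
             (fun w => J x t w i j : measurableTypeR R)) &
        (forall t : R, t \in `[0, T] ->
           {ae P, forall w, C1 (fun x => Y x t w) /\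
              forall x, J x t w = jacobian (fun x' => Y x' t w) x})].

End stochastics.

(* Main.v *)
(* Let D and S be the first and second differences of x |-> X^x in a direction u.
   Gronwall gives |D| <= C |u|.  The theorem reduces to |S_t| <= C |u|^(3/2),
   which makes the field C^1, and E|S_t| <= C |u|^2, which by polarisation makes
   the derivative Lipschitz in mean.  The coefficients are C^{1,1} in each
   variable separately only, so that interpolation makes the mixed increments of
   the drift Hoelder 1/2; this gives the first bound, but not the second one.
   For the second, S_t is, up to Gronwall terms, the integral of q(s, X_s, U_s)
   with U = (X^(x+u) - X^(x-u)) / 2 and q of size |u|^(3/2).  Conditioning on the
   past of s - e replaces q by its image under the heat semigroup, which is only
   of size |u|^2 e^(-1/4).  The change from lag e to lag 16 e is controlled by
   the orthogonality of conditional fluctuations over disjoint time windows, and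
   summing over dyadic lags from |u|^2 up to t gives E|S_t| <= C |u|^2. *)

Require Import Defs.
From HB Require Import structures.
From mathcomp Require Import all_boot all_order all_algebra.
From mathcomp Require Import all_classical all_reals all_analysis.
From mathcomp Require Import measurable_realfun ring lra.
Import Order.TTheory GRing.Theory Num.Theory.
Import numFieldNormedType.Exports.
Local Open Scope classical_set_scope.
Local Open Scope ring_scope.
Set Implicit Arguments.
Unset Strict Implicit.
Unset Printing Implicit Defensive.

(** * Increments of separately C^{1,1} maps *)

Ltac vring := apply/rowP => ?; rewrite !mxE; ring.

Section increments.
Context {R : realType} {d : nat}.
Local Notation V := 'rV[R]_d.
Implicit Types (f g : V -> V) (L a : R).

Definition lip L f := forall z h, `|f (z + h) - f z| <= L * `|h|.

Definition lip2 L f := forall z h k,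
  `|f (z + h + k) - f (z + h) - f (z + k) + f z| <= L * `|h| * `|k|.

Lemma lipB L f y z : lip L f -> `|f y - f z| <= L * `|y - z|.
Proof. by move=> /(_ z (y - z)); rewrite (addrC z) subrK. Qed.

Lemma lip2_iter L g z h (n : nat) : 0 <= L -> lip2 L g ->
  `|g (z + n%:R *: h) - g z - n%:R *: (g (z + h) - g z)|
    <= L * n%:R ^+ 2 * `|h| ^+ 2.
Proof.
move=> L0 g2; elim: n => [|n IH].
  by rewrite !scale0r addr0 !subrr normr0 expr0n/= mulr0 mul0r.
have -> : g (z + n.+1%:R *: h) - g z - n.+1%:R *: (g (z + h) - g z) =
  (g (z + n%:R *: h) - g z - n%:R *: (g (z + h) - g z)) +
  (g (z + n%:R *: h + h) - g (z + n%:R *: h) - g (z + h) + g z).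
  have -> : z + n.+1%:R *: h = z + n%:R *: h + h.
    by rewrite -natr1 scalerDl scale1r addrA.
  rewrite -natr1; vring.
apply: le_trans (ler_normD _ _) _.
apply: le_trans (lerD IH (g2 _ _ _)) _.
rewrite normrZ ger0_norm // -natr1.
have := normr_ge0 h; set x := `|h| => x0.
have n0 : 0 <= n%:R :> R by [].
have : 0 <= L * x ^+ 2 * (n%:R + 1) by rewrite !mulr_ge0 // ?addr_ge0.
nra.
Qed.

Lemma lip2_landau L a g z h : 0 <= L -> (forall z, `|g z| <= a) ->
  lip2 L g -> `|g (z + h) - g z| <= (4 + L) * Num.sqrt a * `|h|.
Proof.
move=> L0 ga g2.
have a0 : 0 <= a by apply: le_trans (ga z).
have g2a : `|g (z + h) - g z| <= 2 * a.
  by apply: le_trans (ler_normB _ _) _; rewrite mulr2n mulrDl mul1r lerD.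
set s := Num.sqrt a; have s0 : 0 <= s by exact: sqrtr_ge0.
have as2 : a = s * s by rewrite -expr2 sqr_sqrtr.
have x0 := normr_ge0 h.
have [sh|hs] := lerP s `|h|.
  apply: le_trans g2a _; rewrite as2; have := ler_wpM2l s0 sh.
  have : 0 <= L * s * `|h| by rewrite !mulr_ge0.
  have : 0 <= s * `|h| by rewrite !mulr_ge0.
  lra.
have [h0|h0] := eqVneq `|h| 0.
  by move/normr0_eq0 : h0 => ->; rewrite addr0 subrr normr0 mulr0.
have hgt : 0 < `|h| by rewrite lt_neqAle eq_sym h0.
set N := Num.truncn (s / `|h|).
have sh0 : 0 <= s / `|h| by rewrite divr_ge0.
have /andP[N1 N2] := truncn_itv sh0; rewrite -/N in N1 N2.
have Nge1 : (1 <= N)%N.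
  by rewrite /N truncn_ge_nat // ler_pdivlMr // mul1r ltW.
have N1' : N%:R * `|h| <= s by rewrite -ler_pdivlMr.
have N2' : s <= 2 * N%:R * `|h|.
  apply: (@le_trans _ _ (N.+1%:R * `|h|)); first by rewrite -ler_pdivrMr // ltW.
  by rewrite ler_wpM2r // -natrM ler_nat mul2n -addnn -addn1 leq_add2l.
have := lip2_iter z h N L0 g2.
set D := g (z + h) - g z => I.
have {}I : N%:R * `|D| <= 2 * a + L * N%:R ^+ 2 * `|h| ^+ 2.
  rewrite -[N%:R]ger0_norm // -normrZ.
  have -> : N%:R *: D = (g (z + N%:R *: h) - g z) -
     (g (z + N%:R *: h) - g z - N%:R *: D) by vring.
  apply: le_trans (ler_normB _ _) _; apply: lerD; last first.
    by rewrite ger0_norm.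
  by apply: le_trans (ler_normB _ _) _; rewrite mulr2n mulrDl mul1r lerD.
have N0 : 0 < N%:R :> R by rewrite ltr0n.
rewrite -(ler_pM2l N0); apply: le_trans I _.
move: N1' N2' N0; rewrite as2; set n := N%:R; set x := `|h| => N1' N2' N0.
have : s * s <= 2 * n * x * s by rewrite ler_wpM2r.
have : L * (n * x) * (n * x) <= L * (n * x) * s.
  by rewrite ler_wpM2l // !mulr_ge0 // ltW.
nra.
Qed.

End increments.

Section two_variables.
Context {R : realType} {d : nat}.
Local Notation V := 'rV[R]_d.

(* |x - y| <= min(2 M, L |y - y'|) absorbed into a square root *)
Lemma le_sqrt_interp (A B t x : R) : 0 <= A -> 0 <= B -> 0 <= t ->
  x <= A -> x <= B * t -> x <= (A + B) * Num.sqrt t.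
Proof.
move=> A0 B0 t0 xA xB.
have s0 := sqrtr_ge0 t; set s := Num.sqrt t in s0 *.
have ts : t = s * s by rewrite -expr2 sqr_sqrtr.
have [s1|s1] := lerP 1 s.
  have : A * 1 <= A * s by rewrite ler_wpM2l.
  have : 0 <= B * s by rewrite mulr_ge0.
  lra.
have : B * (s * s) <= B * (1 * s) by rewrite ler_wpM2l // ler_wpM2r // ltW.
have : 0 <= A * s by rewrite mulr_ge0.
rewrite ts in xB; lra.
Qed.

(* The mixed increment of a function that is C^{1,1} in each variable
   separately: only the exponent 1/2 is available in the other variable. *)
Lemma mixed_increment (L : R) (f : V -> V -> V) y y' z h : 0 <= L ->
  (forall z, lip L (f^~ z)) -> (forall y, lip2 L (f y)) ->
  `|f y (z + h) - f y z - f y' (z + h) + f y' z| <=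
    (4 + 2 * L) * Num.sqrt L * Num.sqrt `|y - y'| * `|h|.
Proof.
move=> L0 f1 f2.
have := @lip2_landau _ _ (2 * L) (L * `|y - y'|) (fun z => f y z - f y' z) z h.
have -> : f y (z + h) - f y' (z + h) - (f y z - f y' z) =
  f y (z + h) - f y z - f y' (z + h) + f y' z by vring.
rewrite sqrtrM // !mulrA; apply.
- by rewrite mulr_ge0.
- by move=> w; exact: (lipB _ _ (f1 w)).
- move=> w u k; have := f2 y w u k; have := f2 y' w u k => A B.
  have -> : f y (w + u + k) - f y' (w + u + k) - (f y (w + u) - f y' (w + u)) -
    (f y (w + k) - f y' (w + k)) + (f y w - f y' w) =
   (f y (w + u + k) - f y (w + u) - f y (w + k) + f y w) -
   (f y' (w + u + k) - f y' (w + u) - f y' (w + k) + f y' w) by vring.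
  by apply: le_trans (ler_normB _ _) _; lra.
Qed.

Definition mixC (L : R) : R := (4 + 2 * L) * Num.sqrt L + 4 * L.

Lemma mixC_ge0 L : 0 <= L -> 0 <= mixC L.
Proof.
by move=> L0; rewrite addr_ge0 ?mulr_ge0 ?sqrtr_ge0 ?addr_ge0 ?mulr_ge0.
Qed.

Lemma lip2_quad (L : R) (g : V -> V) z1 z2 z1' z2' : 0 <= L ->
  lip L g -> lip2 L g ->
  `|g z1 - g z2 - g z1' + g z2'| <=
    3 * L * `|z1 - z2| * Num.sqrt `|z2 - z2'| + L * `|z1 - z2 - z1' + z2'|.
Proof.
move=> L0 g1 g2.
set k := z1 - z2.
have -> : g z1 - g z2 - g z1' + g z2' =
  (g (z2' + (z2 - z2') + k) - g (z2' + (z2 - z2')) - g (z2' + k) + g z2')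
  + (g (z2' + k) - g z1').
  have -> : z2' + (z2 - z2') + k = z1 by rewrite /k; vring.
  have -> : z2' + (z2 - z2') = z2 by vring.
  vring.
apply: le_trans (ler_normD _ _) _; apply: lerD; last first.
  apply: le_trans (lipB _ _ g1) _.
  by rewrite ler_wpM2l // le_eqVlt; apply/orP; left; apply/eqP; congr `|_|; rewrite /k; vring.
set D := _ + g z2'.
have D1 : `|D| <= 2 * L * `|k|.
  have -> : D = (g (z2' + (z2 - z2') + k) - g (z2' + (z2 - z2'))) - (g (z2' + k) - g z2').
    by rewrite /D; vring.
  apply: le_trans (ler_normB _ _) _.
  by have := g1 (z2' + (z2 - z2')) k; have := g1 z2' k; lra.
have D2 : `|D| <= L * `|k| * `|z2 - z2'|.
  by apply: le_trans (g2 _ _ _) _; rewrite -!mulrA (mulrC `|k|).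
have -> : 3 * L * `|k| = 2 * L * `|k| + L * `|k| by lra.
by apply: le_sqrt_interp => //; rewrite !mulr_ge0.
Qed.

Lemma quad_increment (L : R) (f : V -> V -> V) y y' z1 z2 z1' z2' : 0 <= L ->
  (forall z, lip L (f^~ z)) -> (forall y, lip L (f y)) ->
  (forall y, lip2 L (f y)) ->
  `|f y z1 - f y z2 - f y' z1' + f y' z2'| <=
    mixC L * `|z1 - z2| * (Num.sqrt `|y - y'| + Num.sqrt `|z2 - z2'|)
    + L * `|z1 - z2 - z1' + z2'|.
Proof.
move=> L0 fy fz fz2.
have -> : f y z1 - f y z2 - f y' z1' + f y' z2' =
  (f y (z2 + (z1 - z2)) - f y z2 - f y' (z2 + (z1 - z2)) + f y' z2)
  + (f y' z1 - f y' z2 - f y' z1' + f y' z2').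
  by rewrite (addrC z2) subrK; vring.
apply: le_trans (ler_normD _ _) _.
apply: le_trans (lerD (mixed_increment _ _ _ _ L0 fy fz2)
  (lip2_quad _ _ _ _ L0 (fz y') (fz2 y'))) _.
rewrite addrA lerD2r /mixC.
have a0 := normr_ge0 (z1 - z2); set a := `|z1 - z2| in a0 *.
have b0 := sqrtr_ge0 `|y - y'|; set b := Num.sqrt _ in b0 *.
have c0 := sqrtr_ge0 `|z2 - z2'|; set c := Num.sqrt _ in c0 *.
have l0 := sqrtr_ge0 L; set l := Num.sqrt L in l0 *.
have : 0 <= L * a * b by rewrite !mulr_ge0.
have : 0 <= L * a * c by rewrite !mulr_ge0.
have : 0 <= (4 + 2 * L) * l * a * c by rewrite !mulr_ge0 // addr_ge0 // mulr_ge0.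
lra.
Qed.

End two_variables.

Section composition.
Context {R : realType} {d : nat}.
Local Notation V := 'rV[R]_d.

Definition C11_pair (L : R) (f : V -> V -> V) :=
  [/\ forall z, lip L (f^~ z), forall y, lip L (f y),
      forall z, lip2 L (f^~ z) & forall y, lip2 L (f y)].

Definition compC (L : R) : R :=
  mixC L * (1 + L) * (1 + Num.sqrt L) + 3 * L ^+ 2 + L.

Lemma compC_ge0 L : 0 <= L -> 0 <= compC L.
Proof.
move=> L0; by rewrite /compC !addr_ge0 // !mulr_ge0 ?mixC_ge0 ?exprn_ge0 ?addr_ge0 ?sqrtr_ge0.
Qed.

Lemma composite_increment (L : R) (f : V -> V -> V) (m : V -> V) y y' u :
  0 <= L -> C11_pair L f -> lip L m -> lip2 L m ->
  `|f (y + u) (m (y + u)) - f y (m y)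
    - f (y' + u) (m (y' + u)) + f y' (m y')| <=
  compC L * `|u| * Num.sqrt `|y - y'|.
Proof.
move=> L0 [fy fz fy2 fz2] m1 m2.
have M0 := mixC_ge0 L0.
have u0 := normr_ge0 u; have s0 := sqrtr_ge0 `|y - y'|.
have l0 := sqrtr_ge0 L.
have -> : f (y + u) (m (y + u)) - f y (m y)
    - f (y' + u) (m (y' + u)) + f y' (m y') =
  (f (y + u) (m (y + u)) - f y (m (y + u))
   - f (y' + u) (m (y' + u)) + f y' (m (y' + u))) +
  (f y (m (y + u)) - f y (m y) - f y' (m (y' + u)) + f y' (m y')) by vring.
apply: le_trans (ler_normD _ _) _.
have mm z z' : Num.sqrt `|m z - m z'| <= Num.sqrt L * Num.sqrt `|z - z'|.
  by rewrite -sqrtrM // ler_wsqrtr // lipB.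
have H1 := quad_increment (f := fun z y => f y z) (m (y + u)) (m (y' + u))
  (y + u) y (y' + u) y' L0 fz fy fy2.
have H2 := quad_increment y y' (m (y + u)) (m y) (m (y' + u)) (m y') L0 fy fz fz2.
have H3 : `|m (y + u) - m y - m (y' + u) + m y'| <=
    3 * L * `|u| * Num.sqrt `|y - y'|.
  have -> : 3 * L * `|u| = 2 * L * `|u| + L * `|u| by lra.
  apply: le_sqrt_interp => //; rewrite ?mulr_ge0 //.
    have -> : m (y + u) - m y - m (y' + u) + m y' =
      (m (y + u) - m y) - (m (y' + u) - m y') by vring.
    apply: le_trans (ler_normB _ _) _.
    by have := m1 y u; have := m1 y' u; lra.
  have := m2 y' (y - y') u.
  have -> : y' + (y - y') + u = y + u by vring.
  have -> : y' + (y - y') = y by vring.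
  have -> : L * `|y - y'| * `|u| = L * `|u| * `|y - y'| by ring.
  by [].
have H4 := mm (y + u) (y' + u).
have e1 : y + u - (y' + u) = y - y' by vring.
rewrite e1 in H4.
have H5 := mm y y'.
have e2 : y + u - y = u by vring.
have e3 : u - (y' + u) + y' = 0 by vring.
rewrite e2 e3 normr0 mulr0 addr0 in H1.
have H6 := lipB (y + u) y m1; rewrite e2 in H6.
apply: le_trans (lerD H1 H2) _.
move: s0 H3 H4 H5 H6; set s := Num.sqrt `|y - y'|.
set l := Num.sqrt L in l0 *; set a := `|u| in u0 *.
move=> s0 H3 H4 H5 H6.
apply: (@le_trans _ _ (mixC L * a * (l * s + s) +
  (mixC L * (L * a) * (s + l * s) + L * (3 * L * a * s)))).
  apply: lerD.
    by rewrite ler_wpM2l ?mulr_ge0 // lerD2r.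
  apply: lerD; last by rewrite ler_wpM2l.
  apply: ler_pM.
  - by rewrite mulr_ge0.
  - by rewrite addr_ge0 // sqrtr_ge0.
  - by rewrite ler_wpM2l.
  - by rewrite lerD2l.
rewrite /compC -/l.
have : 0 <= L * a * s by rewrite !mulr_ge0.
lra.
Qed.

Lemma composite_difference (L D : R) (f : V -> V -> V) (m m' : V -> V) y y' :
  0 <= L -> 0 <= D -> C11_pair L f -> lip L m' ->
  (forall y, `|m y - m' y| <= D) ->
  `|m y - m' y - m y' + m' y'| <= D * Num.sqrt `|y - y'| ->
  `|f y (m y) - f y (m' y) - f y' (m y') + f y' (m' y')| <=
  compC L * D * Num.sqrt `|y - y'|.
Proof.
move=> L0 D0 [fy fz fy2 fz2] m1 mD mm.
have M0 := mixC_ge0 L0.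
have s0 := sqrtr_ge0 `|y - y'|.
have l0 := sqrtr_ge0 L.
apply: le_trans (quad_increment _ _ _ _ _ _ L0 fy fz fz2) _.
have : Num.sqrt `|m' y - m' y'| <= Num.sqrt L * Num.sqrt `|y - y'|.
  by rewrite -sqrtrM // ler_wsqrtr // lipB.
move: s0 mm; set s := Num.sqrt `|y - y'|.
set l := Num.sqrt L in l0 *.
move=> s0 mm H.
apply: (@le_trans _ _ (mixC L * D * (s + l * s) + L * (D * s))).
  apply: lerD; last by rewrite ler_wpM2l.
  apply: ler_pM.
  - by rewrite mulr_ge0.
  - by rewrite addr_ge0 // sqrtr_ge0.
  - by rewrite ler_wpM2l.
  - by rewrite lerD2l.
rewrite /compC -/l.
have : 0 <= L ^+ 2 * D * s by rewrite !mulr_ge0.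
have : 0 <= mixC L * L * (1 + l) * D * s by rewrite !mulr_ge0 // addr_ge0.
lra.
Qed.

End composition.

Section norms.
Context {R : realType} {d : nat}.
Implicit Types v : 'rV[R]_d.

Lemma mx_entry_norm_le m n (A : 'M[R]_(m, n)) i j : `|A i j| <= `|A|.
Proof.
rewrite [leRHS]/Num.norm /= mx_normrE; apply/bigmax_geP; right => /=.
by exists (i, j).
Qed.

Lemma mx_norm_le m n (A : 'M[R]_(m, n)) (M : R) : 0 <= M ->
  (forall i j, `|A i j| <= M) -> `|A| <= M.
Proof.
move=> M0 AM; rewrite [leLHS]/Num.norm /= mx_normrE; apply/bigmax_leP.
by split => // -[i j] _ /=.
Qed.

Lemma rV_norm_le v (M : R) : 0 <= M -> (forall i, `|v ord0 i| <= M) -> `|v| <= M.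
Proof. by move=> M0 vM; apply: mx_norm_le => // i j; rewrite ord1. Qed.

Lemma mx_entry_enorm_le m n (A : 'M[R]_(m, n)) i j : `|A i j| <= enorm A.
Proof.
rewrite -sqrtr_sqr ler_wsqrtr // (bigD1 i) //= (bigD1 j) //= -addrA lerDl.
apply: addr_ge0; apply: sumr_ge0 => // k _; first exact: sqr_ge0.
by apply: sumr_ge0 => // l _; exact: sqr_ge0.
Qed.

Lemma mx_norm_enorm m n (A : 'M[R]_(m, n)) : `|A| <= enorm A.
Proof. by apply: mx_norm_le => [|i j]; [exact: sqrtr_ge0|exact: mx_entry_enorm_le]. Qed.

Lemma enorm_le m n (A : 'M[R]_(m, n)) : enorm A <= (m * n)%:R * `|A|.
Proof.
rewrite -[leRHS]ger0_norm ?mulr_ge0 // -sqrtr_sqr ler_wsqrtr //.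
apply: (@le_trans _ _ (\sum_(i < m) \sum_(j < n) `|A| ^+ 2)).
  apply: ler_sum => i _; apply: ler_sum => j _.
  by rewrite -[leLHS]real_normK ?num_real // lerXn2r ?nnegrE // mx_entry_norm_le.
rewrite !sumr_const !card_ord -mulrnA mulnC exprMn -[leLHS]mulr_natl.
rewrite ler_wpM2r ?exprn_ge0 //.
by rewrite -natrX ler_nat; case: (m * n)%N => // k; rewrite -{1}[k.+1]muln1 expnS expn1 leq_mul2l.
Qed.

Lemma enorm_ge0 m n (A : 'M[R]_(m, n)) : 0 <= enorm A.
Proof. exact: sqrtr_ge0. Qed.

End norms.

Section C11b_increments.
Context {R : realType} {d : nat}.
Local Notation V := 'rV[R]_d.

Lemma is_derive_line (f : V -> V) (y v : V) (i : 'I_d) (t : R) :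
  differentiable f (y + t *: v) ->
  is_derive t 1 (fun t => f (y + t *: v) ord0 i)
    ((v *m jacobian f (y + t *: v)) ord0 i).
Proof.
move=> df.
set g := fun t => _.
have H : (fun h => h^-1 *: ((g \o shift t) (h *: (1:R)) - g t)) @ 0^' -->
   ((v *m jacobian f (y + t *: v)) ord0 i : R).
  have := diff_derivable df (v := v); rewrite /derivable => /cvg_ex[/= l Hl].
  have <- : l = v *m jacobian f (y + t *: v).
    rewrite -deriveEjacobian //; apply/esym/cvg_lim => //.
  have := @cvg_comp _ _ _ _ (fun M : V => M ord0 i) _ _ _ Hl
    (@coord_continuous _ _ _ ord0 i l).
  apply: cvg_trans; apply: near_eq_cvg.
  near=> h; rewrite /= /g /= !mxE; congr (_ * (f _ _ _ - _)).
  by rewrite /GRing.scale/= mulr1; vring.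
apply: DeriveDef; first by apply/cvg_ex; eexists; exact: H.
by apply: cvg_lim.
Unshelve. all: by end_near. Qed.

Lemma rV_mulmx_entry (v : V) (J : 'M[R]_d) (M : R) i :
  enorm J <= M -> `|(v *m J) ord0 i| <= d%:R * M * `|v|.
Proof.
move=> JM; rewrite mxE; apply: le_trans (ler_norm_sum _ _ _) _.
apply: (@le_trans _ _ (\sum_(j < d) M * `|v|)).
  apply: ler_sum => j _; rewrite normrM mulrC; apply: ler_pM => //.
    by apply: le_trans JM; exact: mx_entry_enorm_le.
  exact: mx_entry_norm_le.
by rewrite sumr_const card_ord -[leLHS]mulr_natl mulrA.
Qed.

Lemma C11b_lip C (f : V -> V) : C11b C f -> lip (d%:R * C) f.
Proof.
move=> [[df _] JC _] y v.
have C0 : 0 <= C by apply: le_trans (JC y); exact: sqrtr_ge0.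
apply: rV_norm_le => [|i]; first by rewrite !mulr_ge0.
pose g t := f (y + t *: v) ord0 i.
have [|c _] := @MVT R g (fun t => (v *m jacobian f (y + t *: v)) ord0 i) 0 1 ltr01
  (fun t _ => is_derive_line i (df _)).
  by apply: derivable_within_continuous => t _; case: (is_derive_line (v := v) (t := t) i (df (y + t *: v))).
rewrite /g scale0r scale1r addr0 subr0 mulr1 => E.
rewrite !mxE [X in `|X|]E.
exact: rV_mulmx_entry.
Qed.

Lemma C11b_lip2 C (f : V -> V) : C11b C f -> lip2 (d%:R * C * d%:R) f.
Proof.
move=> [[df _] JC JL] y v k.
have C0 : 0 <= C by apply: le_trans (JC y); exact: sqrtr_ge0.
apply: rV_norm_le => [|i]; first by rewrite !mulr_ge0.
pose g t := f (y + k + t *: v) ord0 i - f (y + t *: v) ord0 i.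
have dg (t : R) : is_derive t 1 g ((v *m jacobian f (y + k + t *: v)) ord0 i -
      (v *m jacobian f (y + t *: v)) ord0 i).
  exact: (is_deriveB (is_derive_line i (df (y + k + t *: v)))
    (is_derive_line i (df (y + t *: v)))).
have [|c _] := @MVT R g (fun t => (v *m jacobian f (y + k + t *: v)) ord0 i -
      (v *m jacobian f (y + t *: v)) ord0 i) 0 1 ltr01 (fun t _ => dg t).
  by apply: derivable_within_continuous => t _; case: (dg t).
rewrite /g !scale0r !scale1r !addr0 subr0 mulr1 => E.
have -> : (f (y + v + k) - f (y + v) - f (y + k) + f y) ord0 i =
  f (y + k + v) ord0 i - f (y + v) ord0 i - (f (y + k) ord0 i - f y ord0 i).
  have -> : y + k + v = y + v + k by rewrite addrAC.
  move: (f (y + v + k)) (f (y + v)) (f (y + k)) (f y) => p q r s.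
  by rewrite !mxE; ring.
rewrite {}E.
have -> : (v *m jacobian f (y + k + c *: v)) ord0 i -
   (v *m jacobian f (y + c *: v)) ord0 i =
   (v *m (jacobian f (y + k + c *: v) - jacobian f (y + c *: v))) ord0 i.
  by rewrite mulmxBr [RHS]mxE; congr (_ + _); rewrite [RHS]mxE.
apply: le_trans (rV_mulmx_entry _ _ (JL _ _)) _.
have -> : y + k + c *: v - (y + c *: v) = k by vring.
have := enorm_le k; rewrite mul1n => H.
have : d%:R * C * `|v| * enorm k <= d%:R * C * `|v| * (d%:R * `|k|).
  by rewrite ler_wpM2l // !mulr_ge0.
lra.
Qed.

End C11b_increments.

(** * The Borel sigma-algebra of R^d *)

Lemma bigsetI_forall (T : Type) (I : finType) (F : I -> set T) :
  \big[setI/setT]_i F i = [set x | forall i, F i x].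
Proof.
rewrite -bigcap_seq; apply/seteqP; split => x /= H i; last by move=> _; exact: H.
by apply: H => /=; rewrite mem_index_enum.
Qed.

Section borel_rV.
Context {R : realType} {d : nat}.
Local Notation V := 'rV[R]_d.
Local Notation BV := (borel_rV R d).

Definition rV_box (D : 'I_d -> set (measurableTypeR R)) : set BV :=
  [set v | forall i, D i (v ord0 i)].

Definition rV_boxes : set (set BV) :=
  [set U | exists2 D, (forall i, measurable (D i)) & U = rV_box D].

Lemma rV_boxes_setI : setI_closed rV_boxes.
Proof.
move=> _ _ [D mD ->] [E mE ->]; exists (fun i => D i `&` E i).
  by move=> i; exact: measurableI.
apply/seteqP; split => v /=.
  by move=> [vD vE] i; split.
by move=> H; split => i; case: (H i).
Qed.

Lemma rV_boxes_setT : rV_boxes setT.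
Proof. by exists (fun _ => setT) => //; apply/seteqP; split. Qed.

Lemma rV_ballE (c : V) r : 0 < r ->
  ball c r = rV_box (fun i => ball (c ord0 i) r).
Proof.
move=> r0; apply/seteqP; split => v /=.
  by move=> [_ H] i; exact: H.
by move=> H; split => // i j; rewrite ord1.
Qed.

Lemma open_rV_bigcup (U : set V) : open U ->
  exists F : nat -> set BV, (forall n, rV_boxes (F n) \/ F n = set0) /\
    U = \bigcup_n F n.
Proof.
move=> oU.
pose c (q : 'rV[rat]_d) : V := \row_i ratr (q ord0 i).
pose good (q : 'rV[rat]_d) (n : nat) := `[< ball (c q) (n.+1%:R^-1) `<=` U >].
pose F k := if @unpickle ('rV[rat]_d * nat)%type k is Some (q, n) then
  if good q n then ball (c q) (n.+1%:R^-1) else set0 else set0 : set BV.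
exists F; split.
  move=> k; rewrite /F; case: unpickle => [[q n]|]; last by right.
  case: ifP => _; last by right.
  left; rewrite rV_ballE; last by rewrite invr_gt0.
  exists (fun i => ball (c q ord0 i) n.+1%:R^-1) => // i.
  by apply: open_measurable; exact: ball_open.
apply/seteqP; split => [v Uv|v [k _]]; last first.
  rewrite /F; case: unpickle => [[q n]|//].
  by case: ifP => // /asboolP; apply.
have : nbhs v U by rewrite nbhsE; exists U.
move=> /nbhs_ballP[e /= e0 ve].
have [n ne] : exists n, 2 * n.+1%:R^-1 < e.
  have e20 : 0 < e / 2 by rewrite divr_gt0.
  exists (Num.truncn (e / 2)^-1); rewrite mulrC -ltr_pdivlMr //.
  rewrite invf_plt ?posrE //.
  have e2i : 0 <= (e / 2)^-1 by rewrite invr_ge0 ltW.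
  by have /andP[] := truncn_itv e2i.
set r := n.+1%:R^-1 in ne; have r0 : 0 < r by rewrite invr_gt0.
have [q vq] : exists q, ball (c q) r v.
  have /choice[s Hs] : forall i, exists x : rat, `|v ord0 i - ratr x| < r.
    move=> i.
    have /rat_in_itvoo[x] : v ord0 i - r < v ord0 i + r by lra.
    by rewrite in_itv /= => /andP[? ?]; exists x; rewrite ltr_distlC; apply/andP; split; lra.
  exists (\row_i s i); rewrite rV_ballE // => i.
  by rewrite /ball /= !mxE distrC; exact: Hs.
exists (pickle (q, n)) => //; rewrite /F pickleK ifT //.
apply/asboolP => w qw; apply: ve.
apply: (@le_ball _ _ _ (r + r)); first by rewrite -mulr2n -mulr_natl ltW.
by apply: ball_triangle qw; exact: ball_sym.
Qed.

Lemma measurable_rV_coord (i : 'I_d) :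
  measurable_fun [set: BV] (fun v : BV => v ord0 i : measurableTypeR R).
Proof.
apply: (measurability _ (RGenOInfty.measurableE R)).
move=> _ [_ [x ->] <-]; rewrite setTI.
apply: sub_sigma_algebra => /=.
apply: open_comp; last by rewrite set_itvE; exact: open_gt.
by move=> v _; exact: (@coord_continuous R 1 d ord0 i v).
Qed.

Lemma measurable_rV_box D : (forall i, measurable (D i)) ->
  measurable (rV_box D : set BV).
Proof.
move=> mD.
have -> : rV_box D = \big[setI/setT]_(i < d) ((fun v : BV => v ord0 i) @^-1` D i).
  apply/seteqP; split => v; rewrite bigsetI_forall; exact.
apply: bigsetI_measurable => i _.
by rewrite -[X in measurable X]setTI; exact: measurable_rV_coord.
Qed.

Lemma measurable_rV_boxesE (A : set BV) : measurable A -> <<s rV_boxes >> A.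
Proof.
move=> mA.
apply: (mA) => /=; split; first exact: smallest_sigma_algebra.
move=> U /open_rV_bigcup[F [FU ->]].
apply: (@bigcupT_measurable _ (g_sigma_algebraType rV_boxes)) => n.
case: (FU n) => [?|->]; first exact: sub_sigma_algebra.
exact: (@measurable0 _ (g_sigma_algebraType rV_boxes)).
Qed.

Lemma measurable_to_rV dT (T : measurableType dT) (D : set T) (f : T -> BV) :
  (forall i, measurable_fun D (fun t => f t ord0 i : measurableTypeR R)) ->
  measurable_fun D f.
Proof.
move=> mf mD A /measurable_rV_boxesE.
apply: (@smallest_sub _ (sigma_algebra setT) rV_boxes
  [set B | measurable (D `&` f @^-1` B)]).
  split => /=.
  - by rewrite preimage_set0 setI0.
  - move=> B mB /=; rewrite setTD.
    have -> : D `&` f @^-1` (~` B) = D `\` (D `&` f @^-1` B).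
      apply/seteqP; split => t /=; first by move=> [Dt nB]; split => // -[].
      by move=> [Dt nB]; split => // fB; apply: nB.
    exact: measurableD.
  - move=> F mF /=; rewrite preimage_bigcup setI_bigcupr.
    exact: bigcupT_measurable.
move=> _ [E mE ->] /=.
have -> : D `&` f @^-1` rV_box E =
   D `&` \big[setI/setT]_(i < d) (D `&` (fun t => f t ord0 i) @^-1` E i).
  apply/seteqP; split => t; rewrite bigsetI_forall /=.
    by move=> [Dt H]; split => // i; split => //; exact: H.
  by move=> [Dt H]; split => // i; case: (H i).
apply: measurableI => //; apply: bigsetI_measurable => i _; exact: mf.
Qed.

Lemma measurable_to_rVP dT (T : measurableType dT) (f : T -> BV) :
  measurable_fun setT f <->
  (forall i, measurable_fun setT (fun t => f t ord0 i : measurableTypeR R)).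
Proof.
split=> [mf i|]; last exact: measurable_to_rV.
exact: (measurableT_comp (measurable_rV_coord i) mf).
Qed.

End borel_rV.

(** * Integrals of bounded measurable functions *)

Definition bmf {R : realType} {dT} {T : measurableType dT} (f : T -> R) :=
  measurable_fun setT f /\ exists M, forall x, `|f x| <= M.

Section bounded_measurable.
Context {R : realType} {dT} {T : measurableType dT}.
Implicit Types f g : T -> R.

Lemma bmf_cst c : bmf (fun _ : T => c : R).
Proof. by split; [exact: measurable_cst|exists `|c|]. Qed.

Lemma bmfD f g : bmf f -> bmf g -> bmf (fun x => f x + g x).
Proof.
move=> [mf [M fM]] [mg [N gN]]; split; first exact: measurable_funD.
by exists (M + N) => x; apply: le_trans (ler_normD _ _) _; exact: lerD.
Qed.

Lemma bmfN f : bmf f -> bmf (fun x => - f x).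
Proof.
move=> [mf [M fM]]; split; first exact: measurableT_comp.
by exists M => x; rewrite normrN.
Qed.

Lemma bmfB f g : bmf f -> bmf g -> bmf (fun x => f x - g x).
Proof. by move=> bf bg; apply: bmfD => //; exact: bmfN. Qed.

Lemma bmfM f g : bmf f -> bmf g -> bmf (fun x => f x * g x).
Proof.
move=> [mf [M fM]] [mg [N gN]]; split; first exact: measurable_funM.
by exists (M * N) => x; rewrite normrM ler_pM.
Qed.

Lemma bmf_norm f : bmf f -> bmf (fun x => `|f x|).
Proof.
move=> [mf [M fM]]; split; first exact: measurableT_comp.
by exists M => x; rewrite normr_id.
Qed.

Lemma bmf_comp dS (S : measurableType dS) (h : S -> T) f :
  measurable_fun setT h -> bmf f -> bmf (fun x => f (h x)).
Proof.
by move=> mh [mf [M fM]]; split; [exact: measurableT_comp|exists M].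
Qed.

End bounded_measurable.

Section finite_measure_integrals.
Context {R : realType} {dT} {T : measurableType dT}.
Variable mu : {finite_measure set T -> \bar R}.
Implicit Types f g : T -> R.

Lemma bmf_integrable (D : set T) f : measurable D -> bmf f ->
  mu.-integrable D (EFin \o f).
Proof.
move=> mD [mf [M fM]].
apply: (integrableS measurableT mD (@subsetT _ D)).
apply: measurable_bounded_integrable => //.
  by rewrite -ge0_fin_numE // fin_num_measure.
exists M; split; first exact: num_real.
by move=> x Mx y _ /=; exact: le_trans (fM y) (ltW Mx).
Qed.

Lemma bmf_intD f g : bmf f -> bmf g ->
  \int[mu]_x (f x + g x) = \int[mu]_x f x + \int[mu]_x g x.
Proof. by move=> bf bg; apply: RintegralD => //; exact: bmf_integrable. Qed.

Lemma bmf_intB f g : bmf f -> bmf g ->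
  \int[mu]_x (f x - g x) = \int[mu]_x f x - \int[mu]_x g x.
Proof. by move=> bf bg; apply: RintegralB => //; exact: bmf_integrable. Qed.

Lemma bmf_intZ c f : bmf f -> \int[mu]_x (c * f x) = c * \int[mu]_x f x.
Proof. by move=> bf; apply: RintegralZl => //; exact: bmf_integrable. Qed.

Lemma bmf_int_le f g : bmf f -> bmf g -> (forall x, f x <= g x) ->
  \int[mu]_x f x <= \int[mu]_x g x.
Proof.
by move=> bf bg fg; apply: le_Rintegral => //; exact: bmf_integrable.
Qed.

Lemma bmf_int_norm f : bmf f -> `|\int[mu]_x f x| <= \int[mu]_x `|f x|.
Proof. by move=> bf; apply: le_normr_Rintegral => //; exact: bmf_integrable. Qed.

Lemma bmf_intE f : bmf f -> (\int[mu]_x f x)%:E = (\int[mu]_x (f x)%:E)%E.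
Proof.
by move=> bf; rewrite fineK //; apply: integrable_fin_num => //; exact: bmf_integrable.
Qed.

End finite_measure_integrals.

Section probability_integrals.
Context {R : realType} {dT} {T : measurableType dT}.
Variable P : probability T R.
Implicit Types f g : T -> R.

Lemma int_prob_cst (c : R) : \int[P]_x c = c.
Proof. by rewrite Rintegral_cst // [X in fine X](probability_setT P) /= mulr1. Qed.

Lemma bmf_int_ub f M : bmf f -> (forall x, `|f x| <= M) ->
  `|\int[P]_x f x| <= M.
Proof.
move=> bf fM; apply: le_trans (bmf_int_norm P bf) _.
rewrite -[leRHS](int_prob_cst M); apply: bmf_int_le => //.
  exact: bmf_norm.
exact: bmf_cst.
Qed.

End probability_integrals.

Section Fubini_bounded.
Context {R : realType} {d1 d2} {T1 : measurableType d1} {T2 : measurableType d2}.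
Variables (m1 : {finite_measure set T1 -> \bar R}) (m2 : {finite_measure set T2 -> \bar R}).
Variable f : T1 * T2 -> R.
Hypothesis bf : bmf f.

Let intf : (m1 \x m2)%E.-integrable setT (EFin \o f).
Proof.
have [mf [M fM]] := bf.
apply: measurable_bounded_integrable => //; last first.
  exists M; split; first exact: num_real.
  by move=> x Mx y _ /=; exact: le_trans (fM y) (ltW Mx).
have H : (m1 \x m2)%E setT = (m1 setT * m2 setT)%E.
  by rewrite -setXTT; exact: product_measure1E.
apply: (@le_lt_trans _ _ (m1 setT * m2 setT)%E).
  by rewrite -H; exact: lexx.
rewrite lte_mul_pinfty //.
  exact: fin_num_measure.
by rewrite ltey_eq fin_num_measure.
Qed.

Lemma bmf_Fubini :
  \int[m1]_x \int[m2]_y f (x, y) = \int[m2]_y \int[m1]_x f (x, y).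
Proof.
rewrite /Rintegral.
have H1 x : (fine (\int[m2]_y (f (x, y))%:E))%:E = (\int[m2]_y (f (x, y))%:E)%E.
  rewrite -bmf_intE //; apply: (bmf_comp _ bf); exact: pair1_measurable.
have H2 y : (fine (\int[m1]_x (f (x, y))%:E))%:E = (\int[m1]_x (f (x, y))%:E)%E.
  rewrite -bmf_intE //; apply: (bmf_comp _ bf); exact: pair2_measurable.
under [in LHS]eq_integral do rewrite H1.
under [in RHS]eq_integral do rewrite H2.
by congr fine; exact: (Fubini intf).
Qed.

Lemma bmf_int_inner : bmf (fun x => \int[m2]_y f (x, y)).
Proof.
have bfx x : bmf (fun y => f (x, y)).
  by apply: (bmf_comp _ bf); exact: pair1_measurable.
split.
  rewrite /Rintegral; apply: measurableT_comp => //.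
  exact: (measurable_fubini_F intf).
have [mf [M fM]] := bf.
exists (M * fine (m2 setT)) => x.
apply: le_trans (bmf_int_norm _ (bfx x)) _.
rewrite -Rintegral_cst //; apply: bmf_int_le => //; first exact: bmf_norm.
exact: bmf_cst.
Qed.

End Fubini_bounded.

Section independence.
Context {R : realType} {dO d1 d2} {O : measurableType dO}
  {T1 : measurableType d1} {T2 : measurableType d2}.
Variable P : probability O R.

Lemma independent_Fubini (Z1 : O -> T1) (Z2 : O -> T2) (g : T1 * T2 -> R) :
  measurable_fun setT Z1 -> measurable_fun setT Z2 ->
  (forall A1 A2, measurable A1 -> measurable A2 ->
    P (Z1 @^-1` A1 `&` Z2 @^-1` A2) = (P (Z1 @^-1` A1) * P (Z2 @^-1` A2))%E) ->
  bmf g ->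
  \int[P]_w g (Z1 w, Z2 w) = \int[P]_w \int[P]_w' g (Z1 w, Z2 w').
Proof.
move=> mZ1 mZ2 ind bg.
have [mg [M gM]] := bg.
pose X1 : {mfun O >-> T1} := mfun_Sub (mem_set mZ1).
pose X2 : {mfun O >-> T2} := mfun_Sub (mem_set mZ2).
have mX : measurable_fun setT (fun w => (Z1 w, Z2 w)) by exact: measurable_fun_pair.
pose X : {mfun O >-> (T1 * T2)%type} := mfun_Sub (mem_set mX).
have push dU (U : measurableType dU) (Z : {mfun O >-> U}) (h : U -> R) : bmf h ->
    \int[distribution P Z]_u h u = \int[P]_w h (Z w).
  move=> bh; rewrite /Rintegral integral_distribution //.
  - by apply/measurable_EFinP; case: bh.
  - apply: bmf_integrable => //; apply: bmf_comp bh; exact: measurable_funPT.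
rewrite -[LHS](push _ _ X) //.
have bh : bmf (fun x => \int[distribution P X2]_y g (x, y)).
  exact: (@bmf_int_inner _ _ _ _ _ (distribution P X1)).
transitivity (\int[distribution P X1]_x \int[distribution P X2]_y g (x, y)); last first.
  rewrite push //; apply: eq_Rintegral => w _; rewrite push //.
  by apply: bmf_comp bg; exact: pair1_measurable.
rewrite /Rintegral.
have H1 x : (fine (\int[distribution P X2]_y (g (x, y))%:E))%:E = (\int[distribution P X2]_y (g (x, y))%:E)%E.
  by rewrite -bmf_intE //; apply: (bmf_comp _ bg); exact: pair1_measurable.
under [in RHS]eq_integral do rewrite H1.
congr fine.
transitivity (\int[(distribution P X1 \x distribution P X2)%E]_z (g z)%:E)%E.
  apply: eq_measure_integral => A mA _.
  apply/esym/product_measure_unique => //.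
apply/esym; apply: (integral12_prod_meas1 (f := EFin \o g)).
have I1 : (distribution P X).-integrable setT (EFin \o g) by exact: bmf_integrable.
have [_ I2] := integrableP _ _ _ I1.
apply/integrableP; split; first exact/measurable_EFinP.
apply: le_lt_trans I2; rewrite le_eqVlt; apply/orP; left; apply/eqP.
apply: eq_measure_integral => A mA _.
by apply/product_measure_unique.
Qed.

End independence.

(** * Gaussian shifts *)

Section gaussian_density.
Context {R : realType}.
Local Notation leb := (@lebesgue_measure R).
Implicit Types (s c x : R) (h : R -> R).

Lemma normal_pdf_tilt s c x : s != 0 ->
  normal_pdf c s x =
    expR ((2 * c * x - c ^+ 2) / (2 * s ^+ 2)) * normal_pdf 0 s x.
Proof.
move=> s0; rewrite !normal_pdfE //= mulrCA; congr (_ * _).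
rewrite /normal_fun -expRD; congr expR.
by rewrite -(mulr_natl (s ^+ 2) 2); field.
Qed.

Lemma normal_pdf_tilt_sqr s c x : s != 0 ->
  (expR ((2 * c * x - c ^+ 2) / (2 * s ^+ 2)) - 1) ^+ 2 * normal_pdf 0 s x =
  expR (c ^+ 2 / s ^+ 2) * normal_pdf (2 * c) s x - 2 * normal_pdf c s x
    + normal_pdf 0 s x.
Proof.
move=> s0; rewrite (normal_pdf_tilt (2 * c)) // (normal_pdf_tilt c) //.
set L := expR _.
have -> : expR ((2 * (2 * c) * x - (2 * c) ^+ 2) / (2 * s ^+ 2)) =
   L ^+ 2 * (expR (c ^+ 2 / s ^+ 2))^-1.
  by rewrite -[L ^+ 2]/(L * L) /L -expRD -expRN -expRD; congr expR; field.
have E0 : expR (c ^+ 2 / s ^+ 2) != 0 by rewrite gt_eqF // expR_gt0.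
by field.
Qed.

Lemma normr_le_normal_pdf s x : 0 < s ->
  `|x| * normal_pdf 0 s x <=
    s * expR 1 * (normal_pdf s s x + normal_pdf (- s) s x).
Proof.
move=> s0; have sn0 : s != 0 by rewrite gt_eqF.
rewrite (normal_pdf_tilt s) // (normal_pdf_tilt (- s)) // -mulrDl mulrA.
apply: ler_wpM2r; first exact: normal_pdf_ge0.
set A := (2 * s * x - _) / _; set B := (2 * - s * x - _) / _.
have -> : s * expR 1 * (expR A + expR B) = s * (expR (1 + A) + expR (1 + B)).
  by rewrite !expRD; ring.
rewrite -ler_pdivrMl //.
have a e : e = s \/ e = - s ->
   x / e <= 1 + (2 * e * x - e ^+ 2) / (2 * s ^+ 2).
  have s2 : 0 < s ^+ 2 by rewrite exprn_gt0.
  move=> H; have -> : 1 + (2 * e * x - e ^+ 2) / (2 * s ^+ 2) = x / e + 2^-1.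
    by case: H => ->; field; rewrite ?oppr_eq0 ?sn0.
  by rewrite lerDl.
have H1 : x / s <= expR (1 + A).
  apply: le_trans (a s _) _; first by left.
  by apply: le_trans (expR_ge1Dx _); rewrite lerDr.
have H2 : x / - s <= expR (1 + B).
  apply: le_trans (a (- s) _) _; first by right.
  by apply: le_trans (expR_ge1Dx _); rewrite lerDr.
have H3 := expR_gt0 (1 + A); have H4 := expR_gt0 (1 + B).
rewrite invrN mulrN in H2; rewrite mulrC.
by have [x0|x0] := ger0P x; rewrite ?mulNr; lra.
Qed.

Lemma Rintegral_normal_pdf m s : \int[leb]_x normal_pdf m s x = 1.
Proof. by rewrite /Rintegral integral_normal_pdf. Qed.

Lemma expR_sub1_le (r : R) : 0 <= r -> r <= 1 -> expR r - 1 <= r * expR 1.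
Proof.
move=> r0 r1.
have : expR (- r) >= 1 - r by have := expR_ge1Dx (- r); lra.
have E : expR r * expR (- r) = 1 by rewrite -expRD subrr expR0.
have e0 := expR_gt0 r; move=> H.
have : expR r * (1 - r) <= expR r * expR (- r) by rewrite ler_wpM2l // ltW.
rewrite E => H1.
have : r * expR r <= r * expR 1 by rewrite ler_wpM2l // ler_expR.
lra.
Qed.

End gaussian_density.

Section gaussian_shift.
Context {R : realType}.
Local Notation leb := (@lebesgue_measure R).
Local Notation RR := (measurableTypeR R).

Lemma lebesgue_measure_shift (c : R) (A : set R) : measurable A ->
  pushforward leb (fun x : RR => x + c : RR) A = leb A.
Proof.
move=> mA; apply/esym/lebesgue_measure_unique => //=; first exact: measurable_funD.
move=> _ _ [[a b]] _ <-; rewrite /pushforward /=.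
have -> : (fun x : R => x + c) @^-1` `]a, b]%classic = `](a - c), (b - c)]%classic.
  by apply/seteqP; split => x /=; rewrite !in_itv /= => /andP[? ?]; apply/andP; split; lra.
rewrite !lebesgue_measure_itv /= !lte_fin ltrD2r -!EFinB.
by case: ifPn => // _; congr EFin; ring.
Qed.

Lemma integral_normal_prob_bmf (s c : R) (h : RR -> R) : bmf h ->
  \int[normal_prob c s]_x h x = \int[leb]_x (h x * normal_pdf c s x).
Proof.
move=> bh; rewrite /Rintegral; congr fine.
have bi : (normal_prob c s).-integrable setT (EFin \o h) by exact: bmf_integrable.
have mh : measurable_fun setT (EFin \o h) by apply/measurable_EFinP; case: bh.
rewrite -(Radon_Nikodym_change_of_variables (normal_prob_dominates c s)) //=.
apply: ae_eq_integral => //.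
- apply: emeasurable_funM => //; apply: (measurable_int leb).
  by apply: Radon_Nikodym_integrable; exact: normal_prob_dominates.
- apply/measurable_EFinP; apply: measurable_funM; first by case: bh.
  exact: measurable_normal_pdf.
- under [X in ae_eq _ _ _ X]eq_fun do rewrite EFinM.
  apply: ae_eqe_mul2l => /=.
  rewrite Radon_NikodymE//=; first exact: normal_prob_dominates.
  move=> abmu; case: cid => /= k [k1 k2 k3].
  apply: integral_ae_eq => //=.
  + by apply/measurable_EFinP; exact: measurable_normal_pdf.
  + by move=> E _ mE; rewrite -k3.
Qed.


Lemma normal_prob_shift (s c : R) (h : RR -> R) : s != 0 -> bmf h ->
  \int[normal_prob 0 s]_x h (x + c) = \int[normal_prob c s]_x h x.
Proof.
move=> s0 bh.
have mc : measurable_fun [set: RR] (fun x : RR => x + c : RR).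
  exact: measurable_funD.
have E (A : set R) : measurable A ->
    pushforward (normal_prob 0 s) (fun x : RR => x + c : RR) A = normal_prob c s A.
  move=> mA; rewrite /pushforward /normal_prob.
  transitivity (\int[leb]_(x in (fun x : RR => (x + c)%R) @^-1` A)
      ((fun y => (normal_pdf c s y)%:E) \o (fun x : RR => (x + c)%R)) x)%E.
    apply: eq_integral => x _ /=; congr EFin.
    by rewrite !normal_pdfE // /normal_fun subr0 addrK.
  rewrite -(@ge0_integral_pushforward _ _ _ _ _ (fun x : RR => x + c : RR) mc leb) //=.
  - by apply: eq_measure_integral => B mB _; exact: lebesgue_measure_shift.
  - by apply/measurable_funTS/measurable_EFinP; exact: measurable_normal_pdf.
  - by move=> y _; rewrite lee_fin normal_pdf_ge0.
apply: (congr1 fine).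
have mh : measurable_fun setT (EFin \o h) by apply/measurable_EFinP; case: bh.
have bhc : bmf (fun x : RR => h (x + c : RR)) by exact: (bmf_comp mc bh).
have ih : (normal_prob 0 s).-integrable
    ((fun x : RR => (x + c)%R) @^-1` setT) ((EFin \o h) \o (fun x : RR => (x + c)%R)).
  by rewrite preimage_setT; exact: (bmf_integrable (normal_prob 0 s) measurableT bhc).
have H := integral_pushforward mc mh ih measurableT.
rewrite preimage_setT in H.
rewrite -[LHS]H.
by apply: eq_measure_integral => A mA _; exact: E.
Qed.

Lemma gaussian_tilt_bound (s c W lam : R) (k : RR -> R) (w : RR -> R) : 0 < s -> 0 < lam ->
  `|c| <= s -> bmf k ->
  (forall x, k x ^+ 2 * normal_pdf 0 s x <= w x) ->
  leb.-integrable setT (EFin \o w) -> \int[leb]_x w x <= W ->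
  `|\int[leb]_x (k x * normal_pdf c s x) - \int[leb]_x (k x * normal_pdf 0 s x)|
    <= (lam * W + lam^-1 * (c ^+ 2 / s ^+ 2 * expR 1)) / 2.
Proof.
move=> s0 lam0 cs bk kw iw wW.
have sn0 : s != 0 by rewrite gt_eqF.
have ipdf c' : leb.-integrable setT (EFin \o normal_pdf c' s).
  exact: integrable_normal_pdf.
have ik c' : leb.-integrable setT (EFin \o (fun x => k x * normal_pdf c' s x)).
  have [mk [M kM]] := bk.
  apply: (@le_integrable _ _ _ leb setT measurableT _ (EFin \o (fun x => `|M| * normal_pdf c' s x))).
  - apply/measurable_EFinP; apply: measurable_funM => //.
    exact: measurable_normal_pdf.
  - move=> x _ /=; rewrite lee_fin !normrM ler_wpM2r // normr_id.
    exact: le_trans (kM x) (ler_norm _).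
  - exact: (integrableZl _ _ (ipdf c')).
rewrite -RintegralB //.
apply: le_trans (le_normr_Rintegral _ _) _ => //.
  exact: (integrableB measurableT (ik c) (ik 0)).
pose q x := expR (c ^+ 2 / s ^+ 2) * normal_pdf (2 * c) s x
  - 2 * normal_pdf c s x + normal_pdf 0 s x.
have iq1 : leb.-integrable setT (EFin \o
    (fun x => expR (c ^+ 2 / s ^+ 2) * normal_pdf (2 * c) s x)).
  exact: (integrableZl _ _ (ipdf (2 * c))).
have iq2 : leb.-integrable setT (EFin \o (fun x => 2 * normal_pdf c s x)).
  exact: (integrableZl _ _ (ipdf c)).
have iq3 : leb.-integrable setT (EFin \o (fun x =>
    expR (c ^+ 2 / s ^+ 2) * normal_pdf (2 * c) s x - 2 * normal_pdf c s x)).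
  exact: (integrableB measurableT iq1 iq2).
have iq : leb.-integrable setT (EFin \o q).
  exact: (integrableD measurableT iq3 (ipdf 0)).
have intq : \int[leb]_x q x = expR (c ^+ 2 / s ^+ 2) - 1.
  rewrite /q RintegralD // RintegralB // !RintegralZl // !Rintegral_normal_pdf.
  by ring.
have iw1 : leb.-integrable setT (EFin \o (fun x => lam * w x)).
  exact: (integrableZl _ _ iw).
have iq' : leb.-integrable setT (EFin \o (fun x => lam^-1 * q x)).
  exact: (integrableZl _ _ iq).
have isum : leb.-integrable setT (EFin \o (fun x => lam * w x + lam^-1 * q x)).
  exact: (integrableD measurableT iw1 iq').
apply: (@le_trans _ _ (\int[leb]_x (2^-1 * (lam * w x + lam^-1 * q x)))).
  apply: le_Rintegral => //.
  - apply: (integrable_norm (f := fun x => _)).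
    exact: (integrableB measurableT (ik c) (ik 0)).
  - exact: (integrableZl _ _ isum).
  move=> x _ /=.
  rewrite -mulrBr /q -normal_pdf_tilt_sqr //.
  rewrite (normal_pdf_tilt c) //; set L := expR _.
  have -> : L * normal_pdf 0 s x - normal_pdf 0 s x = (L - 1) * normal_pdf 0 s x.
    by rewrite mulrBl mul1r.
  have p0 := normal_pdf_ge0 0 s x; set p := normal_pdf 0 s x in p0 *.
  have := kw x; rewrite -/p => H.
  apply: (@le_trans _ _ (2^-1 * (lam * (k x ^+ 2 * p) + lam^-1 * ((L - 1) ^+ 2 * p)))); last first.
    by rewrite ler_pM2l ?invr_gt0 // lerD2r ler_pM2l.
  rewrite !normrM (ger0_norm p0) mulrA.
  have -> : 2^-1 * (lam * (k x ^+ 2 * p) + lam^-1 * ((L - 1) ^+ 2 * p)) =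
     2^-1 * (lam * `|k x| ^+ 2 + lam^-1 * `|L - 1| ^+ 2) * p.
    by rewrite !real_normK ?num_real //; ring.
  apply: ler_wpM2r => //.
  move: `|k x| `|L - 1| => a e.
  have : 0 <= lam^-1 * (lam * a - e) ^+ 2.
    by rewrite mulr_ge0 ?sqr_ge0 // invr_ge0 ltW.
  have -> : lam^-1 * (lam * a - e) ^+ 2 = lam * a ^+ 2 + lam^-1 * e ^+ 2 - 2 * (a * e).
    by field; rewrite gt_eqF.
  lra.
rewrite RintegralZl // RintegralD // !RintegralZl // intq.
have cs2 : c ^+ 2 / s ^+ 2 <= 1.
  rewrite ler_pdivrMr ?exprn_gt0 // mul1r -(real_normK (num_real c)).
  by rewrite lerXn2r ?nnegrE // ltW.
have := expR_sub1_le (divr_ge0 (sqr_ge0 c) (sqr_ge0 s)) cs2 => H.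
rewrite [leRHS]mulrC ler_pM2l ?invr_gt0 //.
by apply: lerD; rewrite ler_pM2l // invr_gt0.
Qed.

End gaussian_shift.

Section gaussian_smoothing.
Context {R : realType}.
Local Notation leb := (@lebesgue_measure R).
Local Notation RR := (measurableTypeR R).

Definition gaussC : R := 2 * expR 1.

Lemma gaussC_ge2 : 2 <= gaussC.
Proof.
rewrite /gaussC; have := expR_ge1Dx (1 : R); lra.
Qed.

Lemma normal_prob_shift_diff (s c h0 : R) (h : RR -> R) : 0 < s -> bmf h ->
  \int[normal_prob 0 s]_x h (x + c) - \int[normal_prob 0 s]_x h x =
  \int[leb]_x ((h x - h0) * normal_pdf c s x) -
  \int[leb]_x ((h x - h0) * normal_pdf 0 s x).
Proof.
move=> s0 bh; have sn0 : s != 0 by rewrite gt_eqF.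
have bk : bmf (fun x => h x - h0) by apply: bmfB => //; exact: bmf_cst.
rewrite normal_prob_shift // -!integral_normal_prob_bmf //.
have E c' : \int[normal_prob c' s]_x (h x - h0) =
    \int[normal_prob c' s]_x h x - h0.
  rewrite (bmf_intB (normal_prob c' s) bh (bmf_cst h0)).
  by rewrite (int_prob_cst (normal_prob c' s) h0).
by rewrite (E c) (E 0) opprB addrA subrK.
Qed.

Lemma gaussian_shift_bounded (s c A : R) (h : RR -> R) : 0 < s ->
  bmf h -> (forall x, `|h x| <= A) ->
  `|\int[normal_prob 0 s]_x h (x + c) - \int[normal_prob 0 s]_x h x|
    <= gaussC * A * (`|c| / s).
Proof.
move=> s0 bh hA.
have sn0 : s != 0 by rewrite gt_eqF.
have A0 : 0 <= A by apply: le_trans (hA 0).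
have bhc : bmf (fun x : RR => h (x + c : RR)).
  by apply: (bmf_comp _ bh); exact: measurable_funD.
have cs0 : 0 <= `|c| / s by rewrite divr_ge0 // ltW.
have C2 := gaussC_ge2.
have [cs|cs] := lerP `|c| s; last first.
  apply: (@le_trans _ _ (2 * A)).
    apply: le_trans (ler_normB _ _) _.
    have H1 := bmf_int_ub (normal_prob 0 s) bhc (fun x => hA (x + c)).
    have H2 := bmf_int_ub (normal_prob 0 s) bh hA.
    lra.
  have : 1 <= `|c| / s by rewrite ler_pdivlMr // mul1r ltW.
  move=> H; rewrite -mulrA; apply: ler_pM => //.
  by rewrite -[leLHS]mulr1 ler_wpM2l.
have [->|c0] := eqVneq c 0.
  under eq_Rintegral do rewrite addr0.
  by rewrite subrr !normr0 mul0r mulr0.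
have [A00|An0] := eqVneq A 0.
  have h0 x : h x = 0 by apply/eqP; rewrite -normr_le0 -A00.
  under eq_Rintegral do rewrite h0.
  under [X in _ - X]eq_Rintegral do rewrite h0.
  by rewrite subrr normr0 A00 mulr0 mul0r.
have Ap : 0 < A by rewrite lt_neqAle eq_sym An0.
have cp : 0 < `|c| by rewrite normr_gt0.
rewrite (@normal_prob_shift_diff s c 0) //.
pose lam := `|c| / (s * A).
have lam0 : 0 < lam by rewrite divr_gt0 // mulr_gt0.
have ipdf c' : leb.-integrable setT (EFin \o normal_pdf c' s).
  exact: integrable_normal_pdf.
have bk : bmf (fun x => h x - 0) by apply: bmfB => //; exact: bmf_cst.
apply: le_trans (@gaussian_tilt_bound R s c (A ^+ 2) lam (fun x => h x - 0)
  (fun x => A ^+ 2 * normal_pdf 0 s x) s0 lam0 cs bk _ _ _) _.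
- move=> x; rewrite subr0; apply: ler_wpM2r; first exact: normal_pdf_ge0.
  by rewrite -real_normK ?num_real // lerXn2r ?nnegrE.
- exact: (integrableZl _ _ (ipdf 0)).
- by rewrite RintegralZl // Rintegral_normal_pdf mulr1.
rewrite -(real_normK (num_real c)) /lam /gaussC.
have -> : `|c| / (s * A) * A ^+ 2 + (`|c| / (s * A))^-1 * (`|c| ^+ 2 / s ^+ 2 * expR 1)
   = A * (`|c| / s) * (1 + expR 1).
  by field; rewrite An0 sn0 gt_eqF.
have : 0 <= A * (`|c| / s) by rewrite mulr_ge0.
have := expR_ge1Dx (1 : R).
rewrite -(mulrA (2 * expR 1)); move: (A * (`|c| / s)) => y; set e := expR 1 => He Hy.
nra.
Qed.

Lemma gaussian_shift_holder (s c A : R) (h : RR -> R) : 0 < s -> 0 <= A ->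
  bmf h -> (forall x y, `|h x - h y| <= A * Num.sqrt `|x - y|) ->
  `|\int[normal_prob 0 s]_x h (x + c) - \int[normal_prob 0 s]_x h x|
    <= gaussC * A * (`|c| / Num.sqrt s).
Proof.
move=> s0 A0 bh hA.
have sn0 : s != 0 by rewrite gt_eqF.
have r0 : 0 < Num.sqrt s by rewrite sqrtr_gt0.
have rs : s = Num.sqrt s * Num.sqrt s by rewrite -expr2 sqr_sqrtr // ltW.
have bhc : bmf (fun x : RR => h (x + c : RR)).
  by apply: (bmf_comp _ bh); exact: measurable_funD.
have cs0 : 0 <= `|c| / Num.sqrt s by rewrite divr_ge0 // ltW.
have C2 := gaussC_ge2.
have [cs|cs] := lerP `|c| s; last first.
  rewrite -bmf_intB //.
  apply: (@le_trans _ _ (A * Num.sqrt `|c|)).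
    apply: bmf_int_ub; first exact: bmfB.
    by move=> x; have := hA (x + c) x; rewrite [x + c]addrC addrK.
  have : Num.sqrt `|c| <= `|c| / Num.sqrt s.
    rewrite ler_pdivlMr //.
    have {2}-> : `|c| = Num.sqrt `|c| * Num.sqrt `|c| by rewrite -expr2 sqr_sqrtr.
    by rewrite ler_wpM2l // ?sqrtr_ge0 // ler_wsqrtr // ltW.
  move=> H; rewrite -mulrA.
  apply: (@le_trans _ _ (A * (`|c| / Num.sqrt s))); first by rewrite ler_wpM2l.
  by rewrite ler_peMl ?mulr_ge0 //; lra.
have [->|c0] := eqVneq c 0.
  under eq_Rintegral do rewrite addr0.
  by rewrite subrr !normr0 mul0r mulr0.
have [A00|An0] := eqVneq A 0.
  have h0 x : h x = h 0.
    apply/eqP; rewrite -subr_eq0 -normr_le0; apply: le_trans (hA _ _) _.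
    by rewrite A00 mul0r.
  under eq_Rintegral do rewrite h0.
  under [X in _ - X]eq_Rintegral do rewrite h0.
  by rewrite subrr normr0 A00 mulr0 mul0r.
have Ap : 0 < A by rewrite lt_neqAle eq_sym An0.
have cp : 0 < `|c| by rewrite normr_gt0.
rewrite (@normal_prob_shift_diff s c (h 0)) //.
pose lam := `|c| / (A * s * Num.sqrt s).
have lam0 : 0 < lam by rewrite divr_gt0 // !mulr_gt0.
have ipdf c' : leb.-integrable setT (EFin \o normal_pdf c' s).
  exact: integrable_normal_pdf.
have ipp : leb.-integrable setT (EFin \o (fun x => normal_pdf s s x + normal_pdf (- s) s x)).
  exact: (integrableD measurableT (ipdf s) (ipdf (- s))).
have bk : bmf (fun x => h x - h 0) by apply: bmfB => //; exact: bmf_cst.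
apply: le_trans (@gaussian_tilt_bound R s c (A ^+ 2 * (s * expR 1) * 2) lam (fun x => h x - h 0)
  (fun x => A ^+ 2 * (s * expR 1) * (normal_pdf s s x + normal_pdf (- s) s x)) s0 lam0 cs bk _ _ _) _.
- move=> x; rewrite -(mulrA (A ^+ 2)).
  apply: (@le_trans _ _ (A ^+ 2 * (`|x| * normal_pdf 0 s x))).
    rewrite (mulrA (A ^+ 2)); apply: ler_wpM2r; first exact: normal_pdf_ge0.
    rewrite -real_normK ?num_real //.
    have := hA x 0; rewrite subr0 => H.
    have -> : A ^+ 2 * `|x| = (A * Num.sqrt `|x|) ^+ 2.
      by rewrite exprMn sqr_sqrtr.
    by rewrite lerXn2r ?nnegrE // mulr_ge0 // sqrtr_ge0.
  apply: ler_wpM2l; first exact: sqr_ge0.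
  exact: normr_le_normal_pdf.
- exact: (integrableZl _ _ ipp).
- by rewrite RintegralZl // RintegralD // !Rintegral_normal_pdf -natr1 mulr1n.
rewrite -(real_normK (num_real c)) /lam /gaussC.
have rn0 : Num.sqrt s != 0 by rewrite gt_eqF.
move: (Num.sqrt s) r0 rn0 rs => r r0 rn0 rs {cs0 lam lam0}; rewrite rs.
have -> : `|c| / (A * (r * r) * r) * (A ^+ 2 * (r * r * expR 1) * 2) +
  (`|c| / (A * (r * r) * r))^-1 * (`|c| ^+ 2 / (r * r) ^+ 2 * expR 1)
   = A * (`|c| / r) * (3 * expR 1).
  by field; rewrite An0 rn0 gt_eqF.
have : 0 <= A * (`|c| / r) by rewrite mulr_ge0 // divr_ge0 // ltW.
have := expR_ge1Dx (1 : R).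
rewrite -(mulrA (2 * expR 1)); move: (A * (`|c| / r)) => y; set e := expR 1 => He Hy.
have : 0 <= y * e by rewrite mulr_ge0 //; lra.
lra.
Qed.

End gaussian_smoothing.

(** * Brownian increments and the heat semigroup *)

Section rV_measures.
Context {R : realType} {d : nat}.
Local Notation BV := (borel_rV R d).

Lemma rV_measure_unique (m1 m2 : {measure set BV -> \bar R}) :
  (m1 setT < +oo)%E ->
  (forall D, (forall i, measurable (D i)) -> m1 (rV_box D) = m2 (rV_box D)) ->
  forall A, measurable A -> m1 A = m2 A.
Proof.
move=> m1oo H; apply: (measure_unique (@rV_boxes R d) (fun _ => setT)) => //.
- apply/seteqP; split => A; first exact: measurable_rV_boxesE.
  apply: smallest_sub; first exact: sigma_algebra_measurable.
  by move=> _ [D mD ->]; exact: measurable_rV_box.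
- exact: rV_boxes_setI.
- by move=> _; exact: rV_boxes_setT.
- by rewrite bigcup_const.
- by move=> _ [D mD ->]; exact: H.
Qed.

Lemma rV_independence dO (O : measurableType dO) (P : probability O R)
    (Z : O -> BV) (F : set O) : measurable F -> measurable_fun setT Z ->
  (forall D, (forall i, measurable (D i)) ->
     P (F `&` Z @^-1` rV_box D) = (P F * P (Z @^-1` rV_box D))%E) ->
  forall A, measurable A -> P (F `&` Z @^-1` A) = (P F * P (Z @^-1` A))%E.
Proof.
move=> mF mZ H A mA.
have PF : P F \is a fin_num by exact: fin_num_measure.
have PF0 : 0 <= fine (P F) by rewrite fine_ge0.
pose X : {mfun O >-> BV} := mfun_Sub (mem_set mZ).
pose m1 : {measure set BV -> \bar R} := pushforward (mrestr P mF) X.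
pose m2 : {measure set BV -> \bar R} := mscale (NngNum PF0) (distribution P X).
have E1 B : m1 (measurable_funPT X) B = P (F `&` Z @^-1` B) by rewrite setIC.
have E2 B : m2 B = (P F * P (Z @^-1` B))%E.
  transitivity ((fine (P F))%:E * P (Z @^-1` B))%E; first by [].
  by rewrite fineK.
rewrite -E1 -E2; apply: rV_measure_unique => //.
- rewrite E1 preimage_setT setIT; apply: le_lt_trans (probability_le1 P mF) _.
  exact: ltry.
- by move=> D mD; rewrite E1 E2; exact: H.
Qed.

Lemma measurable_rVD dO (O : measurableType dO) (f g : O -> BV) :
  measurable_fun setT f -> measurable_fun setT g ->
  measurable_fun setT (fun w => (f w : 'rV[R]_d) + g w : BV).
Proof.
move=> /measurable_to_rVP mf /measurable_to_rVP mg; apply/measurable_to_rVP => i.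
under eq_fun do rewrite mxE.
exact: (measurable_funD (mf i) (mg i)).
Qed.

Lemma measurable_rVN dO (O : measurableType dO) (f : O -> BV) :
  measurable_fun setT f ->
  measurable_fun setT (fun w => - (f w : 'rV[R]_d) : BV).
Proof.
move=> /measurable_to_rVP mf; apply/measurable_to_rVP => i.
under eq_fun do rewrite mxE.
exact: (measurableT_comp (@oppr_measurable R setT) (mf i)).
Qed.

Lemma measurable_rVB dO (O : measurableType dO) (f g : O -> BV) :
  measurable_fun setT f -> measurable_fun setT g ->
  measurable_fun setT (fun w => (f w : 'rV[R]_d) - g w : BV).
Proof. by move=> mf mg; apply: measurable_rVD => //; exact: measurable_rVN. Qed.

Lemma measurable_rVZ dO (O : measurableType dO) (c : R) (f : O -> BV) :
  measurable_fun setT f ->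
  measurable_fun setT (fun w => c *: (f w : 'rV[R]_d) : BV).
Proof.
move=> /measurable_to_rVP mf; apply/measurable_to_rVP => i.
under eq_fun do rewrite mxE.
exact: (measurable_funM (measurable_cst c) (mf i)).
Qed.

Lemma measurable_rV_norm :
  measurable_fun [set: BV] (fun v : BV => `|v : 'rV[R]_d|).
Proof.
have -> : (fun v : BV => `|v : 'rV[R]_d|) =
   (fun v : BV => \big[Num.max/0]_(i <- index_enum 'I_d) `|v ord0 i|).
  apply/funext => v; apply/eqP; rewrite eq_le; apply/andP; split.
    apply: rV_norm_le => [|i]; first by apply: bigmax_ge_id.
    exact: le_bigmax.
  by apply/bigmax_leP; split => // i _; exact: mx_entry_norm_le.
elim: (index_enum _) => [|i r IH].
  by under eq_fun do rewrite big_nil; exact: measurable_cst.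
under eq_fun do rewrite big_cons.
apply: measurable_maxr => //.
by apply: measurableT_comp => //; exact: measurable_rV_coord.
Qed.

Lemma rV_telescope (F : 'rV[R]_d -> R) (K : R) : 0 <= K ->
  (forall y i (c : R), `|F (y + c *: delta_mx ord0 i) - F y| <= K * `|c|) ->
  forall y u, `|F (y + u) - F y| <= K * d%:R * `|u|.
Proof.
move=> K0 H y u.
have S (r : seq 'I_d) : `|F (y + \sum_(i <- r) u ord0 i *: delta_mx ord0 i) - F y|
    <= K * \sum_(i <- r) `|u ord0 i|.
  elim: r => [|i r IH]; first by rewrite !big_nil addr0 subrr normr0 mulr0.
  rewrite !big_cons; set z := \sum_(j <- r) _ *: _ in IH *.
  set a := _ *: delta_mx _ _.
  have -> : y + (a + z) = y + z + a by rewrite addrCA addrC.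
  have -> : F (y + z + a) - F y = (F (y + z + a) - F (y + z)) + (F (y + z) - F y).
    by rewrite addrA subrK.
  rewrite mulrDr; apply: le_trans (ler_normD _ _) _; exact: (lerD (H _ _ _) IH).
have := S (index_enum 'I_d); rewrite -row_sum_delta => H1.
apply: le_trans H1 _; rewrite -mulrA; apply: ler_wpM2l => //.
apply: le_trans (ler_sum _ (fun i _ => mx_entry_norm_le u ord0 i)) _.
by rewrite sumr_const card_ord -[leLHS]mulr_natl.
Qed.

Lemma norm_delta_rV (c : R) (i : 'I_d) :
  `|c *: delta_mx ord0 i : 'rV[R]_d| <= `|c|.
Proof.
apply: rV_norm_le => // j; rewrite !mxE /=; case: eqP => _ /=.
  by rewrite mulr1.
by rewrite mulr0 normr0.
Qed.

End rV_measures.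

Section brownian_increments.
Context {R : realType} {disp : measure_display} {Omega : measurableType disp}.
Variables (P : probability Omega R) (d : nat).
Local Notation V := 'rV[R]_d.
Local Notation BV := (borel_rV R d).

Definition brownian_wrt (T : R) (G : R -> set (set Omega))
    (B : R -> Omega -> V) : Prop :=
  [/\ forall t, sigma_algebra setT (G t) /\ G t `<=` measurable,
      forall s t, s <= t -> G s `<=` G t,
      forall t (D : set BV), 0 <= t -> t <= T -> measurable D ->
        G t (B t @^-1` D)
    & forall s t (F : set Omega) D, 0 <= s -> s < t -> t <= T -> G s F ->
        (forall i, measurable (D i)) ->
        P (F `&` [set w | rV_box D (B t w - B s w)]) =
        (P F * \prod_(i < d) normal_prob 0 (Num.sqrt (t - s)) (D i))%E].

Variables (T : R) (G : R -> set (set Omega)) (B : R -> Omega -> V).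
Hypothesis hB : brownian_wrt T G B.

Definition past t := g_sigma_algebraType (G t).

Lemma past_measurableE t (A : set (past t)) : measurable A = G t A.
Proof.
have [H _ _ _] := hB; have [sG _] := H t.
by rewrite /measurable /= sigma_algebra_id.
Qed.

Lemma past_sub t dE (E : measurableType dE) (f : Omega -> E) :
  measurable_fun setT (f : past t -> E) -> measurable_fun setT f.
Proof.
have [H _ _ _] := hB; have [_ sG] := H t.
move=> mf _ A mA; have := mf measurableT A mA.
by rewrite past_measurableE; exact: sG.
Qed.

Lemma past_mono s t dE (E : measurableType dE) (f : Omega -> E) : s <= t ->
  measurable_fun setT (f : past s -> E) -> measurable_fun setT (f : past t -> E).
Proof.
have [_ H _ _] := hB => st mf _ A mA; have := mf measurableT A mA.
by rewrite !past_measurableE; exact: H.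
Qed.

Definition incr s t (w : Omega) : V := B t w - B s w.

Lemma past_B t : 0 <= t -> t <= T -> measurable_fun setT (B t : past t -> BV).
Proof.
have [_ _ H _] := hB => t0 tT _ D mD.
by rewrite setTI past_measurableE; exact: H.
Qed.

Lemma past_incr s t : 0 <= s -> s <= t -> t <= T ->
  measurable_fun setT (incr s t : past t -> BV).
Proof.
move=> s0 st tT; apply: measurable_rVB; first by apply: past_B => //; exact: le_trans st.
by apply: (past_mono st); apply: past_B => //; exact: le_trans tT.
Qed.

Lemma measurable_incr s t : 0 <= s -> s <= t -> t <= T ->
  measurable_fun setT (incr s t : Omega -> BV).
Proof. by move=> s0 st tT; apply: past_sub; exact: (past_incr s0 st tT). Qed.

Lemma incr_independent s t (F : set Omega) (A : set BV) :
  0 <= s -> s < t -> t <= T -> G s F -> measurable A ->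
  P (F `&` incr s t @^-1` A) = (P F * P (incr s t @^-1` A))%E.
Proof.
move=> s0 st tT GF.
have [H _ _ I] := hB; have [sG Gm] := H s.
apply: rV_independence; [exact: Gm|exact: (measurable_incr s0 (ltW st) tT)|].
move=> D mD.
have GT : G s setT.
  by case: sG => g0 gC _; have := gC _ g0; rewrite setD0.
rewrite [LHS](I s t F D) //; congr (_ * _)%E.
have := I s t setT D s0 st tT GT mD.
by rewrite setTI probability_setT mul1e => <-.
Qed.

Lemma incr_freeze s t dE (E : measurableType dE) (Z : Omega -> E)
    (g : E * BV -> R) : 0 <= s -> s < t -> t <= T ->
  measurable_fun setT (Z : past s -> E) -> bmf g ->
  \int[P]_w g (Z w, incr s t w) = \int[P]_w \int[P]_w' g (Z w, incr s t w').
Proof.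
move=> s0 st tT mZ bg.
apply: (independent_Fubini (past_sub mZ) (measurable_incr s0 (ltW st) tT) _ bg).
move=> A1 A2 mA1 mA2; apply: incr_independent => //.
by have := mZ measurableT A1 mA1; rewrite setTI past_measurableE.
Qed.

Definition heat s t (g : BV -> R) (y : V) : R := \int[P]_w g (y + incr s t w).

Lemma bmf_heat_integrand s t dE (E : measurableType dE) (h : E -> BV) (g : BV -> R) :
  0 <= s -> s <= t -> t <= T -> measurable_fun setT h -> bmf g ->
  bmf (fun z : E * Omega => g ((h z.1 : V) + incr s t z.2 : BV)).
Proof.
move=> s0 st tT mh; apply: bmf_comp; apply: measurable_rVD.
  exact: (measurableT_comp mh measurable_fst).
exact: (measurableT_comp (measurable_incr s0 st tT) measurable_snd).
Qed.

Lemma bmf_heat s t (g : BV -> R) : 0 <= s -> s <= t -> t <= T -> bmf g ->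
  bmf (heat s t g : BV -> R).
Proof.
move=> s0 st tT bg.
have mid : measurable_fun [set: BV] (@id BV) by exact: measurable_id.
exact: (bmf_int_inner (@dirac _ BV point R) P (bmf_heat_integrand s0 st tT mid bg)).
Qed.

Lemma heat_semigroup s v t (g : BV -> R) y : 0 <= s -> s < v -> v < t -> t <= T ->
  bmf g -> heat s t g y = heat s v (heat v t g) y.
Proof.
move=> s0 sv vt tT bg.
have v0 : 0 <= v by apply: le_trans (ltW sv).
have vT : v <= T by exact: le_trans (ltW vt) tT.
pose g' (z : BV * BV) := g ((y + (z.1 : V)) + (z.2 : V) : BV).
have bg' : bmf g'.
  apply: bmf_comp bg; apply: measurable_rVD; last exact: measurable_snd.
  apply: measurable_rVD; [exact: measurable_cst|exact: measurable_fst].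
have := incr_freeze v0 vt tT (past_incr s0 (ltW sv) vT) bg'.
rewrite /g' /= => E; rewrite /heat -[RHS]E; apply: eq_Rintegral => w _.
by congr g; rewrite /incr; vring.
Qed.

End brownian_increments.

Lemma ge0_integral_le_truncated {R : realType} {dT} {T : measurableType dT}
    (P : probability T R) (f : T -> R) (C : R) :
  measurable_fun setT f -> (forall x, 0 <= f x) ->
  (forall n : nat, \int[P]_x Num.min (f x) n%:R <= C) ->
  (\int[P]_x (f x)%:E <= C%:E)%E.
Proof.
move=> mf f0 H.
pose g (n : nat) x := (Num.min (f x) n%:R)%:E.
have mg n : measurable_fun setT (g n).
  by apply/measurable_EFinP; apply: measurable_minr.
have g0 n x : (0 <= g n x)%E by rewrite lee_fin le_min f0 ler0n.
have gf x : limn (g^~ x) = (f x)%:E.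
  apply/cvg_lim => //; apply: cvg_near_cst; near=> n.
  rewrite /g min_l //; near: n; exact: nbhs_infty_ger.
under eq_integral do rewrite -gf.
rewrite monotone_convergence //; last first.
  move=> x _ m n mn; rewrite lee_fin le_min !ge_min lexx /=.
  by rewrite ler_nat mn orbT.
apply: lime_le.
  apply: ereal_nondecreasing_is_cvgn => m n mn; apply: ge0_le_integral => // x _.
  by rewrite lee_fin le_min !ge_min lexx /= ler_nat mn orbT.
near=> n; rewrite /g -bmf_intE ?lee_fin //.
split; first by apply: measurable_minr.
exists n%:R => x; rewrite ger0_norm; first by rewrite ge_min lexx orbT.
by rewrite le_min f0 ler0n.
Unshelve. all: by end_near. Qed.

Section heat_estimates.
Context {R : realType} {disp : measure_display} {Omega : measurableType disp}.
Variables (P : probability Omega R) (d : nat).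
Local Notation V := 'rV[R]_d.
Local Notation BV := (borel_rV R d).
Local Notation RR := (measurableTypeR R).
Variables (T : R) (G : R -> set (set Omega)) (B : R -> Omega -> V).
Hypothesis hB : brownian_wrt P T G B.
Variables (s t : R).
Hypotheses (s0 : 0 <= s) (st : s < t) (tT : t <= T).
Local Notation sd := (Num.sqrt (t - s)).

Let mincr : measurable_fun setT (incr B s t : Omega -> BV).
Proof. exact: (measurable_incr hB s0 (ltW st) tT). Qed.

Lemma incr_box_prob D : (forall i, measurable (D i)) ->
  P (incr B s t @^-1` rV_box D) = (\prod_(i < d) normal_prob 0 sd (D i))%E.
Proof.
move=> mD; have [H _ _ I] := hB.
have GT : G s setT.
  by have [[g0 gC _] _] := H s; have := gC _ g0; rewrite setD0.
have := I s t setT D s0 st tT GT mD.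
by rewrite setTI probability_setT mul1e => <-.
Qed.

Let z (i : 'I_d) (w : Omega) : RR := incr B s t w ord0 i.
Let W (i : 'I_d) (w : Omega) : BV :=
  \row_j (if j == i then 0 else incr B s t w ord0 j).

Let WE i w j : W i w ord0 j = if j == i then 0 else incr B s t w ord0 j.
Proof. by rewrite mxE. Qed.

Let mz i : measurable_fun setT (z i).
Proof. exact: (measurableT_comp (measurable_rV_coord i) mincr). Qed.

Let mW i : measurable_fun setT (W i).
Proof.
apply: measurable_to_rV => j; rewrite /W.
under eq_fun do rewrite mxE.
by case: eqP => _; [exact: measurable_cst|exact: mz].
Qed.

Lemma incr_coord_prob i (A : set RR) : measurable A ->
  P (z i @^-1` A) = normal_prob 0 sd A.
Proof.
move=> mA.
pose D j : set RR := if j == i then A else setT.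
have -> : z i @^-1` A = incr B s t @^-1` rV_box D.
  apply/seteqP; split => w /=.
    by move=> Aw j; rewrite /D; case: eqP => // ->.
  by move=> /(_ i); rewrite /D eqxx.
rewrite incr_box_prob; last by move=> j; rewrite /D; case: ifP.
rewrite (bigD1 i) //= /D eqxx big1 ?mule1 // => j /negbTE ->.
exact: probability_setT.
Qed.

Lemma incr_coord_independent i (A1 : set BV) (A2 : set RR) :
  measurable A1 -> measurable A2 ->
  P (W i @^-1` A1 `&` z i @^-1` A2) = (P (W i @^-1` A1) * P (z i @^-1` A2))%E.
Proof.
move=> mA1 mA2; rewrite setIC muleC.
apply: rV_independence => //.
  by rewrite -[X in measurable X]setTI; exact: mz.
move=> D mD; rewrite incr_coord_prob //.
have [D0|D0] := pselect (D i 0); last first.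
  have -> : W i @^-1` rV_box D = set0.
    by apply/seteqP; split => // w /= /(_ i); rewrite WE eqxx.
  by rewrite setI0 measure0 mule0.
pose D1 j : set RR := if j == i then A2 else D j.
pose D2 j : set RR := if j == i then setT else D j.
have -> : z i @^-1` A2 `&` W i @^-1` rV_box D = incr B s t @^-1` rV_box D1.
  apply/seteqP; split => w /=.
    move=> [Aw H] j; rewrite /D1; have := H j; rewrite WE.
    by case: eqP => // ->.
  move=> H; split; first by have := H i; rewrite /D1 eqxx.
  by move=> j; have := H j; rewrite /D1 WE; case: (eqVneq j i) => [->|].
have -> : W i @^-1` rV_box D = incr B s t @^-1` rV_box D2.
  apply/seteqP; split => w /=.
    by move=> H j; rewrite /D2; have := H j; rewrite WE; case: eqP.
  by move=> H j; have := H j; rewrite /D2 WE; case: (eqVneq j i) => [-> _|].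
rewrite !incr_box_prob; try by move=> j; rewrite ?/D1 ?/D2; case: ifP.
rewrite (bigD1 i) //= [in RHS](bigD1 i) //= /D1 /D2 eqxx.
rewrite [X in (_ = _ * (X * _))%E](probability_setT (normal_prob 0 sd)) mul1e.
by congr (_ * _)%E; apply: eq_bigr => j /negbTE ->.
Qed.

Lemma incr_coord_integral i (h : RR -> R) : bmf h ->
  \int[P]_w h (z i w) = \int[normal_prob 0 sd]_x h x.
Proof.
move=> bh; pose X : {mfun Omega >-> RR} := mfun_Sub (mem_set (mz i)).
transitivity (\int[distribution P X]_x h x).
  rewrite /Rintegral integral_distribution //.
  - by apply/measurable_EFinP; case: bh.
  - by apply: bmf_integrable => //; exact: (bmf_comp (mz i) bh).
apply: (congr1 fine); apply: eq_measure_integral => A mA _.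
exact: incr_coord_prob.
Qed.

Let line (y : V) i (c : R) (g : BV -> R) (v : BV * RR) : R :=
  g (y + (v.1 : V) + (v.2 + c) *: delta_mx ord0 i : BV).

Let bmf_line y i c g : bmf g -> bmf (line y i c g).
Proof.
move=> bg; apply: bmf_comp bg; apply: measurable_rVD.
  by apply: measurable_rVD; [exact: measurable_cst|exact: measurable_fst].
apply: measurable_to_rV => j.
under eq_fun do rewrite !mxE.
apply: measurable_funM; last exact: measurable_cst.
by apply: measurable_funD; [exact: measurable_snd|exact: measurable_cst].
Qed.

Lemma heat_lineE y i c (g : BV -> R) : bmf g ->
  heat P B s t g (y + c *: delta_mx ord0 i) =
  \int[P]_w \int[normal_prob 0 sd]_x line y i 0 g (W i w, x + c).
Proof.
move=> bg.
transitivity (\int[P]_w line y i c g (W i w, z i w)).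
  apply: eq_Rintegral => w _; rewrite /line /=; congr g.
  rewrite /W /z; move: (incr B s t w) => v.
  apply/rowP => j; rewrite !mxE /=; case: (eqVneq j i) => [->|ji] /=; ring.
rewrite (independent_Fubini (mW i) (mz i) (@incr_coord_independent i) (bmf_line y i c bg)).
apply: eq_Rintegral => w _.
rewrite (incr_coord_integral i (h := fun x => line y i c g (W i w, x))); last first.
  by apply: bmf_comp (bmf_line y i c bg); exact: pair1_measurable.
by apply: eq_Rintegral => x _; rewrite /line /= addr0.
Qed.

Lemma heat_coord_diff y i c (g : BV -> R) K : bmf g ->
  (forall v, `|\int[normal_prob 0 sd]_x line y i 0 g (v, x + c)
     - \int[normal_prob 0 sd]_x line y i 0 g (v, x)| <= K) ->
  `|heat P B s t g (y + c *: delta_mx ord0 i) - heat P B s t g y| <= K.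
Proof.
move=> bg H.
have {2}-> : y = y + 0 *: delta_mx ord0 i by rewrite scale0r addr0.
rewrite !heat_lineE //.
have I c' : bmf (fun w => \int[normal_prob 0 sd]_x line y i 0 g (W i w, x + c')).
  apply: (bmf_comp (mW i) (f := fun v => \int[normal_prob 0 sd]_x line y i 0 g (v, x + c'))).
  apply: (bmf_int_inner (@dirac _ BV point R) (normal_prob 0 sd)
     (f := fun v => line y i 0 g (v.1, v.2 + c'))).
  have := bmf_line y i c' bg; congr bmf; apply/funext => v.
  by rewrite /line /= addr0.
rewrite -bmf_intB //; apply: bmf_int_ub; first exact: bmfB.
move=> w; have := H (W i w).
by under [X in _ -> `|_ - X| <= _]eq_Rintegral do rewrite addr0.
Qed.

Lemma heat_bounded_lip (g : BV -> R) (A : R) y u : bmf g ->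
  (forall v, `|g v| <= A) ->
  `|heat P B s t g (y + u) - heat P B s t g y|
    <= gaussC * A / sd * d%:R * `|u|.
Proof.
move=> bg gA.
have sd0 : 0 < sd by rewrite sqrtr_gt0 subr_gt0.
have C2 : 2 <= gaussC :> R := gaussC_ge2.
have A0 : 0 <= A by apply: le_trans (gA 0).
apply: rV_telescope; first by rewrite divr_ge0 ?mulr_ge0 // ?(ltW sd0) //; lra.
move=> {}y i c; apply: heat_coord_diff => // v.
have bv : bmf (fun x : RR => line y i 0 g (v, x)).
  by apply: bmf_comp (bmf_line y i 0 bg); exact: pair1_measurable.
have := gaussian_shift_bounded c sd0 bv (fun x => gA _).
by rewrite [`|c| / _]mulrC mulrA.
Qed.

Lemma heat_holder_lip (g : BV -> R) (A : R) y u : bmf g -> 0 <= A ->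
  (forall v v' : V, `|g v - g v'| <= A * Num.sqrt `|v - v'|) ->
  `|heat P B s t g (y + u) - heat P B s t g y|
    <= gaussC * A / Num.sqrt sd * d%:R * `|u|.
Proof.
move=> bg A0 gA.
have sd0 : 0 < sd by rewrite sqrtr_gt0 subr_gt0.
have rd0 : 0 < Num.sqrt sd by rewrite sqrtr_gt0.
have C2 : 2 <= gaussC :> R := gaussC_ge2.
apply: rV_telescope; first by rewrite divr_ge0 ?mulr_ge0 // ?(ltW rd0) //; lra.
move=> {}y i c; apply: heat_coord_diff => // v.
have bv : bmf (fun x : RR => line y i 0 g (v, x)).
  by apply: bmf_comp (bmf_line y i 0 bg); exact: pair1_measurable.
have := gaussian_shift_holder (A := A) c sd0 A0 bv.
rewrite [`|c| / _]mulrC mulrA; apply.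
move=> x x'; apply: le_trans (gA _ _) _; apply: ler_wpM2l => //.
rewrite ler_wsqrtr //= !addr0.
have -> : y + (v : V) + x *: delta_mx ord0 i - (y + (v : V) + x' *: delta_mx ord0 i)
  = (x - x') *: delta_mx ord0 i by vring.
exact: norm_delta_rV.
Qed.

Lemma int_abs_incr_coord i :
  (\int[P]_w (`|incr B s t w ord0 i|)%:E <= (2 * expR 1 * sd)%:E)%E.
Proof.
have sd0 : 0 < sd by rewrite sqrtr_gt0 subr_gt0.
have mabs : measurable_fun setT (fun w => `|z i w|).
  by apply: measurableT_comp => //; exact: mz.
apply: ge0_integral_le_truncated => // n.
pose h (x : RR) : R := Num.min `|x| n%:R.
have bh : bmf h.
  split; first by apply: measurable_minr => //; exact: measurableT_comp.
  exists n%:R => x; rewrite /h ger0_norm; first by rewrite ge_min lexx orbT.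
  by rewrite le_min normr_ge0 ler0n.
have -> : \int[P]_w Num.min `|incr B s t w ord0 i| n%:R = \int[P]_w h (z i w) by [].
rewrite incr_coord_integral // integral_normal_prob_bmf //.
have ipdf c' : (@lebesgue_measure R).-integrable setT (EFin \o normal_pdf c' sd).
  exact: integrable_normal_pdf.
have ipp : (@lebesgue_measure R).-integrable setT
    (EFin \o (fun x => normal_pdf sd sd x + normal_pdf (- sd) sd x)).
  exact: (integrableD measurableT (ipdf sd) (ipdf (- sd))).
have ipp2 : (@lebesgue_measure R).-integrable setT
    (EFin \o (fun x => sd * expR 1 * (normal_pdf sd sd x + normal_pdf (- sd) sd x))).
  exact: (integrableZl _ _ ipp).
apply: (@le_trans _ _ (\int[lebesgue_measure]_x
    (sd * expR 1 * (normal_pdf sd sd x + normal_pdf (- sd) sd x)))); last first.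
  by rewrite RintegralZl // RintegralD // !Rintegral_normal_pdf; lra.
have le x : h x * normal_pdf 0 sd x <=
    sd * expR 1 * (normal_pdf sd sd x + normal_pdf (- sd) sd x).
  apply: le_trans (normr_le_normal_pdf x sd0).
  apply: ler_wpM2r; first exact: normal_pdf_ge0.
  by rewrite /h ge_min lexx.
have h0 x : 0 <= h x by rewrite /h le_min normr_ge0 ler0n.
apply: le_Rintegral => //.
apply: (@le_integrable _ _ _ lebesgue_measure setT measurableT _
   (EFin \o (fun x => sd * expR 1 * (normal_pdf sd sd x + normal_pdf (- sd) sd x)))) => //.
  apply/measurable_EFinP; apply: measurable_funM; first by case: bh.
  exact: measurable_normal_pdf.
move=> x _ /=; rewrite lee_fin ger0_norm ?mulr_ge0 ?normal_pdf_ge0 //.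
by apply: le_trans (le x) _; exact: ler_norm.
Qed.

End heat_estimates.

(** * Averaging along the noise *)

Section time_integrals.
Context {R : realType}.
Local Notation leb := (@lebesgue_measure R).
Local Notation RR := (measurableTypeR R).
Implicit Types (a b c : R) (f g : RR -> R).

Lemma lebesgue_itv_lty a b : (leb (`[a, b]%classic : set RR) < +oo)%E.
Proof.
rewrite lebesgue_measure_itv /=; case: ifP => _; last exact: ltry.
by rewrite -EFinD ltry.
Qed.

Lemma measurable_itvRR a b : measurable (`[a, b]%classic : set RR).
Proof. exact: measurable_itv. Qed.

Lemma bmf_itv_integrable a b f : bmf f ->
  leb.-integrable (`[a, b]%classic : set RR) (EFin \o f).
Proof.
move=> [mf [M fM]]; apply: measurable_bounded_integrable => //.
- exact: lebesgue_itv_lty.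
- exact: measurable_funTS.
- exists M; split; first exact: num_real.
  by move=> x Mx y _ /=; exact: le_trans (fM y) (ltW Mx).
Qed.

Definition lebI a b : {finite_measure set RR -> \bar R} :=
  mfrestr (measurable_itvRR a b) (lebesgue_itv_lty a b).

Lemma lebI_setT a b : a <= b -> fine (lebI a b setT) = b - a.
Proof.
move=> ab; rewrite /lebI /= /mfrestr /= /mrestr setTI lebesgue_measure_itv /= lte_fin.
by move: ab; rewrite le_eqVlt => /predU1P[->|->] //; rewrite ltxx subrr.
Qed.

Lemma lebI_int a b f : bmf f ->
  \int[lebI a b]_s f s = \int[leb]_(s in (`[a, b]%classic : set RR)) f s.
Proof.
move=> bf; have mD : measurable (`[a, b]%classic : set RR) by exact: measurable_itvRR.
have mN : measurable (~` (`[a, b]%classic : set RR)) by exact: measurableC.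
apply: (congr1 fine).
rewrite (@negligible_integral _ _ _ (lebI a b) setT (~` `[a, b]%classic)) //.
- rewrite setDE setTI setCK; apply: eq_measure_integral => A mA sA.
  by rewrite /lebI /= /mfrestr /= /mrestr setIidl.
- exact: bmf_integrable.
- by rewrite /lebI /= /mfrestr /= /mrestr setICl measure0.
Qed.

Lemma lebI_int_norm a b f M : bmf f -> a <= b ->
  (forall s, a <= s -> s <= b -> `|f s| <= M) ->
  `|\int[lebI a b]_s f s| <= (b - a) * M.
Proof.
move=> bf ab fM; rewrite lebI_int //.
have mD : measurable (`[a, b]%classic : set RR) by exact: measurable_itvRR.
apply: le_trans (le_normr_Rintegral _ (bmf_itv_integrable _ _ bf)) _ => //.
apply: (@le_trans _ _ (\int[leb]_(s in (`[a, b]%classic : set RR)) M)).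
  apply: le_Rintegral => //; [exact: (bmf_itv_integrable _ _ (bmf_norm bf))|exact: (bmf_itv_integrable _ _ (bmf_cst M))|].
  by move=> s; rewrite /= in_itv /= => /andP[? ?]; exact: fM.
by rewrite Rintegral_cst // -lebI_setT // mulrC /lebI /= /mfrestr /= /mrestr setTI.
Qed.

Lemma lebI_int_le a b f g : bmf f -> bmf g -> 
  (forall s, a <= s -> s <= b -> f s <= g s) ->
  \int[lebI a b]_s f s <= \int[lebI a b]_s g s.
Proof.
move=> bf bg fg; rewrite !lebI_int //.
have mD : measurable (`[a, b]%classic : set RR) by exact: measurable_itvRR.
apply: le_Rintegral => //; [exact: (bmf_itv_integrable _ _ bf)|exact: (bmf_itv_integrable _ _ bg)|].
by move=> s; rewrite /= in_itv /= => /andP[? ?]; exact: fg.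
Qed.

Lemma lebI_int_split a b c f : bmf f -> a <= b -> b <= c ->
  \int[lebI a c]_s f s = \int[lebI a b]_s f s + \int[lebI b c]_s f s.
Proof.
move=> bf ab bc; rewrite !lebI_int //.
have := @Rintegral_itvB R f (BLeft a) (BRight c) b (bmf_itv_integrable a c bf).
rewrite !bnd_simp => /(_ ab bc) H.
rewrite -(Rintegral_itv_obnd_cbnd (r := b)) //; last first.
  apply: integrableS (bmf_itv_integrable b c bf) => //.
  exact: subset_itv_oc_cc.
by rewrite -H addrC subrK.
Qed.

End time_integrals.

Section orthogonality.
Context {R : realType} {disp : measure_display} {Omega : measurableType disp}.
Variable P : probability Omega R.
Local Notation RR := (measurableTypeR R).

Lemma bmf_int_sqr (f : Omega -> R) : bmf f ->
  (\int[P]_w `|f w|) ^+ 2 <= \int[P]_w (f w ^+ 2).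
Proof.
move=> bf; set m := \int[P]_w `|f w|.
have bn := bmf_norm bf.
have b2 : bmf (fun w => f w ^+ 2).
  by under eq_fun do rewrite expr2; exact: bmfM.
have : 0 <= \int[P]_w (f w ^+ 2 - 2 * m * `|f w| + m ^+ 2).
  apply: Rintegral_ge0 => w _.
  rewrite -(real_normK (num_real (f w))).
  by have := sqr_ge0 (`|f w| - m); congr (_ <= _); ring.
have b3 : bmf (fun w => 2 * m * `|f w|) by apply: bmfM => //; exact: bmf_cst.
rewrite (bmf_intD P (bmfB b2 b3) (bmf_cst _)) (bmf_intB P b2 b3) (bmf_intZ P _ bn).
rewrite (int_prob_cst P (m ^+ 2)) -/m; lra.
Qed.

Lemma orthogonal_bound (t0 t1 h M : R) (br : RR * Omega -> R) :
  t0 <= t1 -> 0 < h -> 0 <= M -> bmf br ->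
  (forall s w, t0 <= s -> s <= t1 -> `|br (s, w)| <= M) ->
  (forall s s', t0 <= s' -> s' <= s - h -> s <= t1 ->
     \int[P]_w (br (s, w) * br (s', w)) = 0) ->
  \int[P]_w `|\int[lebI t0 t1]_s br (s, w)| <=
    M * Num.sqrt (2 * h * (t1 - t0)).
Proof.
move=> t01 h0 M0 bbr brM ort.
pose W w := \int[lebI t0 t1]_s br (s, w).
have bswap : bmf (fun z : Omega * RR => br (z.2, z.1)).
  by apply: (bmf_comp _ bbr); exact: measurable_swap.
have bW : bmf W by exact: (bmf_int_inner P (lebI t0 t1) bswap).
have bbrs s : bmf (fun w => br (s, w)).
  by apply: bmf_comp bbr; exact: pair1_measurable.
have bbrw w : bmf (fun s => br (s, w)).
  by apply: bmf_comp bbr; exact: pair2_measurable.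
have -> : \int[P]_w `|\int[lebI t0 t1]_s br (s, w)| = \int[P]_w `|W w| by [].
have EW : \int[P]_w (W w ^+ 2) <= (t1 - t0) * (2 * h * M ^+ 2).
  have b1 : bmf (fun z : Omega * RR => W z.1 * br (z.2, z.1)).
    by apply: bmfM => //; apply: bmf_comp bW; exact: measurable_fst.
  have -> : \int[P]_w (W w ^+ 2) = \int[P]_w \int[lebI t0 t1]_s (W w * br (s, w)).
    by apply: eq_Rintegral => w _; rewrite bmf_intZ.
  rewrite (bmf_Fubini P (lebI t0 t1) b1) /=.
  have b2 : bmf (fun s : RR => \int[P]_w (W w * br (s, w))).
    apply: (bmf_int_inner (lebI t0 t1) P (f := fun z => W z.2 * br z)).
    by apply: bmfM => //; apply: bmf_comp bW; exact: measurable_snd.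
  apply: le_trans (ler_norm _) _; apply: lebI_int_norm => // s s0 s1.
  have b3 : bmf (fun z : Omega * RR => br (s, z.1) * br (z.2, z.1)).
    by apply: bmfM => //; apply: (bmf_comp _ (bbrs s)); exact: measurable_fst.
  have -> : \int[P]_w (W w * br (s, w)) = \int[lebI t0 t1]_s' \int[P]_w (br (s, w) * br (s', w)).
    rewrite -(bmf_Fubini P (lebI t0 t1) b3) /=.
    by apply: eq_Rintegral => w _; rewrite /= bmf_intZ // mulrC.
  pose phi s' := \int[P]_w (br (s, w) * br (s', w)).
  have bphi : bmf phi.
    apply: (bmf_int_inner (lebI t0 t1) P (f := fun z => br (s, z.2) * br z)).
    by apply: bmfM => //; apply: (bmf_comp _ (bbrs s)); exact: measurable_snd.
  have phiM s' : t0 <= s' -> s' <= t1 -> `|phi s'| <= M ^+ 2.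
    move=> s'0 s'1; apply: bmf_int_ub; first exact: bmfM.
    by move=> w; rewrite normrM expr2 ler_pM // brM.
  have phi0 s' : t0 <= s' -> s' <= t1 -> s' <= s - h \/ s + h <= s' -> `|phi s'| <= 0.
    move=> s'0 s'1 [H|H]; rewrite normr_le0; apply/eqP; first exact: ort.
    rewrite /phi; under eq_Rintegral do rewrite mulrC.
    by apply: ort => //; lra.
  set p := Num.max t0 (s - h); set r := Num.min t1 (s + h).
  have p0 : t0 <= p by rewrite le_max lexx.
  have ps : p <= s by rewrite ge_max s0 /=; lra.
  have sr : s <= r by rewrite le_min s1 /=; lra.
  have r1 : r <= t1 by rewrite ge_min lexx.
  have pr : p <= r by exact: le_trans sr.
  rewrite -[X in `|X| <= _]/(\int[lebI t0 t1]_s' phi s').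
  rewrite (lebI_int_split bphi p0 (le_trans pr r1)) (lebI_int_split bphi pr r1).
  have Z1 : `|\int[lebI t0 p]_s' phi s'| <= 0.
    have [H|H] := lerP (s - h) t0.
      rewrite /p max_l //; apply: le_trans (lebI_int_norm bphi (lexx _) _) _.
        by move=> s' a b; apply: phiM => //; lra.
      by rewrite subrr mul0r.
    rewrite -(mulr0 (p - t0)); apply: lebI_int_norm => // s' a.
    by rewrite /p (max_r (ltW H)) => b; apply: phi0 => //; [lra|left].
  have Z2 : `|\int[lebI r t1]_s' phi s'| <= 0.
    have [H|H] := lerP t1 (s + h).
      rewrite /r min_l //; apply: le_trans (lebI_int_norm bphi (lexx _) _) _.
        by move=> s' a b; apply: phiM => //; lra.
      by rewrite subrr mul0r.
    rewrite -(mulr0 (t1 - r)); apply: lebI_int_norm => // s'.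
    by rewrite /r (min_r (ltW H)) => a b; apply: phi0 => //; [lra|right].
  have Z3 : `|\int[lebI p r]_s' phi s'| <= (r - p) * M ^+ 2.
    by apply: lebI_int_norm => // s' a b; apply: phiM; lra.
  have rp : r - p <= 2 * h.
    have : s - h <= p by rewrite le_max lexx orbT.
    have : r <= s + h by rewrite ge_min lexx orbT.
    lra.
  have H1 : (r - p) * M ^+ 2 <= 2 * h * M ^+ 2 by rewrite ler_wpM2r // sqr_ge0.
  apply: le_trans (ler_normD _ _) _.
  rewrite -[leRHS]add0r; apply: lerD => //.
  apply: le_trans (ler_normD _ _) _.
  rewrite -[leRHS]addr0; apply: lerD => //; exact: le_trans Z3 H1.
have x0 : 0 <= \int[P]_w `|W w| by apply: Rintegral_ge0.
rewrite -(ler_pXn2r (n := 2)) ?nnegrE ?mulr_ge0 ?sqrtr_ge0 //.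
apply: le_trans (bmf_int_sqr bW) _; apply: le_trans EW _.
rewrite exprMn sqr_sqrtr ?mulr_ge0 ?subr_ge0 ?(ltW h0) //; lra.
Qed.

End orthogonality.

Section lag_comparison.
Context {R : realType} {disp : measure_display} {Omega : measurableType disp}.
Variables (P : probability Omega R) (d : nat).
Local Notation V := 'rV[R]_d.
Local Notation BV := (borel_rV R d).
Local Notation RR := (measurableTypeR R).
Variables (T : R) (G : R -> set (set Omega)) (B : R -> Omega -> V).
Hypothesis hB : brownian_wrt P T G B.

Definition jointly_measurable (X : R -> Omega -> V) :=
  measurable_fun setT (fun z : RR * Omega => X z.1 z.2 : BV).

Definition adapted (X : R -> Omega -> V) := forall (s : R), 0 <= s -> s <= T ->
  measurable_fun setT (X s : past G s -> BV).

Definition bmf3 (g : R -> V -> V -> R) :=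
  bmf (fun z : RR * (BV * BV) => g z.1 z.2.1 z.2.2).

Hypothesis mB : jointly_measurable B.
Variables (xi eta : R -> Omega -> V).
Hypotheses (mxi : jointly_measurable xi) (meta : jointly_measurable eta).
Hypotheses (axi : adapted xi) (aeta : adapted eta).

Lemma shift_jointly X c : jointly_measurable X ->
  measurable_fun setT (fun z : RR * Omega => X (z.1 - c) z.2 : BV).
Proof.
move=> mX; apply: (measurableT_comp (f := fun z : RR * Omega => X z.1 z.2 : BV)
  (g := fun z : RR * Omega => (z.1 - c : RR, z.2))) => //.
apply/measurable_fun_pairP; split; last exact: measurable_snd.
by apply: measurable_funB; [exact: measurable_fst|exact: measurable_cst].
Qed.

(* The conditional expectation, given the past of [s - b], of [g] at the lagged
   state [xi (s - a)], with [xi] replaced by a Brownian increment on the lag. *)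
Definition lag_heat (a b : R) (g : R -> V -> V -> R) (s : R) (w : Omega) : R :=
  heat P B (s - b) (s - a) (fun y => g s y (eta (s - b) w)) (xi (s - b) w).

Lemma bmf_lag a g : bmf3 g ->
  bmf (fun z : RR * Omega => g z.1 (xi (z.1 - a) z.2) (eta (z.1 - a) z.2)).
Proof.
move=> bg; apply: (bmf_comp _ bg (h := fun z : RR * Omega =>
   (z.1, (xi (z.1 - a) z.2 : BV, eta (z.1 - a) z.2 : BV)))).
apply: measurable_fun_pair; first exact: measurable_fst.
by apply: measurable_fun_pair; exact: shift_jointly.
Qed.

Lemma bmf_lag_heat a b g : bmf3 g ->
  bmf (fun z : RR * Omega => lag_heat a b g z.1 z.2).
Proof.
move=> bg.
have m1 : measurable_fun setT (fun z : (RR * Omega) * Omega => z.1.1).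
  exact: (measurableT_comp measurable_fst measurable_fst).
have m2 X c : jointly_measurable X -> measurable_fun setT
    (fun z : (RR * Omega) * Omega => X (z.1.1 - c) z.1.2 : BV).
  by move=> mX; exact: (measurableT_comp (shift_jointly c mX) measurable_fst).
have m3 X c : jointly_measurable X -> measurable_fun setT
    (fun z : (RR * Omega) * Omega => X (z.1.1 - c) z.2 : BV).
  move=> mX; apply: (measurableT_comp (f := fun z : RR * Omega => X (z.1 - c) z.2 : BV)
    (g := fun z : (RR * Omega) * Omega => (z.1.1, z.2))).
    exact: shift_jointly.
  by apply: measurable_fun_pair => //; exact: measurable_snd.
have bb : bmf (fun z : (RR * Omega) * Omega =>
   g z.1.1 (xi (z.1.1 - b) z.1.2 + (B (z.1.1 - a) z.2 - B (z.1.1 - b) z.2))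
     (eta (z.1.1 - b) z.1.2)).
  apply: (bmf_comp _ bg (h := fun z : (RR * Omega) * Omega =>
   (z.1.1, (xi (z.1.1 - b) z.1.2 + (B (z.1.1 - a) z.2 - B (z.1.1 - b) z.2) : BV,
     eta (z.1.1 - b) z.1.2 : BV)))).
  apply: measurable_fun_pair; first exact: m1.
  apply: measurable_fun_pair; last exact: m2.
  by apply: measurable_rVD; [exact: m2|apply: measurable_rVB; exact: m3].
exact: (bmf_int_inner (@dirac _ (RR * Omega)%type point R) P bb).
Qed.

Variables (g : R -> V -> V -> R) (a b t M Ly Lu Kxi Keta : R).
Hypotheses (bg : bmf3 g) (a0 : 0 <= a) (ab : a < b) (bt : b <= t) (tT : t <= T).
Hypotheses (M0 : 0 <= M) (Ly0 : 0 <= Ly) (Lu0 : 0 <= Lu) (Kxi0 : 0 <= Kxi) (Keta0 : 0 <= Keta).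
Variable D : R.
Hypothesis etaD : forall (s : R) w, 0 <= s -> s <= T -> `|eta s w| <= D.
Hypothesis gM : forall (s : R) y u, b <= s -> s <= t -> `|u| <= D -> `|g s y u| <= M.
Hypothesis gy : forall (s : R) y y' u, b <= s -> s <= t -> `|u| <= D ->
  `|g s y u - g s y' u| <= Ly * `|y - y'|.
Hypothesis gu : forall (s : R) y u u', b <= s -> s <= t -> `|u| <= D -> `|u'| <= D ->
  `|g s y u - g s y u'| <= Lu * `|u - u'|.
Hypothesis xiK : forall (r s : R), 0 <= r -> r <= s -> s <= T ->
  (\int[P]_w (`|xi s w - xi r w - incr B r s w|)%:E <= (Kxi * (s - r))%:E)%E.
Hypothesis etaK : forall (r s : R) w, 0 <= r -> r <= s -> s <= T ->
  `|eta s w - eta r w| <= Keta * (s - r).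

Let lags : [/\ 0 <= a, a < b, b <= t & t <= T]. Proof. by []. Qed.

Let A (s : R) (w : Omega) := g s (xi (s - a) w) (eta (s - a) w).
Let A1 (s : R) (w : Omega) :=
  g s (xi (s - b) w + incr B (s - b) (s - a) w) (eta (s - b) w).
Let A2 := lag_heat a b g.

Let bA : bmf (fun z : RR * Omega => A z.1 z.2).
Proof. exact: bmf_lag. Qed.

Let bA1 : bmf (fun z : RR * Omega => A1 z.1 z.2).
Proof.
apply: (bmf_comp _ bg (h := fun z : RR * Omega =>
   (z.1, (xi (z.1 - b) z.2 + incr B (z.1 - b) (z.1 - a) z.2 : BV, eta (z.1 - b) z.2 : BV)))).
apply: measurable_fun_pair; first exact: measurable_fst.
apply: measurable_fun_pair; last exact: shift_jointly.
by apply: measurable_rVD; [|apply: measurable_rVB]; exact: shift_jointly.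
Qed.

Let bA2 : bmf (fun z : RR * Omega => A2 z.1 z.2).
Proof. exact: bmf_lag_heat. Qed.

Let br (z : RR * Omega) := A1 z.1 z.2 - A2 z.1 z.2.

Let bbr : bmf br. Proof. exact: bmfB. Qed.

Let past_pair (r s : R) : 0 <= r -> r <= s -> s <= T ->
  measurable_fun setT (xi r : past G s -> BV) /\
  measurable_fun setT (eta r : past G s -> BV).
Proof.
move=> r0 rs sT; have rT := le_trans rs sT.
by split; apply: (past_mono hB rs); [exact: axi|exact: aeta].
Qed.

Let past_br (s r : R) : b <= s -> s <= t -> s - a <= r -> r <= T ->
  bmf (fun w : past G r => br (s, w)).
Proof.
move=> bs st ar rT.
have [a0' ab' bt' tT'] := lags.
have sb0 : 0 <= s - b by lra.
have [m1 m2] : measurable_fun setT (xi (s - b) : past G r -> BV) /\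
    measurable_fun setT (eta (s - b) : past G r -> BV) by apply: past_pair; lra.
have m3 : measurable_fun setT (incr B (s - b) (s - a) : past G r -> BV).
  by apply: (past_mono hB ar); apply: (past_incr hB); lra.
apply: bmfB.
  apply: (bmf_comp _ bg (h := fun w : past G r =>
    (s : RR, (xi (s - b) w + incr B (s - b) (s - a) w : BV, eta (s - b) w : BV)))).
  apply: measurable_fun_pair; first exact: measurable_cst.
  by apply: measurable_fun_pair => //; exact: measurable_rVD.
have mi : measurable_fun setT (incr B (s - b) (s - a) : Omega -> BV).
  by apply: (measurable_incr hB); lra.
have bb : bmf (fun z : past G r * Omega =>
   g s (xi (s - b) z.1 + incr B (s - b) (s - a) z.2) (eta (s - b) z.1)).
  apply: (bmf_comp _ bg (h := fun z : past G r * Omega =>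
    (s : RR, (xi (s - b) z.1 + incr B (s - b) (s - a) z.2 : BV, eta (s - b) z.1 : BV)))).
  apply: measurable_fun_pair; first exact: measurable_cst.
  apply: measurable_fun_pair; last exact: (measurableT_comp m2 measurable_fst).
  apply: measurable_rVD; first exact: (measurableT_comp m1 measurable_fst).
  exact: (measurableT_comp mi measurable_snd).
exact: (bmf_int_inner (@dirac _ (past G r) point R) P bb).
Qed.

Let br_orthogonal (s s' : R) : b <= s' -> s' <= s - (b - a) -> s <= t ->
  \int[P]_w (br (s, w) * br (s', w)) = 0.
Proof.
move=> bs' ss' st.
have [a0' ab' bt' tT'] := lags.
have sb0 : 0 <= s - b by lra.
have bs'w : bmf (fun w => br (s', w)).
  by apply: bmf_comp bbr; exact: pair1_measurable.
have b1 : bmf (fun w => A1 s w).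
  by apply: (bmf_comp _ bA1 (h := fun w => (s : RR, w))); exact: pair1_measurable.
have b2 : bmf (fun w => A2 s w).
  by apply: (bmf_comp _ bA2 (h := fun w => (s : RR, w))); exact: pair1_measurable.
have -> : \int[P]_w (br (s, w) * br (s', w)) =
   \int[P]_w (br (s', w) * A1 s w - br (s', w) * A2 s w).
  by apply: eq_Rintegral => w _; rewrite /br /=; ring.
rewrite (bmf_intB P (bmfM bs'w b1) (bmfM bs'w b2)).
apply/eqP; rewrite subr_eq0; apply/eqP.
have sbT : s - b <= T by lra.
pose h (z : past G (s - b) * BV) : R := br (s', z.1) *
   g s (xi (s - b) z.1 + (z.2 : V)) (eta (s - b) z.1).
have [m1 m2] := past_pair sb0 (lexx _) sbT.
have bh : bmf h.
  apply: bmfM.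
    apply: (bmf_comp measurable_fst (f := fun w : past G (s - b) => br (s', w))).
    by apply: past_br => //; lra.
  apply: (bmf_comp _ bg (h := fun z : past G (s - b) * BV =>
    (s : RR, (xi (s - b) z.1 + (z.2 : V) : BV, eta (s - b) z.1 : BV)))).
  apply: measurable_fun_pair; first exact: measurable_cst.
  apply: measurable_fun_pair; last exact: (measurableT_comp m2 measurable_fst).
  apply: measurable_rVD; first exact: (measurableT_comp m1 measurable_fst).
  exact: measurable_snd.
have sab : s - b < s - a by lra.
have saT : s - a <= T by lra.
have mid : measurable_fun setT (id : past G (s - b) -> past G (s - b)).
  exact: measurable_id.
rewrite [LHS](incr_freeze hB sb0 sab saT mid bh).
apply: eq_Rintegral => w _; rewrite /h /A2 /lag_heat /heat /=.
have mi : measurable_fun setT (incr B (s - b) (s - a) : Omega -> BV).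
  by apply: (measurable_incr hB); lra.
apply: bmf_intZ.
apply: (bmf_comp _ bg (h := fun w' : Omega =>
   (s : RR, (xi (s - b) w + incr B (s - b) (s - a) w' : BV, eta (s - b) w : BV)))).
apply: measurable_fun_pair; first exact: measurable_cst.
apply: measurable_fun_pair; last exact: measurable_cst.
by apply: measurable_rVD => //; exact: measurable_cst.
Qed.

Let bsl (f : RR * Omega -> R) s : bmf f -> bmf (fun w => f (s, w)).
Proof. by move=> bf; apply: bmf_comp bf; exact: pair1_measurable. Qed.

Let bsr (f : RR * Omega -> R) w : bmf f -> bmf (fun s => f (s, w)).
Proof. by move=> bf; apply: bmf_comp bf; exact: pair2_measurable. Qed.

Let bI (f : RR * Omega -> R) : bmf f -> bmf (fun w => \int[lebI b t]_s f (s, w)).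
Proof.
move=> bf; apply: (bmf_int_inner P (lebI b t) (f := fun z => f (z.2, z.1))).
by apply: (bmf_comp _ bf); exact: measurable_swap.
Qed.

Lemma lag_comparison :
  \int[P]_w `|\int[lebI b t]_s g s (xi (s - a) w) (eta (s - a) w)
              - \int[lebI b t]_s lag_heat a b g s w|
  <= (t - b) * ((Ly * Kxi + Lu * Keta) * (b - a))
     + 2 * M * Num.sqrt (2 * (b - a) * (t - b)).
Proof.
have [a0' ab' bt' tT'] := lags.
have M0' := M0.
pose e z := A z.1 z.2 - A1 z.1 z.2.
have be : bmf e by exact: bmfB.
apply: (@le_trans _ _ (\int[P]_w (`|\int[lebI b t]_s e (s, w)| + `|\int[lebI b t]_s br (s, w)|))).
  apply: bmf_int_le.
  - by apply: bmf_norm; apply: bmfB; [exact: (bI bA)|exact: (bI bA2)].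
  - by apply: bmfD; apply: bmf_norm; exact: bI.
  move=> w; apply: le_trans (ler_normD _ _); rewrite le_eqVlt; apply/orP; left; apply/eqP.
  congr `|_|; rewrite /e /br /=.
  rewrite (bmf_intB _ (bsr w bA) (bsr w bA1)) (bmf_intB _ (bsr w bA1) (bsr w bA2)) /=.
  by rewrite addrA subrK.
rewrite (bmf_intD P (bmf_norm (bI be)) (bmf_norm (bI bbr))); apply: lerD; last first.
  have := @orthogonal_bound _ _ _ P b t (b - a) (2 * M) br bt _ _ bbr _ br_orthogonal.
  apply; [lra|lra|move=> s w bs st].
  have sb0 : 0 <= s - b by lra.
  have eD : `|eta (s - b) w| <= D by apply: etaD; lra.
  have H1 : `|A1 s w| <= M by exact: gM.
  have H2 : `|A2 s w| <= M.
    apply: bmf_int_ub; last by move=> w'; exact: gM.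
    have mi : measurable_fun setT (incr B (s - b) (s - a) : Omega -> BV).
      by apply: (measurable_incr hB); lra.
    apply: (bmf_comp _ bg (h := fun w' : Omega =>
      (s : RR, (xi (s - b) w + incr B (s - b) (s - a) w' : BV, eta (s - b) w : BV)))).
    apply: measurable_fun_pair; first exact: measurable_cst.
    apply: measurable_fun_pair; last exact: measurable_cst.
    by apply: measurable_rVD => //; exact: measurable_cst.
  by apply: le_trans (ler_normB _ _) _; rewrite /=; lra.
have bes := bmf_norm be.
apply: (@le_trans _ _ (\int[P]_w \int[lebI b t]_s `|e (s, w)|)).
  apply: bmf_int_le; [exact: bmf_norm (bI be)|exact: bI bes|].
  by move=> w; apply: bmf_int_norm; exact: bsr.
have bsw : bmf (fun z : Omega * RR => `|e (z.2, z.1)|).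
  by apply: (bmf_comp _ bes); exact: measurable_swap.
rewrite (bmf_Fubini P (lebI b t) bsw) /=.
apply: le_trans (ler_norm _) _; apply: lebI_int_norm => //.
  exact: (bmf_int_inner (lebI b t) P bes).
move=> s bs st.
have sb0 : 0 <= s - b by lra.
have sba : s - b <= s - a by lra.
have saT : s - a <= T by lra.
have bews : bmf (fun w => `|e (s, w)|) by exact: (bsl s bes).
rewrite ger0_norm; last by apply: Rintegral_ge0.
rewrite -lee_fin bmf_intE //.
have mx X c : jointly_measurable X -> measurable_fun setT (X c : Omega -> BV).
  by move=> mX; exact: (measurableT_comp mX (pair1_measurable (c : RR))).
have mn : measurable_fun setT (fun w =>
    `|xi (s - a) w - xi (s - b) w - incr B (s - b) (s - a) w|).
  apply: (measurableT_comp (f := fun v : BV => `|v : V|)); first exact: measurable_rV_norm.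
  by apply: measurable_rVB; apply: measurable_rVB; exact: mx.
apply: (@le_trans _ _ (\int[P]_w ((Ly * `|xi (s - a) w - xi (s - b) w - incr B (s - b) (s - a) w|)%:E
    + (Lu * (Keta * (b - a)))%:E))%E).
  apply: ge0_le_integral => //.
  - by apply/measurable_EFinP; case: bews.
  - apply: emeasurable_funD => //; apply/measurable_EFinP.
    by apply: measurable_funM => //.
  move=> w _; rewrite -EFinD lee_fin /e /A /A1 /=.
  have e1 : `|eta (s - b) w| <= D by apply: etaD; lra.
  have e2 : `|eta (s - a) w| <= D by apply: etaD; lra.
  set y := xi (s - a) w; set y' := xi (s - b) w + _.
  set u := eta (s - a) w; set u' := eta (s - b) w.
  have -> : g s y u - g s y' u' = (g s y u - g s y' u) + (g s y' u - g s y' u').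
    by rewrite addrA subrK.
  apply: le_trans (ler_normD _ _) _; apply: lerD.
    have -> : xi (s - a) w - xi (s - b) w - incr B (s - b) (s - a) w = y - y'.
      by rewrite /y /y'; vring.
    exact: gy.
  apply: le_trans (gu y' bs st e2 e1) _; apply: ler_wpM2l => //.
  by have := etaK w sb0 sba saT; congr (_ <= _ * _); ring.
have mL : measurable_fun setT (fun w =>
    (Ly * `|xi (s - a) w - xi (s - b) w - incr B (s - b) (s - a) w|)%:E).
  by apply/measurable_EFinP; apply: measurable_funM.
rewrite (ge0_integralD P measurableT _ mL _ (measurable_cst _)); first last.
- by move=> w _; rewrite lee_fin !mulr_ge0 //; lra.
- by move=> w _; rewrite lee_fin mulr_ge0.
under eq_integral do rewrite EFinM.
rewrite ge0_integralZl_EFin //; last by apply/measurable_EFinP.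
rewrite integral_cst // [X in (_ + _ * X)%E](probability_setT P) mule1.
rewrite mulrDl EFinD -mulrA; apply: leeD.
  rewrite EFinM; apply: lee_wpmul2l; first by rewrite lee_fin.
  by have := xiK sb0 sba saT; congr (_ <= (_ * _)%:E)%E; ring.
by rewrite lee_fin mulrA.
Qed.

End lag_comparison.

Section noise_averaging.
Context {R : realType} {disp : measure_display} {Omega : measurableType disp}.
Variables (P : probability Omega R) (d : nat).
Local Notation V := 'rV[R]_d.
Local Notation BV := (borel_rV R d).
Local Notation RR := (measurableTypeR R).
Variables (T : R) (G : R -> set (set Omega)) (B : R -> Omega -> V).
Hypotheses (hB : brownian_wrt P T G B) (mB : jointly_measurable B).
Variables (xi eta : R -> Omega -> V).
Hypotheses (mxi : jointly_measurable xi) (meta : jointly_measurable eta).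
Hypotheses (axi : adapted T G xi) (aeta : adapted T G eta).
Variables (K delta D : R) (q : R -> V -> V -> R).
Local Notation root4 x := (Num.sqrt (Num.sqrt x)).

Hypotheses (K0 : 0 <= K) (delta0 : 0 < delta) (delta1 : delta <= 1) (T0 : 0 < T).
Hypothesis bq : bmf3 q.
Hypothesis etaD : forall (s : R) w, 0 <= s -> s <= T -> `|eta s w| <= D.
Hypothesis qM : forall (s : R) y u, 0 <= s -> s <= T -> `|u| <= D ->
  `|q s y u| <= K * delta.
Hypothesis qy : forall (s : R) y y' u, 0 <= s -> s <= T -> `|u| <= D ->
  `|q s y u - q s y' u| <= K * `|y - y'|.
Hypothesis qu : forall (s : R) y u u', 0 <= s -> s <= T -> `|u| <= D -> `|u'| <= D ->
  `|q s y u - q s y u'| <= K * `|u - u'|.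
Hypothesis heatqM : forall (s r v : R) y u, 0 <= s -> s <= T ->
  0 <= r -> r < v -> v <= T -> `|u| <= D ->
  `|heat P B r v (fun y => q s y u) y| <= K * delta ^+ 2 / root4 (v - r).
Hypothesis heatqu : forall (s r v : R) y u u', 0 <= s -> s <= T ->
  0 <= r -> r < v -> v <= T -> `|u| <= D -> `|u'| <= D ->
  `|heat P B r v (fun y => q s y u) y - heat P B r v (fun y => q s y u') y|
    <= K * delta * `|u - u'| / root4 (v - r).
Hypothesis xiK : forall r s : R, 0 <= r -> r <= s -> s <= T ->
  (\int[P]_w (`|xi s w - xi r w - incr B r s w|)%:E <= (K * (s - r))%:E)%E.
Hypothesis etaK : forall (r s : R) w, 0 <= r -> r <= s -> s <= T ->
  `|eta s w - eta r w| <= K * delta * (s - r).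

Let Rad : R := 1 + T.

Definition noise_stepC : R :=
  60 * gaussC * d%:R * K ^+ 2 * T + 15 * K ^+ 2 * T * (1 + T) ^+ 2
  + 2 * K * Num.sqrt (30 * T) + 15 * K * (1 + T) ^+ 2.

Definition noiseC : R :=
  2 * T * K ^+ 2 + 2 * K * Num.sqrt (2 * T) + K + 3 * noise_stepC * (1 + T).

Let F (rho t : R) : R := \int[P]_w
  `|\int[lebI (rho ^+ 4) t]_s lag_heat P B xi eta 0 (rho ^+ 4) q s w|.

Let rho_le (rho t : R) : 0 < rho -> rho ^+ 4 <= t -> t <= T -> rho <= Rad.
Proof.
have T0' := T0; move=> r0 rt tT; rewrite leNgt; apply/negP; rewrite /Rad => H.
have : rho ^+ 1 <= rho ^+ 4 by apply: ler_weXn2l => //; lra.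
rewrite expr1; lra.
Qed.

Let bqs (s : R) (u : V) : bmf (fun y : BV => q s y u).
Proof.
apply: (bmf_comp _ bq (h := fun y : BV => (s : RR, (y, u : BV)))).
apply: measurable_fun_pair; first exact: measurable_cst.
by apply: measurable_fun_pair; [exact: measurable_id|exact: measurable_cst].
Qed.

Let bheatq (e : R) : bmf3 (fun s y u => heat P B (s - e) s (fun y => q s y u) y).
Proof.
have mz X c : jointly_measurable X -> measurable_fun setT
    (fun z : (RR * (BV * BV)) * Omega => X (z.1.1 - c) z.2 : BV).
  move=> mX; apply: (measurableT_comp (f := fun z : RR * Omega => X (z.1 - c) z.2 : BV)
    (g := fun z : (RR * (BV * BV)) * Omega => (z.1.1, z.2))).
    exact: shift_jointly.
  apply: measurable_fun_pair; last exact: measurable_snd.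
  exact: (measurableT_comp measurable_fst measurable_fst).
have mz0 : measurable_fun setT
    (fun z : (RR * (BV * BV)) * Omega => B z.1.1 z.2 : BV).
  by have := mz B 0 mB; under eq_fun do rewrite subr0.
have m2 : measurable_fun setT (fun z : (RR * (BV * BV)) * Omega => z.1.2).
  exact: (measurableT_comp measurable_snd measurable_fst).
have bb : bmf (fun z : (RR * (BV * BV)) * Omega =>
    q z.1.1 ((z.1.2.1 : V) + (B z.1.1 z.2 - B (z.1.1 - e) z.2)) z.1.2.2).
  apply: (bmf_comp _ bq (h := fun z : (RR * (BV * BV)) * Omega =>
    (z.1.1, ((z.1.2.1 : V) + (B z.1.1 z.2 - B (z.1.1 - e) z.2) : BV, z.1.2.2)))).
  apply: measurable_fun_pair.
    exact: (measurableT_comp measurable_fst measurable_fst).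
  apply: measurable_fun_pair; last exact: (measurableT_comp measurable_snd m2).
  apply: measurable_rVD; first exact: (measurableT_comp measurable_fst m2).
  by apply: measurable_rVB => //; exact: mz.
exact: (bmf_int_inner (@dirac _ (RR * (BV * BV))%type point R) P bb).
Qed.

Let root4K (rho : R) : 0 <= rho -> root4 (rho ^+ 4) = rho.
Proof.
move=> r0; have -> : rho ^+ 4 = (rho ^+ 2) ^+ 2 by rewrite -exprM.
by rewrite !sqrtr_sqr ger0_norm ?exprn_ge0 // sqrtr_sqr ger0_norm.
Qed.

Let blag_slice (b : R) w : bmf (fun s : RR => lag_heat P B xi eta 0 b q s w).
Proof.
apply: (bmf_comp _ (bmf_lag_heat P mB mxi meta 0 b bq) (h := fun s => (s, w))).
exact: pair2_measurable.
Qed.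

Let blag_int (b c t : R) :
  bmf (fun w => \int[lebI c t]_s lag_heat P B xi eta 0 b q s w).
Proof.
apply: (bmf_int_inner P (lebI c t)
  (f := fun z : Omega * RR => lag_heat P B xi eta 0 b q z.2 z.1)).
apply: (bmf_comp _ (bmf_lag_heat P mB mxi meta 0 b bq)
  (h := fun z : Omega * RR => (z.2, z.1))).
exact: measurable_swap.
Qed.

Let lagM (rho s : R) w : 0 < rho -> rho ^+ 4 <= s -> s <= T ->
  `|lag_heat P B xi eta 0 (rho ^+ 4) q s w| <= K * delta ^+ 2 / rho.
Proof.
move=> r0 rs sT; rewrite /lag_heat subr0.
have r40 : 0 < rho ^+ 4 by rewrite exprn_gt0.
have H := @heatqM s (s - rho ^+ 4) s (xi (s - rho ^+ 4) w) (eta (s - rho ^+ 4) w).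
apply: le_trans (H _ _ _ _ _ _) _; try lra; first by apply: etaD; lra.
have -> : s - (s - rho ^+ 4) = rho ^+ 4 by ring.
by rewrite (root4K (ltW r0)).
Qed.

(* The lag is [rho ^+ 4], so the smoothing factor [lag^(-1/4)] is [rho^-1]; the
   cost of passing from [rho] to [2 * rho] then sums geometrically. *)
Let noise_step (rho t : R) : 0 < rho -> 16 * rho ^+ 4 <= t -> t <= T ->
  F rho t <= F (2 * rho) t + noise_stepC * delta ^+ 2 * rho.
Proof.
move=> r0 rt tT.
have [K0' d0' d1' T0'] : [/\ 0 <= K, 0 < delta, delta <= 1 & 0 < T] by [].
set e := rho ^+ 4 in rt *.
have e0 : 0 < e by rewrite exprn_gt0.
have rR : rho <= Rad by apply: (@rho_le _ t) => //; rewrite -/e; lra.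
have e16 : (2 * rho) ^+ 4 = 16 * e by rewrite exprMn -natrX.
have C2 : 2 <= gaussC :> R := gaussC_ge2.
pose g s y u := heat P B (s - e) s (fun y => q s y u) y.
pose M := K * delta ^+ 2 / rho.
have M0 : 0 <= M by rewrite /M divr_ge0 ?mulr_ge0 ?exprn_ge0 // ltW.
pose Ly := 4 * gaussC * d%:R * K * delta ^+ 2 / rho ^+ 3.
have Ly0 : 0 <= Ly by rewrite /Ly divr_ge0 ?exprn_ge0 ?mulr_ge0 ?exprn_ge0 // ?(ltW r0) ?(ltW d0') //; lra.
pose Lu := K * delta / rho.
have Lu0 : 0 <= Lu by rewrite /Lu divr_ge0 ?mulr_ge0 // ltW.
have gM (s : R) y u : 16 * e <= s -> s <= t -> `|u| <= D -> `|g s y u| <= M.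
  move=> es st uD; apply: le_trans (@heatqM s (s - e) s y u _ _ _ _ _ _) _; try by []; try lra.
  have -> : s - (s - e) = e by ring.
  by rewrite /e (root4K (ltW r0)).
have gu (s : R) y u u' : 16 * e <= s -> s <= t -> `|u| <= D -> `|u'| <= D ->
    `|g s y u - g s y u'| <= Lu * `|u - u'|.
  move=> es st uD uD'; apply: le_trans (@heatqu s (s - e) s y u u' _ _ _ _ _ _ _) _; try by []; try lra.
  have -> : s - (s - e) = e by ring.
  by rewrite /e (root4K (ltW r0)) /Lu mulrAC.
have gy (s : R) y y' u : 16 * e <= s -> s <= t -> `|u| <= D ->
    `|g s y u - g s y' u| <= Ly * `|y - y'|.
  move=> es st uD; rewrite /g; set v := s - e / 2.
  have se0 : 0 <= s - e by lra.
  have sev : s - e < v by rewrite /v; lra.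
  have vs : v < s by rewrite /v; lra.
  have sT : s <= T by lra.
  have vT : v <= T by lra.
  have v0 : 0 <= v by lra.
  have bqsu := bqs s u.
  rewrite !(heat_semigroup hB _ se0 sev vs sT bqsu).
  have bh : bmf (heat P B v s (fun y : BV => q s y u) : BV -> R).
    by apply: (bmf_heat hB) => //; exact: ltW.
  have r4 : rho / 2 <= root4 (s - v).
    have -> : s - v = e / 2 by rewrite /v; ring.
    rewrite -[leLHS]root4K ?divr_ge0 ?(ltW r0) // !ler_wsqrtr //.
    have -> : (rho / 2) ^+ 4 = e / 16 by rewrite /e; field.
    lra.
  have r2 : rho ^+ 2 / 2 <= Num.sqrt (v - (s - e)).
    have -> : v - (s - e) = e / 2 by rewrite /v; field.
    rewrite -[leLHS]ger0_norm ?divr_ge0 ?exprn_ge0 ?(ltW r0) // -sqrtr_sqr ler_wsqrtr //.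
    have -> : (rho ^+ 2 / 2) ^+ 2 = e / 4 by rewrite /e; field.
    lra.
  have p4 : 0 < root4 (s - v) by apply: lt_le_trans r4; lra.
  have p2 : 0 < Num.sqrt (v - (s - e)) by apply: lt_le_trans r2; rewrite divr_gt0 ?exprn_gt0.
  pose A := K * delta ^+ 2 / (rho / 2).
  have KA : forall z : BV, `|heat P B v s (fun y : BV => q s y u) z| <= A.
    move=> z; apply: le_trans (@heatqM s v s z u _ _ _ _ _ _) _ => //; first by lra.
    rewrite /A ler_wpM2l ?mulr_ge0 ?exprn_ge0 ?(ltW d0') //.
    by rewrite lef_pV2 // posrE //; lra.
  have := heat_bounded_lip hB se0 sev vT y' (y - y') bh KA.
  rewrite (addrC y') subrK => H; apply: le_trans H _.
  apply: ler_wpM2r => //.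
  have A0 : 0 <= A by rewrite /A divr_ge0 ?mulr_ge0 ?exprn_ge0 ?(ltW d0') //; lra.
  apply: (@le_trans _ _ (gaussC * A / (rho ^+ 2 / 2) * d%:R)).
    apply: ler_wpM2r => //; apply: ler_wpM2l; first by rewrite mulr_ge0 //; lra.
    by rewrite lef_pV2 // posrE // divr_gt0 ?exprn_gt0.
  rewrite le_eqVlt; apply/orP; left; apply/eqP; rewrite /A /Ly.
  by field; rewrite gt_eqF.
have e16e : e < 16 * e by lra.
have Kd0 : 0 <= K * delta by rewrite mulr_ge0 // ltW.
have := lag_comparison hB mB mxi meta axi aeta (bheatq e) (ltW e0) e16e rt tT M0
  Ly0 Lu0 Kd0 etaD gM gy gu xiK etaK.
set X := (X in X <= _ -> _) => H.
have eA w : \int[lebI (16 * e) t]_s heat P B (s - e) s (fun y => q s y (eta (s - e) w)) (xi (s - e) w) =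
    \int[lebI (16 * e) t]_s lag_heat P B xi eta 0 e q s w.
  by apply: eq_Rintegral => s _; rewrite /lag_heat subr0.
have eA2 w : \int[lebI (16 * e) t]_s lag_heat P B xi eta e (16 * e) g s w =
    \int[lebI (16 * e) t]_s lag_heat P B xi eta 0 (16 * e) q s w.
  have b1 : bmf (fun s : RR => lag_heat P B xi eta e (16 * e) g s w).
    apply: (bmf_comp _ (bmf_lag_heat P mB mxi meta e (16 * e) (bheatq e)) (h := fun s => (s, w))).
    exact: pair2_measurable.
  rewrite (lebI_int _ _ b1) (lebI_int _ _ (blag_slice (16 * e) w)).
  apply: eq_Rintegral => s; rewrite inE /= in_itv /= => /andP[s1 s2].
  rewrite /lag_heat subr0 /g.
  by rewrite -(heat_semigroup hB) //; lra.
have step : F rho t <= \int[P]_w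
   (`|\int[lebI e (16 * e)]_s lag_heat P B xi eta 0 e q s w| +
    `|\int[lebI (16 * e) t]_s lag_heat P B xi eta 0 e q s w -
      \int[lebI (16 * e) t]_s lag_heat P B xi eta 0 (16 * e) q s w| +
    `|\int[lebI (16 * e) t]_s lag_heat P B xi eta 0 (16 * e) q s w|).
  apply: bmf_int_le.
  - exact: bmf_norm (blag_int _ _ _).
  - apply: bmfD; last exact: bmf_norm (blag_int _ _ _).
    apply: bmfD; first exact: bmf_norm (blag_int _ _ _).
    by apply: bmf_norm; apply: bmfB; exact: blag_int.
  move=> w; rewrite -/e (lebI_int_split (blag_slice e w) (ltW e16e) rt).
  set x1 := \int[_]_s _; set x2 := \int[_]_s _; set x3 := \int[_]_s _.
  apply: le_trans (ler_normD _ _) _; rewrite -addrA lerD2l.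
  by apply: le_trans (ler_normD _ _); rewrite subrK.
apply: le_trans step _.
rewrite (bmf_intD P); [|apply: bmfD|exact: bmf_norm (blag_int _ _ _)]; last 2 first.
- exact: bmf_norm (blag_int _ _ _).
- by apply: bmf_norm; apply: bmfB; exact: blag_int.
rewrite (bmf_intD P); [|exact: bmf_norm (blag_int _ _ _)|by apply: bmf_norm; apply: bmfB; exact: blag_int].
rewrite [in F (2 * rho) t]/F e16 addrC; apply: lerD => //.
have -> : \int[P]_w `|\int[lebI (16 * e) t]_s lag_heat P B xi eta 0 e q s w -
      \int[lebI (16 * e) t]_s lag_heat P B xi eta 0 (16 * e) q s w| = X.
  by apply: eq_Rintegral => w _; rewrite -eA -eA2.
have H1 : \int[P]_w `|\int[lebI e (16 * e)]_s lag_heat P B xi eta 0 e q s w| <= (16 * e - e) * M.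
  apply: le_trans (ler_norm _) _; apply: bmf_int_ub; first exact: bmf_norm (blag_int _ _ _).
  move=> w; rewrite normr_id; apply: lebI_int_norm; [exact: blag_slice|exact: ltW|].
  by move=> s s1 s2; apply: lagM => //; lra.
apply: le_trans (lerD H1 H) _.
have te : t - 16 * e <= T by lra.
have sq : Num.sqrt (2 * (16 * e - e) * (t - 16 * e)) <= Num.sqrt (30 * T) * rho ^+ 2.
  have -> : rho ^+ 2 = Num.sqrt e.
    have -> : e = (rho ^+ 2) ^+ 2 by rewrite -exprM.
    by rewrite sqrtr_sqr ger0_norm // exprn_ge0 // ltW.
  rewrite -sqrtrM ?mulr_ge0 ?(ltW T0) // ler_wsqrtr //.
  have : (t - 16 * e) * e <= T * e by rewrite ler_wpM2r // ltW.
  lra.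
have r3 : rho ^+ 3 <= Rad ^+ 2 * rho.
  by rewrite exprSr ler_wpM2r ?(ltW r0) // lerXn2r ?nnegrE ?(ltW r0) // (le_trans (ltW r0)).
have d2 : delta ^+ 2 <= 1 by rewrite exprn_ile1 // ltW.
have i1 : (t - 16 * e) * ((Ly * K + Lu * (K * delta)) * (16 * e - e)) <=
   T * ((Ly * K + Lu * (K * delta)) * (16 * e - e)).
  apply: ler_wpM2r => //; apply: mulr_ge0; last by lra.
  by apply: addr_ge0; apply: mulr_ge0.
have i2 : 2 * M * Num.sqrt (2 * (16 * e - e) * (t - 16 * e)) <=
   2 * M * (Num.sqrt (30 * T) * rho ^+ 2).
  by rewrite ler_wpM2l // mulr_ge0.
have E1 : T * ((Ly * K + Lu * (K * delta)) * (16 * e - e)) =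
   60 * gaussC * d%:R * K ^+ 2 * T * delta ^+ 2 * rho + 15 * K ^+ 2 * T * delta ^+ 2 * rho ^+ 3.
  by rewrite /Ly /Lu /e; field; rewrite gt_eqF.
have E2 : 2 * M * (Num.sqrt (30 * T) * rho ^+ 2) =
   2 * K * Num.sqrt (30 * T) * delta ^+ 2 * rho.
  by rewrite /M; field; rewrite gt_eqF.
have E3 : (16 * e - e) * M = 15 * K * delta ^+ 2 * rho ^+ 3.
  by rewrite /M /e; field; rewrite gt_eqF.
have i3 : 15 * K * delta ^+ 2 * rho ^+ 3 <= 15 * K * delta ^+ 2 * (Rad ^+ 2 * rho).
  by rewrite ler_wpM2l // !mulr_ge0 ?exprn_ge0 ?(ltW d0') //.
have i4 : 15 * K ^+ 2 * T * delta ^+ 2 * rho ^+ 3 <= 15 * K ^+ 2 * T * delta ^+ 2 * (Rad ^+ 2 * rho).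
  by rewrite ler_wpM2l // !mulr_ge0 ?exprn_ge0 ?(ltW d0') ?(ltW T0') //.
apply: (@le_trans _ _ (15 * K * delta ^+ 2 * (Rad ^+ 2 * rho) +
  (60 * gaussC * d%:R * K ^+ 2 * T * delta ^+ 2 * rho + 15 * K ^+ 2 * T * delta ^+ 2 * (Rad ^+ 2 * rho)
   + 2 * K * Num.sqrt (30 * T) * delta ^+ 2 * rho))).
  rewrite E3; apply: lerD => //; apply: lerD; last by rewrite -E2.
  by apply: le_trans i1 _; rewrite E1 lerD2l.
by rewrite /noise_stepC /Rad le_eqVlt; apply/orP; left; apply/eqP; ring.
Qed.

Lemma noise_stepC_ge0 : 0 <= noise_stepC.
Proof.
have C2 : 2 <= gaussC :> R := gaussC_ge2.
have [K0' T0'] := (K0, T0).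
by rewrite /noise_stepC !addr_ge0 // !mulr_ge0 ?exprn_ge0 ?sqrtr_ge0 //; lra.
Qed.

Let noise_induction n (rho t : R) : 0 < rho -> rho ^+ 4 <= t -> t <= T ->
  t < (2 ^+ n * rho) ^+ 4 ->
  F rho t <= noise_stepC * delta ^+ 2 * (3 * Rad - rho).
Proof.
have [K0' d0' d1' T0'] : [/\ 0 <= K, 0 < delta, delta <= 1 & 0 < T] by [].
have C0 := noise_stepC_ge0.
have CD : 0 <= noise_stepC * delta ^+ 2 by rewrite mulr_ge0 // exprn_ge0 // ltW.
elim: n rho => [|n IH] rho r0 rt tT tn.
  by move: tn; rewrite expr0 mul1r ltNge rt.
have rR : rho <= Rad by exact: (@rho_le _ t).
have [t16|t16] := lerP (16 * rho ^+ 4) t.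
  have e16 : (2 * rho) ^+ 4 = 16 * rho ^+ 4 by rewrite exprMn -natrX.
  have := noise_step r0 t16 tT.
  have : F (2 * rho) t <= noise_stepC * delta ^+ 2 * (3 * Rad - 2 * rho).
    apply: IH => //; [by rewrite mulr_gt0|by rewrite e16|].
    by rewrite mulrA -exprSr.
  move=> H1 H2; apply: le_trans H2 _; apply: le_trans (lerD H1 (lexx _)) _.
  by rewrite le_eqVlt; apply/orP; left; apply/eqP; ring.
apply: (@le_trans _ _ ((t - rho ^+ 4) * (K * delta ^+ 2 / rho))).
  apply: le_trans (ler_norm _) _; apply: bmf_int_ub; first exact: bmf_norm (blag_int _ _ _).
  move=> w; rewrite normr_id; apply: lebI_int_norm; [exact: blag_slice|by []|].
  by move=> s s1 s2; apply: lagM => //; lra.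
apply: (@le_trans _ _ ((15 * rho ^+ 4) * (K * delta ^+ 2 / rho))).
  apply: ler_wpM2r; last by lra.
  by rewrite divr_ge0 ?mulr_ge0 ?exprn_ge0 // ltW.
have -> : (15 * rho ^+ 4) * (K * delta ^+ 2 / rho) = 15 * K * delta ^+ 2 * rho ^+ 3.
  by field; rewrite gt_eqF.
have r3 : rho ^+ 3 <= Rad ^+ 2 * rho.
  by rewrite exprSr ler_wpM2r ?(ltW r0) // lerXn2r ?nnegrE ?(ltW r0) // (le_trans (ltW r0)).
apply: (@le_trans _ _ (15 * K * delta ^+ 2 * (Rad ^+ 2 * rho))).
  by rewrite ler_wpM2l // !mulr_ge0 ?exprn_ge0 ?(ltW d0') //.
apply: (@le_trans _ _ (noise_stepC * delta ^+ 2 * rho)); last first.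
  by rewrite ler_wpM2l //; lra.
have -> : 15 * K * delta ^+ 2 * (Rad ^+ 2 * rho) = 15 * K * (1 + T) ^+ 2 * delta ^+ 2 * rho.
  by rewrite /Rad; ring.
apply: ler_wpM2r; first exact: ltW.
apply: ler_wpM2r; first by rewrite exprn_ge0 // ltW.
have C2 : 2 <= gaussC :> R := gaussC_ge2.
by rewrite /noise_stepC lerDr !addr_ge0 // !mulr_ge0 ?exprn_ge0 ?sqrtr_ge0 //; lra.
Qed.

Lemma noise_averaging (t : R) : 0 <= t -> t <= T ->
  \int[P]_w `|\int[lebI 0 t]_s q s (xi s w) (eta s w)| <= noiseC * delta ^+ 2.
Proof.
move=> t0 tT.
have [K0' d0' d1' T0'] : [/\ 0 <= K, 0 < delta, delta <= 1 & 0 < T] by [].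
have C0 := noise_stepC_ge0.
have d20 : 0 < delta ^+ 2 by rewrite exprn_gt0.
have bA : bmf (fun z : RR * Omega => q z.1 (xi z.1 z.2) (eta z.1 z.2)).
  have := bmf_lag mxi meta 0 bq; congr bmf; apply/funext => z.
  by rewrite subr0.
have bAs w : bmf (fun s : RR => q s (xi s w) (eta s w)).
  by apply: (bmf_comp _ bA (h := fun s => (s, w))); exact: pair2_measurable.
have bAI a c : bmf (fun w => \int[lebI a c]_s q s (xi s w) (eta s w)).
  apply: (bmf_int_inner P (lebI a c) (f := fun z : Omega * RR => q z.2 (xi z.2 z.1) (eta z.2 z.1))).
  apply: (bmf_comp _ bA (h := fun z : Omega * RR => (z.2, z.1))).
  exact: measurable_swap.
have qb (a c : R) w : 0 <= a -> a <= c -> c <= T ->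
    `|\int[lebI a c]_s q s (xi s w) (eta s w)| <= (c - a) * (K * delta).
  move=> a0 ac cT; apply: lebI_int_norm => // s s1 s2.
  by apply: qM; [lra|lra|apply: etaD; lra].
have noise_ge : K * delta ^+ 2 <= noiseC * delta ^+ 2.
  rewrite ler_wpM2r ?(ltW d20) // /noiseC -addrA -[leLHS]add0r lerD //.
    by rewrite addr_ge0 // !mulr_ge0 ?exprn_ge0 ?sqrtr_ge0 // ltW.
  by rewrite lerDl !mulr_ge0 //; lra.
have [dt|td] := lerP (delta ^+ 2) t; last first.
  apply: le_trans noise_ge.
  apply: le_trans (ler_norm _) _; apply: bmf_int_ub; first exact: bmf_norm.
  move=> w; rewrite normr_id; apply: le_trans (qb 0 t w (lexx _) t0 tT) _.
  rewrite subr0; have : t * (K * delta) <= delta ^+ 2 * (K * 1).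
    apply: ler_pM => //; [by rewrite mulr_ge0 // ltW|exact: ltW|by rewrite ler_wpM2l].
  lra.
pose e := delta ^+ 2.
have Kd0 : 0 <= K * delta by rewrite mulr_ge0 // ltW.
have e_ge : 0 <= e := ltW d20.
have dT : e <= T := le_trans dt tT.
have qM' (s : R) y u : e <= s -> s <= t -> `|u| <= D -> `|q s y u| <= K * delta.
  by move=> es st; apply: qM; lra.
have qy' (s : R) y y' u : e <= s -> s <= t -> `|u| <= D ->
    `|q s y u - q s y' u| <= K * `|y - y'|.
  by move=> es st; apply: qy; lra.
have qu' (s : R) y u u' : e <= s -> s <= t -> `|u| <= D -> `|u'| <= D ->
    `|q s y u - q s y u'| <= K * `|u - u'|.
  by move=> es st; apply: qu; lra.
have H0 := lag_comparison hB mB mxi meta axi aeta bq (lexx 0) d20 dt tT Kd0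
  K0 K0 Kd0 etaD qM' qy' qu' xiK etaK.
pose L w := \int[lebI e t]_s lag_heat P B xi eta 0 e q s w.
pose I w := \int[lebI e t]_s q s (xi s w) (eta s w).
have H : \int[P]_w `|I w - L w| <=
   (t - e) * ((K * K + K * (K * delta)) * e) + 2 * (K * delta) * Num.sqrt (2 * e * (t - e)).
  move: H0; rewrite !subr0; apply: le_trans.
  rewrite le_eqVlt; apply/orP; left; apply/eqP; apply: eq_Rintegral => w _.
  by congr (`|_ - _|); apply: eq_Rintegral => s _; rewrite subr0.
pose rho := Num.sqrt delta.
have r0 : 0 < rho by rewrite sqrtr_gt0.
have r4 : rho ^+ 4 = e.
  have -> : rho ^+ 4 = (rho ^+ 2) ^+ 2 by rewrite -exprM.
  by rewrite sqr_sqrtr // ltW.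
have [n tn] : exists n : nat, t < (2 ^+ n * rho) ^+ 4.
  have [n] : exists n : nat, T / e < n%:R.
    by exists (Num.bound (T / e)); rewrite archi_boundP // divr_ge0 // ltW.
  rewrite ltr_pdivrMr // => Tn; exists n; apply: le_lt_trans tT _; apply: lt_le_trans Tn _.
  rewrite exprMn r4; apply: ler_wpM2r => //.
  apply: (@le_trans _ _ (2 ^+ n)); first by rewrite -natrX ler_nat ltnW // ltn_expl.
  by rewrite -exprM ler_weXn2l ?ler1n // -[leqLHS]muln1 leq_mul.
have HF := noise_induction r0 (etrans (congr1 (fun x => x <= t) r4) dt) tT tn.
rewrite /F r4 -/L in HF.
have {}HF : \int[P]_w `|L w| <= noise_stepC * delta ^+ 2 * (3 * Rad).
  have d20' := ltW d20; have r0' := ltW r0.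
  apply: le_trans HF _; apply: ler_wpM2l; first exact: mulr_ge0.
  by rewrite lerBlDr lerDl.
have bI : bmf I by exact: bAI.
have bL : bmf L by exact: blag_int.
apply: (@le_trans _ _ (\int[P]_w (e * (K * delta) + (`|I w - L w| + `|L w|)))).
  apply: bmf_int_le.
  - exact: bmf_norm (bAI _ _).
  - apply: bmfD; first exact: bmf_cst.
    by apply: bmfD; apply: bmf_norm => //; exact: bmfB.
  move=> w; rewrite (lebI_int_split (bAs w) e_ge dt) -/(I w).
  apply: le_trans (ler_normD _ _) _; apply: lerD.
    by have := qb 0 e w (lexx _) e_ge dT; rewrite subr0.
  by apply: le_trans (ler_normD _ _); rewrite subrK.
have bIL : bmf (fun w => `|I w - L w|) by apply: bmf_norm; exact: bmfB.
rewrite (bmf_intD P (bmf_cst (e * (K * delta))) (bmfD bIL (bmf_norm bL))) (bmf_intD P bIL (bmf_norm bL)).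
rewrite (int_prob_cst P (e * (K * delta))).
have sq : Num.sqrt (2 * e * (t - e)) <= Num.sqrt (2 * T) * delta.
  have -> : Num.sqrt (2 * T) * delta = Num.sqrt (2 * T) * Num.sqrt e.
    by rewrite /e sqrtr_sqr ger0_norm // ltW.
  rewrite -sqrtrM ?mulr_ge0 ?(ltW T0) //; apply: ler_wsqrtr.
  rewrite -mulrA -[leRHS]mulrA ler_wpM2l // mulrC; apply: ler_wpM2r => //.
  by rewrite lerBlDr; apply: le_trans tT _; rewrite lerDl.
have i1 : e * (K * delta) <= K * delta ^+ 2.
  by rewrite /e mulrC ler_wpM2r ?(ltW d20) // -[leRHS]mulr1 ler_wpM2l.
have i2 : (t - e) * ((K * K + K * (K * delta)) * e) <= T * ((K * K + K * K) * e).
  have te0 : 0 <= t - e by rewrite subr_ge0.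
  have teT : t - e <= T by rewrite lerBlDr; apply: le_trans tT _; rewrite lerDl.
  apply: ler_pM => //.
    by rewrite mulr_ge0 // addr_ge0 // mulr_ge0.
  apply: ler_wpM2r => //; rewrite lerD2l ler_wpM2l // -[leRHS]mulr1; exact: ler_wpM2l.
have i3 : 2 * (K * delta) * Num.sqrt (2 * e * (t - e)) <=
    2 * (K * delta) * (Num.sqrt (2 * T) * delta).
  by rewrite ler_wpM2l // mulr_ge0.
apply: le_trans (lerD i1 (lerD (le_trans H (lerD i2 i3)) HF)) _.
by rewrite /noiseC /Rad /e le_eqVlt; apply/orP; left; apply/eqP; ring.
Qed.

End noise_averaging.

(** * Gronwall lemmas and joint measurability *)

Section gronwall.
Context {R : realType}.
Local Notation leb := (@lebesgue_measure R).
Local Notation RR := (measurableTypeR R).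

Lemma integral_expR_le (l t : R) : 0 < l -> 0 <= t ->
  leb.-integrable (`[0, t]%classic : set RR) (fun s => (expR (l * s))%:E) /\
  \int[leb]_(s in (`[0, t]%classic : set RR)) expR (l * s) <= expR (l * t) / l.
Proof.
move=> l0 t0.
have dE (s : R) : is_derive s 1 (fun s : R => expR (l * s) / l) (expR (l * s)).
  apply: is_derive_eq; rewrite /GRing.scale /=; field.
  by rewrite gt_eqF.
have cE : continuous (fun s : R => expR (l * s)).
  move=> s; apply: continuous_comp; last exact: continuous_expR.
  exact: mulrl_continuous.
have iE : leb.-integrable (`[0, t]%classic : set RR) (fun s => (expR (l * s))%:E).
  apply: continuous_compact_integrable; first exact: segment_compact.
  exact: continuous_subspaceT.
split => //.
move: t0; rewrite le_eqVlt => /predU1P[<-|t0].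
  by rewrite set_itv1 Rintegral_set1 divr_ge0 ?expR_ge0 // ltW.
rewrite /Rintegral (@continuous_FTC2 R _ (fun s : R => expR (l * s) / l)) //.
- by rewrite /= lerBlDr lerDl divr_ge0 ?expR_ge0 // ltW.
- exact: continuous_subspaceT.
- have cF : continuous (fun s : R => expR (l * s) / l).
    by move=> s; apply: differentiable_continuous; apply/derivable1_diffP; apply: ex_derive.
  split; first by move=> s _; exact: ex_derive.
  + by apply: cvg_at_right_filter; exact: cF.
  + by apply: cvg_at_left_filter; exact: cF.
- by move=> s _; rewrite derive1E; apply: derive_val.
Qed.

Definition gronwall_intC (L T : R) : R := 2 * expR ((2 * L + 1) * T).

Lemma gronwall_int (h r : RR -> R) (L T : R) : bmf h -> bmf r -> 0 <= L ->
  (forall t, 0 <= r t) ->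
  (forall t, 0 <= t -> t <= T -> h t <= r t + L * \int[lebI 0 t]_s h s) ->
  forall t, 0 <= t -> t <= T ->
    \int[lebI 0 t]_s h s <= gronwall_intC L T * \int[lebI 0 T]_s r s.
Proof.
move=> bh br L0 r0 hL t0 t00 t0T.
have T0 : 0 <= T by exact: le_trans t0T.
pose l := 2 * L + 1.
have l0 : 0 < l by rewrite /l; lra.
pose N := \int[lebI 0 T]_s r s.
have intr0 a b : a <= b -> 0 <= \int[lebI a b]_s r s.
  by move=> ab; apply: Rintegral_ge0.
have rN t : 0 <= t -> t <= T -> \int[lebI 0 t]_s r s <= N.
  by move=> t_0 tT; rewrite /N (lebI_int_split br t_0 tT) lerDl intr0.
have N0 : 0 <= N by exact: intr0.
pose Z t := \int[lebI 0 t]_s h s.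
have [_ [H hH]] := bh.
have H0 : 0 <= H by exact: le_trans (normr_ge0 _) (hH 0).
have ZT t : 0 <= t -> t <= T -> `|Z t| <= T * H.
  move=> t_0 tT; apply: (@le_trans _ _ ((t - 0) * H)); first exact: lebI_int_norm.
  by rewrite subr0 ler_wpM2r.
pose E := [set x | exists2 t, 0 <= t <= T & x = expR (- (l * t)) * Z t].
have E0 : E !=set0 by exists (expR (- (l * 0)) * Z 0); exists 0; rewrite ?lexx.
have Eub : has_sup E.
  split => //; exists (T * H) => x [t /andP[t_0 tT] ->].
  apply: le_trans (ler_norm _) _; rewrite normrM -[leRHS]mul1r ler_pM //; last exact: ZT.
  by rewrite ger0_norm ?expR_ge0 // -[leRHS]expR0 ler_expR oppr_le0 mulr_ge0 // ltW.
pose M := sup E.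
pose M' := Num.max 0 M.
have M'0 : 0 <= M' by rewrite le_max lexx.
have hM t : 0 <= t -> t <= T -> Z t <= M' * expR (l * t).
  move=> t_0 tT; have : expR (- (l * t)) * Z t <= M'.
    rewrite le_max; apply/orP; right; apply: sup_upper_bound => //.
    by exists t => //; rewrite t_0.
  by rewrite expRN mulrC ler_pdivrMr ?expR_gt0.
have hM2 t : 0 <= t -> t <= T -> expR (- (l * t)) * Z t <= N + M' / 2.
  move=> t_0 tT; rewrite expRN mulrC ler_pdivrMr ?expR_gt0 //.
  have [iE leE] := integral_expR_le l0 t_0.
  have : Z t <= N + L * M' * (expR (l * t) / l).
    have LM : 0 <= L * M' by rewrite mulr_ge0.
    apply: le_trans (lerD (rN _ t_0 tT) (ler_wpM2l LM leE)).
    rewrite /Z !lebI_int //.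
    rewrite -(RintegralZl (L * M') (measurable_itvRR 0 t)
      (iE : leb.-integrable _ (EFin \o (fun s : RR => expR (l * s))))).
    have i2 : leb.-integrable (`[0, t]%classic : set RR)
        (EFin \o (fun s : RR => L * M' * expR (l * s))).
      have := integrableZl (measurable_itvRR _ _) (L * M') iE.
      by apply: eq_integrable => //; exact: measurable_itvRR.
    rewrite -(RintegralD (measurable_itvRR 0 t) (bmf_itv_integrable 0 t br) i2).
    apply: (le_Rintegral (measurable_itvRR 0 t)); [exact: bmf_itv_integrable| |].
      have := integrableD (measurable_itvRR 0 t) (bmf_itv_integrable 0 t br) i2.
      by apply: eq_integrable => //; exact: measurable_itvRR.
    move=> s; rewrite /= in_itv /= => /andP[s0 st].
    have sT : s <= T by exact: le_trans tT.
    apply: le_trans (hL s s0 sT) _; rewrite lerD2l -mulrA; apply: ler_wpM2l => //.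
    exact: hM.
  move=> H1.
  have e1 : 1 <= expR (l * t) by rewrite -[leLHS]expR0 ler_expR mulr_ge0 // ltW.
  apply: le_trans H1 _; rewrite [leRHS]mulrDl; apply: lerD; first by rewrite ler_peMr.
  rewrite (_ : L * M' * (expR (l * t) / l) = (L / l) * (M' * expR (l * t))); last first.
    by field; rewrite gt_eqF.
  rewrite (_ : M' / 2 * _ = 2^-1 * (M' * expR (l * t))); last by field.
  apply: ler_wpM2r; first by rewrite mulr_ge0 ?expR_ge0.
  by rewrite ler_pdivrMr // /l; lra.
have MM : M <= N + M' / 2.
  by apply: ge_sup => // x [t /andP[t_0 tT] ->]; exact: hM2.
have M2 : M' <= 2 * N.
  by move: MM; rewrite /M'; case: (leP 0 M); lra.
apply: le_trans (hM t0 t00 t0T) _; rewrite /gronwall_intC -/N mulrAC.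
apply: ler_pM; rewrite ?expR_ge0 //.
by rewrite ler_expR ler_wpM2l // ltW.
Qed.

Definition gronwallC (L T : R) : R := 1 + L * gronwall_intC L T * T.

Lemma gronwall_intC_ge0 L T : 0 <= gronwall_intC L T.
Proof. by rewrite mulr_ge0 ?expR_ge0. Qed.

Lemma gronwallC_ge0 L T : 0 <= L -> 0 <= T -> 0 <= gronwallC L T.
Proof. by move=> L0 T0; rewrite addr_ge0 // !mulr_ge0 ?gronwall_intC_ge0. Qed.

Lemma gronwall (h : RR -> R) (L T al : R) : bmf h -> 0 <= L -> 0 <= al ->
  (forall t, 0 <= t -> t <= T -> h t <= al + L * \int[lebI 0 t]_s h s) ->
  forall t, 0 <= t -> t <= T -> h t <= gronwallC L T * al.
Proof.
move=> bh L0 al0 hL t t0 tT; apply: le_trans (hL t t0 tT) _.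
have T0 : 0 <= T by exact: le_trans tT.
have := gronwall_int bh (bmf_cst al) L0 (fun=> al0) hL t0 tT.
move=> /(ler_wpM2l L0) H; apply: le_trans (lerD (lexx al) H) _.
have : \int[lebI 0 T]_s al <= (T - 0) * al.
  apply: le_trans (ler_norm _) _; apply: lebI_int_norm => //; first exact: bmf_cst.
  by move=> s _ _; rewrite ger0_norm.
rewrite subr0 => /(ler_wpM2l (mulr_ge0 L0 (gronwall_intC_ge0 L T))).
by rewrite /gronwallC mulrDl mul1r lerD2l !mulrA.
Qed.

End gronwall.

Section caratheodory.
Context {R : realType} {disp : measure_display} {Omega : measurableType disp}.
Variable d : nat.
Local Notation V := 'rV[R]_d.
Local Notation BV := (borel_rV R d).
Local Notation RR := (measurableTypeR R).

Lemma dyadic_floor_cvg (s : R) : (fun n => (Num.floor (2 ^+ n * s))%:~R / 2 ^+ n) @ \oo --> s.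
Proof.
apply/cvgrPdist_le => e e0.
have := @cvg_geometric R 1 (1/2) _; rewrite ger0_norm //.
move=> /(_ _)/cvgrPdist_le; have h : 1 / 2 < 1 :> R by lra.
move=> /(_ h e e0); apply: filterS => n; rewrite sub0r normrN /geometric /= mul1r => H.
have p0 : 0 < 2 ^+ n :> R by rewrite exprn_gt0.
apply: le_trans H; rewrite !mul1r exprVn [leRHS]ger0_norm ?invr_ge0 ?(ltW p0) //.
have := floorD1_gt (2 ^+ n * s); have := floor_le_tmp (2 ^+ n * s).
rewrite intrD.
set k := (Num.floor _)%:~R => k1 k2.
have H1 : `|2 ^+ n * s - k| <= 1 :> R by rewrite ler_norml; lra.
have H2 : `|s - k / 2 ^+ n| <= (2 ^+ n)^-1 :> R.
  have -> : s - k / 2 ^+ n = (2 ^+ n * s - k) / 2 ^+ n by field; rewrite gt_eqF.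
  by rewrite normrM normfV (gtr0_norm p0) ler_piMl // invr_ge0 ltW.
exact: H2.
Qed.

Lemma caratheodory (X : R -> Omega -> V) :
  (forall s, measurable_fun setT (X s : Omega -> BV)) ->
  (forall w, continuous (X^~ w)) -> jointly_measurable X.
Proof.
move=> mX cX; apply: measurable_to_rV => i.
pose h n (z : RR * Omega) := X ((Num.floor (2 ^+ n * z.1))%:~R / 2 ^+ n) z.2 ord0 i.
apply: (@measurable_fun_cvg _ _ _ _ h) => [n|z _].
  move=> _ A mA; rewrite setTI.
  have -> : h n @^-1` A = \bigcup_(k : int)
     ((`[k%:~R / 2 ^+ n, (k + 1)%:~R / 2 ^+ n[%classic : set RR) `*`
      [set w | A (X (k%:~R / 2 ^+ n) w ord0 i)]).
    have p0 : 0 < 2 ^+ n :> R by rewrite exprn_gt0.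
    apply/seteqP; split => -[s w] /=; rewrite /h /=.
      move=> Az; exists (Num.floor (2 ^+ n * s)) => //=; split => //.
      rewrite in_itv /= ler_pdivrMr // ltr_pdivlMr // (mulrC s).
      by rewrite floor_le_tmp floorD1_gt.
    move=> [k _ [/=]]; rewrite in_itv /= ler_pdivrMr // ltr_pdivlMr // (mulrC s) => ks.
    by rewrite (floor_def ks).
  apply: countable_bigcupT_measurable => // k; apply: measurableX => //.
  have := measurableT_comp (measurable_rV_coord i) (mX (k%:~R / 2 ^+ n)).
  by move=> /(_ measurableT A mA); rewrite setTI.
apply: (@cvg_comp _ _ _ (fun n => X ((Num.floor (2 ^+ n * z.1))%:~R / 2 ^+ n) z.2)
  (fun v : V => v ord0 i) _ (nbhs (X z.1 z.2))); last exact: coord_continuous.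
apply: (@cvg_comp _ _ _ _ (X^~ z.2) _ (nbhs z.1)); last exact: cX.
exact: dyadic_floor_cvg.
Qed.

Definition clamp (T s : R) : R := Num.max 0 (Num.min s T).

Lemma clamp_itv T s : 0 <= T -> 0 <= clamp T s <= T.
Proof. by move=> T0; rewrite /clamp le_max lexx /= ge_max T0 ge_min lexx orbT. Qed.

Lemma clamp_id T s : 0 <= s -> s <= T -> clamp T s = s.
Proof. by move=> s0 sT; rewrite /clamp min_l // max_r. Qed.

Lemma clamp_continuous T : continuous (clamp T).
Proof.
move=> s; rewrite /clamp.
apply: (@continuous_max _ _ (fun=> 0) (fun s => Num.min s T)); first exact: cvg_cst.
by apply: continuous_min; [exact: cvg_id|exact: cvg_cst].
Qed.

Lemma continuous_clamp (T : R) (f : R -> V) : 0 <= T ->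
  {within `[0, T], continuous f} -> continuous (f \o clamp T).
Proof.
move=> T0 /subspace_continuousP cf s.
have cs : (`[0, T]%classic : set R) (clamp T s) by rewrite /= in_itv /= clamp_itv.
apply: cvg_comp (cf _ cs).
move=> A /= [e e0 eA].
have := @clamp_continuous T s; move=> /cvgrPdist_lt /(_ _ e0).
rewrite /nbhs /=; apply: filterS => r rs; apply: eA => //=.
by rewrite in_itv /= clamp_itv.
Qed.

Lemma continuous_clamp_bounded (T : R) (f : R -> V) : 0 <= T ->
  {within `[0, T], continuous f} -> exists M, forall s, `|f (clamp T s)| <= M.
Proof.
move=> T0 cf; have cg := continuous_clamp T0 cf.
have cn : continuous (fun s => `|f (clamp T s)|).
  by move=> s; apply: continuous_comp; [exact: cg|exact: norm_continuous].
have [c _ cM] := EVT_max T0 (continuous_subspaceT cn).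
exists `|f (clamp T c)| => s.
have := cM (clamp T s); rewrite in_itv /= clamp_itv // => /(_ isT).
by rewrite clamp_id //; case/andP: (clamp_itv s T0).
Qed.

End caratheodory.

Section integral_measurability.
Context {R : realType} d1 d2 (T1 : measurableType d1) (T2 : measurableType d2).

Lemma measurable_int_inner (P : probability T2 R) (f : T1 * T2 -> R) :
  measurable_fun setT f -> measurable_fun setT (fun x => \int[P]_y f (x, y)).
Proof.
move=> mf; rewrite /Rintegral.
under eq_fun do rewrite integralE.
have mE : measurable_fun setT (EFin \o f) by exact/measurable_EFinP.
apply: (measurableT_comp (@fine_measurable _ _ measurableT)).
apply: emeasurable_funB.
- have := @measurable_fun_fubini_tonelli_F _ _ _ _ _ P (EFin \o f)^\+%E
    (measurable_funepos mE) (fun _ => funepos_ge0 _ _).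
  by apply: eq_measurable_fun => x _; apply: eq_integral => y _; rewrite !funeposE.
- have := @measurable_fun_fubini_tonelli_F _ _ _ _ _ P (EFin \o f)^\-%E
    (measurable_funeneg mE) (fun _ => funeneg_ge0 _ _).
  by apply: eq_measurable_fun => x _; apply: eq_integral => y _; rewrite !funenegE.
Qed.

End integral_measurability.

(** * Mean-field drifts *)

Lemma lip2_second_difference {R : realType} {d : nat} (L : R)
    (g : 'rV[R]_d -> 'rV[R]_d) a b c :
  lip L g -> lip2 L g ->
  `|g a + g b - g c - g c| <= L * `|a + b - c - c| + L * `|a - c| * `|a - c|.
Proof.
move=> g1 g2; pose h := a - c.
have H1 := g2 (c - h) h h; have H2 := lipB b (c - h) g1.
have e1 : c - h + h + h = a by rewrite /h; vring.
have e2 : c - h + h = c by rewrite /h; vring.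
have e3 : b - (c - h) = a + b - c - c by rewrite /h; vring.
rewrite e1 e2 -/h in H1; rewrite e3 in H2.
have -> : g a + g b - g c - g c = (g b - g (c - h)) + (g a - g c - g c + g (c - h)).
  by vring.
by apply: le_trans (ler_normD _ _) _; exact: lerD.
Qed.

Section vector_integrals.
Context {R : realType} {disp : measure_display} {Omega : measurableType disp}.
Variables (P : probability Omega R) (d : nat).
Local Notation V := 'rV[R]_d.

Definition rint (Z : Omega -> V) : V := \row_i \int[P]_w Z w ord0 i.

Definition rintegrable (Z : Omega -> V) :=
  forall i, P.-integrable setT (fun w => (Z w ord0 i)%:E).

Lemma rintegrableD Z Z' : rintegrable Z -> rintegrable Z' ->
  rintegrable (fun w => Z w + Z' w).
Proof.
move=> iZ iZ' i; apply: eq_integrable (integrableD measurableT (iZ i) (iZ' i)) => //.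
by move=> w _; rewrite mxE.
Qed.

Lemma rintegrableN Z : rintegrable Z -> rintegrable (fun w => - Z w).
Proof.
move=> iZ i; apply: eq_integrable (integrableN (iZ i)) => //.
by move=> w _; rewrite mxE.
Qed.

Lemma rintegrableB Z Z' : rintegrable Z -> rintegrable Z' ->
  rintegrable (fun w => Z w - Z' w).
Proof. by move=> iZ /rintegrableN; exact: rintegrableD. Qed.

Lemma rintD Z Z' : rintegrable Z -> rintegrable Z' ->
  rint (fun w => Z w + Z' w) = rint Z + rint Z'.
Proof.
move=> iZ iZ'; apply/rowP => i; rewrite !mxE.
under eq_Rintegral do rewrite mxE.
exact: (RintegralD measurableT (iZ i) (iZ' i)).
Qed.

Lemma rintB Z Z' : rintegrable Z -> rintegrable Z' ->
  rint (fun w => Z w - Z' w) = rint Z - rint Z'.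
Proof.
move=> iZ iZ'; apply/rowP => i; rewrite !mxE.
under eq_Rintegral do rewrite !mxE.
exact: (RintegralB measurableT (iZ i) (iZ' i)).
Qed.

Lemma rint_le Z (h : Omega -> R) : rintegrable Z ->
  P.-integrable setT (EFin \o h) -> (forall w, `|Z w| <= h w) ->
  `|rint Z| <= \int[P]_w h w.
Proof.
move=> iZ ih Zh; apply: rV_norm_le => [|i].
  by apply: Rintegral_ge0 => w _; exact: le_trans (Zh w).
rewrite mxE; apply: le_trans (le_normr_Rintegral measurableT (iZ i)) _.
apply: (le_Rintegral measurableT) => //.
  by apply: eq_integrable (integrable_abse (iZ i)).
by move=> w _; apply: le_trans (Zh w); exact: mx_entry_norm_le.
Qed.

Lemma rint_ub Z (M : R) : rintegrable Z -> (forall w, `|Z w| <= M) -> `|rint Z| <= M.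
Proof.
move=> iZ ZM; rewrite -[leRHS](int_prob_cst P M).
by apply: rint_le => //; exact: bmf_integrable (bmf_cst M).
Qed.

End vector_integrals.

Section mean_fields.
Context {R : realType} {disp : measure_display} {Omega : measurableType disp}.
Variables (P : probability Omega R) (d : nat).
Local Notation V := 'rV[R]_d.
Local Notation BV := (borel_rV R d).
Local Notation RR := (measurableTypeR R).

Definition regular_coeff (L : R) (f : R -> V -> V -> V) :=
  [/\ 0 <= L,
      measurable_fun setT (fun z : RR * (BV * BV) => f z.1 z.2.1 z.2.2 : BV) &
      forall s, C11_pair L (f s)].

Variables (L : R) (f phi : R -> V -> V -> V).
Hypotheses (cf : regular_coeff L f) (cphi : regular_coeff L phi).

Definition mfield (X : R -> Omega -> V) (s : R) (y : V) : V :=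
  rint P (fun w => phi s y (X s w)).

Definition beta (X : R -> Omega -> V) (s : R) (y : V) : V :=
  f s y (mfield X s y).

Definition phi_integrable (X : R -> Omega -> V) :=
  forall s y, rintegrable P (fun w => phi s y (X s w)).

Let L0 : 0 <= L. Proof. by case: cf. Qed.

Ltac rintable := repeat first
  [ match goal with H : phi_integrable _ |- _ => exact: H end
  | apply: rintegrableB | apply: rintegrableD ].

Section one_process.
Variable X : R -> Omega -> V.
Hypothesis iX : phi_integrable X.

Lemma mfield_lip s : lip L (mfield X s).
Proof.
have [_ _ /(_ s)[p1 _ _ _]] := cphi.
move=> y h; rewrite /mfield -rintB; rintable; apply: rint_ub; first by rintable.
by move=> w; exact: p1.
Qed.

Lemma mfield_lip2 s : lip2 L (mfield X s).
Proof.
have [_ _ /(_ s)[_ _ p1 _]] := cphi.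
move=> y h k; rewrite /mfield -!(rintB, rintD); rintable.
by apply: rint_ub; [rintable|move=> w; exact: p1].
Qed.

Definition driftL := L * (1 + L).

Lemma driftL_ge0 : 0 <= driftL.
Proof. by rewrite mulr_ge0 // addr_ge0. Qed.

Lemma beta_lip s y y' : `|beta X s y - beta X s y'| <= driftL * `|y - y'|.
Proof.
have [_ _ /(_ s)[f1 f2 _ _]] := cf.
have -> : beta X s y - beta X s y' =
    (f s y (mfield X s y) - f s y' (mfield X s y)) +
    (f s y' (mfield X s y) - beta X s y') by rewrite /beta; vring.
apply: le_trans (ler_normD _ _) _; rewrite /driftL mulrDr mulr1 mulrDl lerD //.
  exact: (lipB _ _ (f1 _)).
apply: le_trans (lipB _ _ (f2 _)) _; rewrite -mulrA ler_wpM2l //.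
exact: lipB (mfield_lip s).
Qed.

Hypothesis mX : jointly_measurable X.

Lemma measurable_mfield :
  measurable_fun setT (fun z : RR * BV => mfield X z.1 z.2 : BV).
Proof.
have [_ mphi _] := cphi.
apply: measurable_to_rV => i; rewrite /mfield /rint.
under eq_fun do rewrite mxE.
apply: (measurable_int_inner P
  (f := fun z : (RR * BV) * Omega => phi z.1.1 z.1.2 (X z.1.1 z.2) ord0 i)).
apply: (measurableT_comp (f := fun z : RR * (BV * BV) => phi z.1 z.2.1 z.2.2 ord0 i)
  (g := fun z : (RR * BV) * Omega => (z.1.1, (z.1.2, X z.1.1 z.2 : BV)))).
  exact: (measurableT_comp (measurable_rV_coord i) mphi).
have m1 : measurable_fun setT (fun z : (RR * BV) * Omega => z.1.1).
  exact: (measurableT_comp measurable_fst measurable_fst).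
apply: measurable_fun_pair => //; apply: measurable_fun_pair.
  exact: (measurableT_comp measurable_snd measurable_fst).
apply: (measurableT_comp (f := fun z : RR * Omega => X z.1 z.2 : BV)
    (g := fun z : (RR * BV) * Omega => (z.1.1, z.2))) => //.
by apply: measurable_fun_pair => //; exact: measurable_snd.
Qed.

Lemma measurable_beta :
  measurable_fun setT (fun z : RR * BV => beta X z.1 z.2 : BV).
Proof.
have [_ mfc _] := cf.
apply: (measurableT_comp (f := fun z : RR * (BV * BV) => f z.1 z.2.1 z.2.2 : BV)
  (g := fun z : RR * BV => (z.1, (z.2, mfield X z.1 z.2 : BV)))) => //.
apply: measurable_fun_pair; first exact: measurable_fst.
by apply: measurable_fun_pair; [exact: measurable_snd|exact: measurable_mfield].
Qed.

End one_process.

Section two_processes.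
Variables X X' : R -> Omega -> V.
Hypotheses (iX : phi_integrable X) (iX' : phi_integrable X').
Variable s : R.
Hypothesis iD : P.-integrable setT (fun w => (`|X s w - X' s w|)%:E).
Local Notation ED := (\int[P]_w `|X s w - X' s w|).

Lemma mfield_dist y : `|mfield X s y - mfield X' s y| <= L * ED.
Proof.
have [_ _ /(_ s)[_ p2 _ _]] := cphi.
rewrite /mfield -rintB; rintable; rewrite -(RintegralZl L measurableT (iD : P.-integrable _ (EFin \o _))).
apply: rint_le; first by rintable.
  have := integrableZl measurableT L iD.
  by apply: eq_integrable.
by move=> w; exact: (lipB _ _ (p2 _)).
Qed.

Lemma mfield_dist_holder y y' :
  `|mfield X s y - mfield X' s y - mfield X s y' + mfield X' s y'|
  <= (4 + 2 * L) * Num.sqrt L * Num.sqrt `|y - y'| * ED.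
Proof.
have [_ _ /(_ s)[p1 _ _ p2]] := cphi.
set c := (4 + 2 * L) * Num.sqrt L * Num.sqrt `|y - y'|.
rewrite /mfield -!(rintB, rintD); rintable.
rewrite -(RintegralZl c measurableT (iD : P.-integrable _ (EFin \o _))).
apply: rint_le.
- by rintable.
- by have := integrableZl measurableT c iD; apply: eq_integrable.
move=> w; have := @mixed_increment _ _ L (phi s) y y' (X' s w) (X s w - X' s w) L0 p1 p2.
by rewrite (addrC (X' s w)) subrK.
Qed.

Lemma beta_dist y y' :
  `|beta X s y - beta X' s y'| <= driftL * `|y - y'| + L * (L * ED).
Proof.
have [_ _ /(_ s)[f1 f2 _ _]] := cf.
have -> : beta X s y - beta X' s y' =
    (beta X s y - beta X s y') + (beta X s y' - beta X' s y') by vring.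
apply: le_trans (ler_normD _ _) _; apply: lerD; first exact: beta_lip.
apply: le_trans (lipB _ _ (f2 _)) _; rewrite ler_wpM2l //.
exact: mfield_dist.
Qed.

Definition holderC := compC L * (L + (4 + 2 * L) * Num.sqrt L).

Lemma holderC_ge0 : 0 <= holderC.
Proof. by rewrite mulr_ge0 ?compC_ge0 // addr_ge0 // mulr_ge0 ?sqrtr_ge0 // addr_ge0 ?mulr_ge0. Qed.

Lemma beta_dist_holder y y' :
  `|beta X s y - beta X' s y - beta X s y' + beta X' s y'|
  <= holderC * ED * Num.sqrt `|y - y'|.
Proof.
have [_ _ /(_ s) cfs] := cf.
have ED0 : 0 <= ED by apply: Rintegral_ge0.
have c0 : 0 <= (4 + 2 * L) * Num.sqrt L by rewrite mulr_ge0 ?sqrtr_ge0 // addr_ge0 ?mulr_ge0.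
pose D := (L + (4 + 2 * L) * Num.sqrt L) * ED.
have D0 : 0 <= D by rewrite mulr_ge0 // addr_ge0.
have H := @composite_difference _ _ L D (f s) (mfield X s) (mfield X' s) y y' L0 D0 cfs
  (mfield_lip iX' s).
rewrite /holderC -(mulrA (compC L)); apply: H.
- move=> z; apply: le_trans (mfield_dist z) _; rewrite /D ler_wpM2r //.
  by rewrite lerDl.
- apply: le_trans (mfield_dist_holder y y') _.
  rewrite /D -mulrA (mulrC (Num.sqrt `|_|)) mulrA; apply: ler_wpM2r; first exact: sqrtr_ge0.
  by apply: ler_wpM2r => //; rewrite lerDr.
Qed.

End two_processes.

Lemma beta_increment X s y y' u : phi_integrable X ->
  `|beta X s (y + u) - beta X s y - beta X s (y' + u) + beta X s y'|
  <= compC L * `|u| * Num.sqrt `|y - y'|.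
Proof.
move=> iX; have [_ _ /(_ s) cfs] := cf.
exact: (composite_increment y y' u L0 cfs (mfield_lip iX s) (mfield_lip2 iX s)).
Qed.

Lemma beta_second_difference X1 X2 X0 s y (D : R) :
  phi_integrable X1 -> phi_integrable X2 -> phi_integrable X0 ->
  bmf (fun w => `|X1 s w + X2 s w - X0 s w - X0 s w|) ->
  (forall w, `|X1 s w - X0 s w| <= D) ->
  P.-integrable setT (fun w => (`|X1 s w - X0 s w|)%:E) ->
  `|beta X1 s y + beta X2 s y - beta X0 s y - beta X0 s y|
  <= L * (L * (\int[P]_w `|X1 s w + X2 s w - X0 s w - X0 s w| + D ^+ 2))
     + L * (L * D) ^+ 2.
Proof.
move=> i1 i2 i0 bS D1 iD.
have [_ _ /(_ s)[_ f2 _ f4]] := cf; have [_ _ /(_ s)[_ p2 _ p4]] := cphi.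
have D0 : 0 <= D by exact: le_trans (normr_ge0 _) (D1 point).
apply: le_trans (lip2_second_difference _ _ _ (f2 y) (f4 y)) _; apply: lerD.
  rewrite ler_wpM2l // /mfield.
  rewrite -!(rintB, rintD); rintable.
  set S := fun w => `|X1 s w + _ - _ - _|.
  have bSD : bmf (fun w => L * (S w + D ^+ 2)).
    by apply: (bmfM (bmf_cst _)); apply: bmfD => //; exact: bmf_cst.
  apply: (@le_trans _ _ (\int[P]_w (L * (S w + D ^+ 2)))).
    apply: rint_le.
    - by rintable.
    - exact: bmf_integrable.
    move=> w; apply: le_trans (lip2_second_difference _ _ _ (p2 y) (p4 y)) _.
    rewrite mulrDr lerD2l -mulrA ler_wpM2l // expr2; exact: ler_pM.
  rewrite (bmf_intZ P L (bmfD bS (bmf_cst (D ^+ 2)))) (bmf_intD P bS (bmf_cst (D ^+ 2))).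
  by rewrite (int_prob_cst P (D ^+ 2)).
rewrite -mulrA ler_wpM2l // expr2.
have H : `|mfield X1 s y - mfield X0 s y| <= L * D.
  apply: le_trans (mfield_dist i1 i0 iD y) _; rewrite ler_wpM2l //.
  rewrite -[leRHS](int_prob_cst P D); apply: (le_Rintegral measurableT) => //.
  exact: bmf_integrable (bmf_cst D).
exact: ler_pM.
Qed.

End mean_fields.

(** * First differences of solutions *)

Section time_vector_integrals.
Context {R : realType} {d : nat}.
Local Notation V := 'rV[R]_d.
Local Notation RR := (measurableTypeR R).

Lemma lebI_int_bound (a b : R) (f h : RR -> R) : bmf f -> bmf h ->
  (forall s, a <= s -> s <= b -> `|f s| <= h s) ->
  `|\int[lebI a b]_s f s| <= \int[lebI a b]_s h s.
Proof.
move=> bf bh fh; apply: le_trans (bmf_int_norm _ bf) _.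
by apply: lebI_int_le => //; exact: bmf_norm.
Qed.

Lemma lebI_row_bound (a b : R) (Z : RR -> V) (h : RR -> R) : 
  (forall i, bmf (fun s => Z s ord0 i)) -> bmf h -> (forall s, 0 <= h s) ->
  (forall s, a <= s -> s <= b -> `|Z s| <= h s) ->
  `|\row_i \int[lebI a b]_s Z s ord0 i| <= \int[lebI a b]_s h s.
Proof.
move=> bZ bh h0 Zh; apply: rV_norm_le => [|i]; first exact: Rintegral_ge0.
rewrite mxE; apply: lebI_int_bound => // s sa sb.
by apply: le_trans (Zh s sa sb); exact: mx_entry_norm_le.
Qed.

Lemma lebI_int_cst (a b c : R) : a <= b -> \int[lebI a b]_s c = (b - a) * c.
Proof. by move=> ab; rewrite Rintegral_cst // -lebI_setT // mulrC. Qed.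

End time_vector_integrals.

Section tonelli_bound.
Context {R : realType} {disp : measure_display} {Omega : measurableType disp}.
Variables (P : probability Omega R).
Local Notation RR := (measurableTypeR R).

Lemma tonelli_bound (g : RR * Omega -> R) (a b c : R) : a <= b -> 0 <= c ->
  measurable_fun setT g -> (forall z, 0 <= g z) ->
  (forall w, bmf (fun s => g (s, w))) ->
  (forall s, (\int[P]_w (g (s, w))%:E <= c%:E)%E) ->
  (\int[P]_w (\int[lebI a b]_s g (s, w))%:E <= ((b - a) * c)%:E)%E.
Proof.
move=> ab c0 mg g0 bg gc.
under eq_integral do rewrite (bmf_intE _ (bg _)).
have mg' : measurable_fun setT (fun z : Omega * RR => (g (z.2, z.1))%:E).
  by apply/measurable_EFinP; apply: (measurableT_comp mg); exact: measurable_swap.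
have g0' (z : Omega * RR) : (0 <= (g (z.2, z.1))%:E)%E by rewrite lee_fin.
rewrite (@fubini_tonelli _ _ _ _ _ P (lebI a b) _ mg' g0') /=.
apply: (@le_trans _ _ (\int[lebI a b]_s c%:E)%E).
  apply: ge0_le_integral => //.
  - by move=> s _; apply: integral_ge0 => w _; rewrite lee_fin.
  - exact: (@measurable_fun_fubini_tonelli_G _ _ _ _ _ P _ mg' g0').
have fl : (lebI a b setT = (fine (lebI a b setT))%:E)%E by rewrite fineK ?fin_num_measure.
by rewrite integral_cst // [X in (_ * X)%E]fl lebI_setT // -EFinM mulrC.
Qed.

End tonelli_bound.

Section nice_processes.
Context {R : realType} {disp : measure_display} {Omega : measurableType disp}.
Variables (P : probability Omega R) (d : nat).
Local Notation V := 'rV[R]_d.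
Local Notation BV := (borel_rV R d).
Local Notation RR := (measurableTypeR R).
Local Notation leb := (@lebesgue_measure R).
Variables (T : R) (G : R -> set (set Omega)) (B : R -> Omega -> V).

Definition clamped (X : R -> Omega -> V) := forall s w, X s w = X (clamp T s) w.

Definition path_bounded (X : R -> Omega -> V) :=
  forall w, exists M, forall s, `|X s w| <= M.

Definition nice_noise :=
  [/\ brownian_wrt P T G B, jointly_measurable B, clamped B, path_bounded B &
      forall w, B 0 w = 0].

Variables (L : R) (f phi : R -> V -> V -> V).

Definition nice_solution (x : V) (X : R -> Omega -> V) :=
  [/\ jointly_measurable X, adapted T G X, clamped X /\ path_bounded X,
      phi_integrable P phi X &
      forall w,
        (forall i, leb.-integrable (`[0, T]%classic : set RR)
          (fun s => (beta P f phi X s (X s w) ord0 i)%:E)) /\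
        forall t, 0 <= t -> t <= T ->
          X t w = x + (\row_i \int[leb]_(s in (`[0, t]%classic : set RR))
            beta P f phi X s (X s w) ord0 i) + B t w].

Hypotheses (T0 : 0 < T) (nB : nice_noise).
Hypotheses (cf : regular_coeff L f) (cphi : regular_coeff L phi).
Local Notation beta := (beta P f phi).
Local Notation dL := (driftL L).
Implicit Types X : R -> Omega -> V.
Let L0 : 0 <= L. Proof. by case: cf. Qed.
Let dL0 : 0 <= dL. Proof. exact: driftL_ge0 cf. Qed.

Lemma jointly_measurable_path X w : jointly_measurable X ->
  measurable_fun setT (fun s : RR => X s w : BV).
Proof.
move=> mX; apply: (measurableT_comp mX (g := fun s : RR => (s, w))).
exact: pair2_measurable.
Qed.

Lemma jointly_measurable_slice X s : jointly_measurable X ->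
  measurable_fun setT (fun w => X s w : BV).
Proof.
move=> mX; apply: (measurableT_comp mX (g := fun w => (s : RR, w))).
exact: pair1_measurable.
Qed.

Lemma nice_beta_path x X (a : R -> V) : nice_solution x X ->
  measurable_fun setT (a : RR -> BV) ->
  measurable_fun setT (fun s : RR => beta X s (a s) : BV).
Proof.
move=> [mX _ _ iX _] ma.
apply: (measurableT_comp (measurable_beta P cf cphi mX) (g := fun s : RR => (s, a s : BV))).
by apply: measurable_fun_pair; [exact: measurable_id|].
Qed.

Lemma nice_difference x X x' (X' : R -> Omega -> V) w w' (H : R) : nice_solution x X -> nice_solution x' X' ->
  (forall s y y', `|beta X s y - beta X' s y'| <= dL * `|y - y'| + H) ->
  (forall i, bmf (fun s : RR => (beta X s (X s w) - beta X' s (X' s w')) ord0 i)) /\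
  forall t, 0 <= t -> t <= T ->
    X t w - X' t w' = x - x' +
      (\row_i \int[lebI 0 t]_s (beta X s (X s w) - beta X' s (X' s w')) ord0 i)
      + (B t w - B t w').
Proof.
move=> nX nX' bH.
have [mX _ [_ pX] _ /(_ w)[iX eX]] := nX; have [mX' _ [_ pX'] _ /(_ w')[iX' eX']] := nX'.
have bZ i : bmf (fun s : RR => (beta X s (X s w) - beta X' s (X' s w')) ord0 i).
  have m1 := nice_beta_path nX (jointly_measurable_path w mX).
  have m2 := nice_beta_path nX' (jointly_measurable_path w' mX').
  have := measurableT_comp (measurable_rV_coord i) (measurable_rVB m1 m2).
  split=> //; have [M XM] := pX w; have [M' XM'] := pX' w'.
  exists (dL * (M + M') + H) => s; apply: le_trans (mx_entry_norm_le _ _ _) _.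
  apply: le_trans (bH _ _ _) _; rewrite lerD2r ler_wpM2l //.
  by apply: le_trans (ler_normB _ _) _; exact: lerD.
split => // t t0 tT; rewrite eX // eX' //.
have -> : (\row_i \int[lebI 0 t]_s (beta X s (X s w) - beta X' s (X' s w')) ord0 i) =
   (\row_i \int[leb]_(s in (`[0, t]%classic : set RR)) beta X s (X s w) ord0 i) -
   (\row_i \int[leb]_(s in (`[0, t]%classic : set RR)) beta X' s (X' s w') ord0 i) :> V.
  apply/rowP => i; rewrite !mxE (lebI_int _ _ (bZ i)).
  have sub : (`[0, t]%classic : set RR) `<=` (`[0, T]%classic : set RR).
    by move=> s; rewrite /= !in_itv /= => /andP[-> st]; exact: le_trans tT.
  have j (g : RR -> R) : leb.-integrable (`[0, T]%classic : set RR) (EFin \o g) ->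
      leb.-integrable (`[0, t]%classic : set RR) (EFin \o g).
    by apply: integrableS => //; exact: measurable_itvRR.
  rewrite -(RintegralB (measurable_itvRR 0 t) (j _ (iX i)) (j _ (iX' i))).
  by apply: eq_Rintegral => s _; rewrite !mxE.
by rewrite opprD addrACA opprD (addrACA x).
Qed.

Lemma nice_dist_self x X s y y' : nice_solution x X ->
  `|beta X s y - beta X s y'| <= dL * `|y - y'| + 0.
Proof. by move=> [_ _ _ iX _]; rewrite addr0; exact: (beta_lip cf cphi iX). Qed.

Variables (R0 : R) (w0 : Omega).
Hypothesis w0R : forall s, `|B s w0| <= R0.

Let R00 : 0 <= R0. Proof. exact: le_trans (normr_ge0 _) (w0R 0). Qed.

Lemma bmf_path_norm X w : jointly_measurable X -> path_bounded X ->
  bmf (fun s : RR => `|X s w|).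
Proof.
move=> mX pX; split.
  exact: (measurableT_comp measurable_rV_norm (jointly_measurable_path w mX)).
by have [M XM] := pX w; exists M => s; rewrite normr_id.
Qed.

Lemma reference_distance x X t w : nice_solution x X -> 0 <= t -> t <= T ->
  `|X t w - X t w0| <= `|B t w| + R0
    + dL * (gronwall_intC dL T * \int[lebI 0 T]_s (`|B s w| + R0)).
Proof.
move=> nX t0 tT; have [mX _ [_ pX] iX _] := nX.
have [hB mB _ pB _] := nB.
have [bZ eZ] := nice_difference w w0 nX nX (fun s y y' => nice_dist_self s y y' nX).
pose h (s : RR) := `|X s w - X s w0|.
have bh : bmf h.
  split.
    apply: (measurableT_comp measurable_rV_norm).
    by apply: measurable_rVB; exact: jointly_measurable_path.
  have [M XM] := pX w; have [M' XM'] := pX w0.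
  exists (M + M') => s; rewrite /h normr_id.
  by apply: le_trans (ler_normB _ _) _; exact: lerD.
have br : bmf (fun s : RR => `|B s w| + R0).
  by apply: bmfD; [exact: bmf_path_norm|exact: bmf_cst].
have Hh s : 0 <= s -> s <= T -> h s <= `|B s w| + R0 + dL * \int[lebI 0 s]_r h r.
  move=> s0 sT; rewrite /h (eZ s s0 sT) subrr add0r.
  apply: le_trans (ler_normD _ _) _; rewrite addrC; apply: lerD.
    by apply: le_trans (ler_normB _ _) _; rewrite lerD2l.
  rewrite -(bmf_intZ _ dL bh); apply: lebI_row_bound => //.
  - by apply: bmfM => //; exact: bmf_cst.
  - by move=> r; rewrite mulr_ge0 // normr_ge0.
  - by move=> r _ _; have := nice_dist_self r (X r w) (X r w0) nX; rewrite addr0.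
have := gronwall_int bh br dL0 _ Hh t0 tT.
move=> /(_ (fun=> addr_ge0 (normr_ge0 _) R00)) /(ler_wpM2l dL0) H.
by apply: le_trans (Hh t t0 tT) _; rewrite lerD2l.
Qed.

Definition brownianC : R := d%:R * (2 * expR 1 * Num.sqrt T).

Lemma brownianC_ge0 : 0 <= brownianC.
Proof. by rewrite !mulr_ge0 ?sqrtr_ge0 ?expR_ge0. Qed.

Lemma int_abs_brownian s : (\int[P]_w (`|B s w|)%:E <= brownianC%:E)%E.
Proof.
have [hB mB cB pB B0] := nB.
have -> : (\int[P]_w (`|B s w|)%:E = \int[P]_w (`|B (clamp T s) w|)%:E)%E.
  by apply: eq_integral => w _; rewrite -cB.
have /andP[] := clamp_itv s (ltW T0); move: (clamp T s) => t t0 tT.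
move: t0; rewrite le_eqVlt => /predU1P[<-|t0].
  under eq_integral do rewrite B0 normr0.
  by rewrite integral0 lee_fin brownianC_ge0.
have mBt := jointly_measurable_slice t mB.
apply: (@le_trans _ _ (\int[P]_w (\sum_(i < d) (`|B t w ord0 i|)%:E)%E)%E).
  apply: ge0_le_integral => //.
  - by apply/measurable_EFinP; exact: (measurableT_comp measurable_rV_norm mBt).
  - apply: emeasurable_sum => i; apply/measurable_EFinP.
    by apply: measurableT_comp => //; exact: (measurableT_comp (measurable_rV_coord i) mBt).
  move=> w _; rewrite sumEFin lee_fin; apply: rV_norm_le => [|i]; first exact: sumr_ge0.
  by rewrite (bigD1 i) //= lerDl sumr_ge0.
rewrite ge0_integral_sum //; last first.
  move=> i; apply/measurable_EFinP; apply: measurableT_comp => //.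
  exact: (measurableT_comp (measurable_rV_coord i) mBt).
apply: (@le_trans _ _ (\sum_(i < d) (2 * expR 1 * Num.sqrt T)%:E)%E).
  apply: lee_sum => i _.
  have := int_abs_incr_coord hB (lexx 0) t0 tT i.
  rewrite subr0 /incr => H; apply: le_trans (le_trans H _); last first.
    by rewrite lee_fin ler_wpM2l ?mulr_ge0 ?expR_ge0 // ler_wsqrtr.
  by under [in leRHS]eq_integral do rewrite B0 subr0.
by rewrite sumEFin sumr_const card_ord lee_fin /brownianC -[leLHS]mulr_natl.
Qed.

Definition referenceC : R :=
  (brownianC + R0) * (1 + dL * gronwall_intC dL T * T).

Lemma referenceC_ge0 : 0 <= referenceC.
Proof.
apply: mulr_ge0; apply: addr_ge0 => //; first exact: brownianC_ge0.
exact: mulr_ge0 (mulr_ge0 dL0 (gronwall_intC_ge0 _ _)) (ltW T0).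
Qed.

Lemma reference_bound x X s : nice_solution x X ->
  (\int[P]_w (`|X s w - X s w0|)%:E <= referenceC%:E)%E.
Proof.
move=> nX; have [mX _ [cX _] iX _] := nX.
have [hB mB cB pB _] := nB.
have -> : (\int[P]_w (`|X s w - X s w0|)%:E =
    \int[P]_w (`|X (clamp T s) w - X (clamp T s) w0|)%:E)%E.
  by apply: eq_integral => w _; rewrite -!cX.
have /andP[] := clamp_itv s (ltW T0); move: (clamp T s) => t t0 tT.
set c := dL * gronwall_intC dL T.
have c0 : 0 <= c := mulr_ge0 dL0 (gronwall_intC_ge0 _ _).
have mBt := jointly_measurable_slice t mB.
have mXt := jointly_measurable_slice t mX.
pose g (z : RR * Omega) := `|B z.1 z.2| + R0.
have mg : measurable_fun setT g.
  by apply: measurable_funD => //; exact: (measurableT_comp measurable_rV_norm mB).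
have g0 z : 0 <= g z by exact: addr_ge0.
have bg w : bmf (fun r : RR => g (r, w)).
  by apply: bmfD; [exact: bmf_path_norm|exact: bmf_cst].
have gE r : (\int[P]_w (g (r, w))%:E <= (brownianC + R0)%:E)%E.
  under eq_integral do rewrite EFinD.
  rewrite ge0_integralD //; try by move=> w _; rewrite lee_fin.
    2: apply/measurable_EFinP.
    2: exact: (measurableT_comp measurable_rV_norm (jointly_measurable_slice r mB)).
  by rewrite EFinD leeD ?int_abs_brownian // integral_cst // [X in (_ * X)%E](probability_setT P) mule1.
have H := tonelli_bound (ltW T0) (addr_ge0 brownianC_ge0 R00) mg g0 bg gE.
rewrite subr0 in H.
have mI : measurable_fun setT (fun w => \int[lebI 0 T]_r g (r, w)).
  rewrite /Rintegral; apply: (measurableT_comp (@fine_measurable _ _ measurableT)).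
  have := @measurable_fun_fubini_tonelli_G _ _ _ _ _ (lebI 0 T) (EFin \o g).
  by apply => //; exact/measurable_EFinP.
apply: (@le_trans _ _ (\int[P]_w ((g (t, w))%:E + c%:E * (\int[lebI 0 T]_r g (r, w))%:E))%E).
  apply: ge0_le_integral => //.
  - by apply/measurable_EFinP; apply: (measurableT_comp measurable_rV_norm); apply: measurable_rVB.
  - apply/measurable_EFinP; apply: measurable_funD.
      exact: (measurableT_comp mg (pair1_measurable _)).
    exact: measurable_funM.
  - move=> w _; rewrite -EFinM -EFinD lee_fin.
    by have := reference_distance w nX t0 tT; rewrite mulrA.
rewrite ge0_integralD //; last 4 first.
- by move=> w _; rewrite lee_fin.
- by apply/measurable_EFinP; exact: (measurableT_comp mg (pair1_measurable _)).
- by move=> w _; rewrite -EFinM lee_fin mulr_ge0 // Rintegral_ge0.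
- by apply/measurable_EFinP; exact: measurable_funM.
rewrite ge0_integralZl //; try by [rewrite lee_fin|exact/measurable_EFinP].
  2: by move=> w _; rewrite lee_fin Rintegral_ge0.
apply: (@le_trans _ _ ((brownianC + R0)%:E + c%:E * (T * (brownianC + R0))%:E)%E).
  by apply: leeD => //; rewrite lee_wpmul2l // lee_fin.
by rewrite -EFinM -EFinD lee_fin /referenceC -/c le_eqVlt; apply/orP; left; apply/eqP; ring.
Qed.

End nice_processes.

Section first_differences.
Context {R : realType} {disp : measure_display} {Omega : measurableType disp}.
Variables (P : probability Omega R) (d : nat).
Local Notation V := 'rV[R]_d.
Local Notation BV := (borel_rV R d).
Local Notation RR := (measurableTypeR R).
Local Notation leb := (@lebesgue_measure R).
Variables (T : R) (G : R -> set (set Omega)) (B : R -> Omega -> V).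
Variables (L : R) (f phi : R -> V -> V -> V).
Hypotheses (T0 : 0 < T) (nB : nice_noise P T G B).
Hypotheses (cf : regular_coeff L f) (cphi : regular_coeff L phi).
Variables (R0 : R) (w0 : Omega).
Hypothesis w0R : forall s, `|B s w0| <= R0.
Local Notation beta := (beta P f phi).
Local Notation dL := (driftL L).
Let L0 : 0 <= L. Proof. by case: cf. Qed.
Let dL0 : 0 <= dL. Proof. exact: driftL_ge0 cf. Qed.

Variables (x x' : V) (X X' : R -> Omega -> V).
Hypotheses (nX : nice_solution P T G B f phi x X).
Hypotheses (nX' : nice_solution P T G B f phi x' X').

Local Notation D s w := `|X s w - X' s w|.

Lemma measurable_distance : measurable_fun setT (fun z : RR * Omega => D z.1 z.2).
Proof.
have [mX _ _ _ _] := nX; have [mX' _ _ _ _] := nX'.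
by apply: (measurableT_comp measurable_rV_norm); exact: measurable_rVB.
Qed.

Lemma distance_finite : exists2 H : R, 0 <= H &
  forall s, (\int[P]_w (D s w)%:E <= H%:E)%E.
Proof.
have [mX _ [_ pX] _ _] := nX; have [mX' _ [_ pX'] _ _] := nX'.
have [M XM] := pX w0; have [M' XM'] := pX' w0.
have M0 : 0 <= M := le_trans (normr_ge0 _) (XM 0).
have M0' : 0 <= M' := le_trans (normr_ge0 _) (XM' 0).
pose C := referenceC d T L R0.
have C0 : 0 <= C := referenceC_ge0 T0 cf w0R.
exists (C + (C + (M + M'))) => [|s]; first by rewrite !addr_ge0.
have m1 : measurable_fun setT (fun w => (`|X s w - X s w0|)%:E).
  apply/measurable_EFinP; apply: (measurableT_comp measurable_rV_norm).
  by apply: measurable_rVB => //; exact: jointly_measurable_slice.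
have m2 : measurable_fun setT (fun w => (`|X' s w - X' s w0|)%:E).
  apply/measurable_EFinP; apply: (measurableT_comp measurable_rV_norm).
  by apply: measurable_rVB => //; exact: jointly_measurable_slice.
have m3 : measurable_fun setT (fun w => (D s w)%:E).
  apply/measurable_EFinP; exact: (measurableT_comp measurable_distance (pair1_measurable _)).
apply: (@le_trans _ _ (\int[P]_w ((`|X s w - X s w0|)%:E + ((`|X' s w - X' s w0|)%:E + (M + M')%:E)))%E).
  apply: ge0_le_integral => //.
    by apply: emeasurable_funD => //; exact: emeasurable_funD.
  move=> w _; rewrite -!EFinD lee_fin.
  have -> : X s w - X' s w = (X s w - X s w0) + (- (X' s w - X' s w0) + (X s w0 - X' s w0)).
    by move: (X s w) (X' s w) (X s w0) (X' s w0) => a1 a2 a3 a4; vring.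
  apply: le_trans (ler_normD _ _) _; rewrite lerD2l.
  apply: le_trans (ler_normD _ _) _; rewrite normrN lerD2l.
  by apply: le_trans (ler_normB _ _) _; exact: lerD.
rewrite ge0_integralD //; try by move=> w _; rewrite ?lee_fin ?adde_ge0 ?lee_fin ?addr_ge0.
  2: exact: emeasurable_funD.
rewrite [leRHS]EFinD; apply: leeD; first exact: (reference_bound T0 nB cf cphi w0R s nX).
rewrite ge0_integralD //; try by move=> w _; rewrite lee_fin ?addr_ge0.
rewrite [leRHS]EFinD; apply: leeD; first exact: (reference_bound T0 nB cf cphi w0R s nX').
by rewrite integral_cst // [X in (_ * X)%E](probability_setT P) mule1.
Qed.

Lemma distance_integrable s : P.-integrable setT (fun w => (D s w)%:E).
Proof.
have m3 : measurable_fun setT (fun w => (D s w)%:E).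
  apply/measurable_EFinP; exact: (measurableT_comp measurable_distance (pair1_measurable _)).
apply/integrableP; split => //.
have [H _ HD] := distance_finite.
under eq_integral do rewrite gee0_abs ?lee_fin //.
exact: le_lt_trans (HD s) (ltry _).
Qed.

Lemma distance_path (h : RR -> R) t w : bmf h -> (forall s, 0 <= h s) ->
  (forall s, \int[P]_w D s w <= h s) -> 0 <= t -> t <= T ->
  D t w <= `|x - x'| + \int[lebI 0 t]_s (dL * D s w + L * (L * h s)).
Proof.
move=> bh h0 hD t0 tT; have [mh [H hH]] := bh.
have [mX _ [_ pX] iX _] := nX; have [mX' _ [_ pX'] iX' _] := nX'.
have bB s y y' : `|beta X s y - beta X' s y'| <= dL * `|y - y'| + L * (L * h s).
  apply: le_trans (beta_dist cf cphi iX iX' (distance_integrable s) y y') _.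
  by rewrite lerD2l !ler_wpM2l.
have [bZ eZ] := @nice_difference _ _ _ P d T G B L f phi cf cphi x X x' X' w w (L * (L * H)) nX nX'
  (fun s y y' => le_trans (bB s y y') (lerD (lexx _)
     (ler_wpM2l L0 (ler_wpM2l L0 (le_trans (ler_norm _) (hH s)))))).
rewrite (eZ t t0 tT) subrr addr0; apply: le_trans (ler_normD _ _) _; rewrite lerD2l.
apply: lebI_row_bound => //.
- apply: bmfD; apply: (bmfM (bmf_cst _)); last by apply: (bmfM (bmf_cst _)).
  split; first exact: (measurableT_comp measurable_distance (pair2_measurable _)).
  have [M XM] := pX w; have [M' XM'] := pX' w.
  exists (M + M') => s; rewrite normr_id.
  by apply: le_trans (ler_normB _ _) _; exact: lerD.
- by move=> s; apply: addr_ge0; [exact: mulr_ge0 dL0 (normr_ge0 _)|rewrite !mulr_ge0].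
Qed.

Lemma distance_path_bmf w : bmf (fun s : RR => D s w).
Proof.
have [mX _ [_ pX] iX _] := nX; have [mX' _ [_ pX'] iX' _] := nX'.
split; first exact: (measurableT_comp measurable_distance (pair2_measurable _)).
have [M XM] := pX w; have [M' XM'] := pX' w.
exists (M + M') => s; rewrite normr_id.
by apply: le_trans (ler_normB _ _) _; exact: lerD.
Qed.

Lemma distance_gronwall (H : R) : 0 <= H -> (forall s, \int[P]_w D s w <= H) ->
  forall s w, D s w <= gronwallC dL T * (`|x - x'| + T * (L * (L * H))).
Proof.
move=> H0 DH s w.
have [_ _ [cX _] _ _] := nX; have [_ _ [cX' _] _ _] := nX'.
rewrite cX cX'; have /andP[] := clamp_itv s (ltW T0); move: (clamp T s) => t t0 tT.
have LH : 0 <= L * (L * H) by rewrite !mulr_ge0.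
have c0 : 0 <= `|x - x'| + T * (L * (L * H)) by rewrite addr_ge0 // mulr_ge0 // ltW.
apply: (gronwall (distance_path_bmf w) dL0 c0) t0 tT => r r0 rT.
apply: le_trans (distance_path w (bmf_cst H) (fun=> H0) DH r0 rT) _.
have b1 := bmfM (bmf_cst dL) (distance_path_bmf w).
rewrite (bmf_intD _ b1 (bmf_cst (L * (L * H)))) (bmf_intZ _ dL (distance_path_bmf w)).
rewrite lebI_int_cst // subr0 addrA addrAC lerD2r lerD2l.
by apply: ler_wpM2r.
Qed.

Lemma distance_bmf : bmf (fun z : RR * Omega => D z.1 z.2).
Proof.
split; first exact: measurable_distance.
have [H H0 HD] := distance_finite.
have DH s : \int[P]_w D s w <= H.
  by rewrite -lee_fin fineK // ge0_fin_numE ?integral_ge0 //; exact: le_lt_trans (HD s) (ltry _).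
by eexists => z; rewrite normr_id; exact: distance_gronwall H0 DH z.1 z.2.
Qed.

Definition lipschitzC : R :=
  gronwallC dL T * (1 + T * (L * (L * gronwallC (dL + L * L) T))).

Lemma lipschitzC_ge0 : 0 <= lipschitzC.
Proof.
have TT := ltW T0; have LL : 0 <= dL + L * L by rewrite addr_ge0 // mulr_ge0.
by rewrite mulr_ge0 ?gronwallC_ge0 // addr_ge0 // !mulr_ge0 ?gronwallC_ge0.
Qed.

Lemma mean_distance_bmf : bmf (fun s : RR => \int[P]_w D s w).
Proof.
have := bmf_int_inner (@dirac _ RR point R) P (f := fun z : RR * Omega => D z.1 z.2) distance_bmf.
by [].
Qed.

Lemma mean_distance s : \int[P]_w D s w <= gronwallC (dL + L * L) T * `|x - x'|.
Proof.
have [_ _ [cX _] _ _] := nX; have [_ _ [cX' _] _ _] := nX'.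
under eq_Rintegral do rewrite cX cX'.
have /andP[] := clamp_itv s (ltW T0); move: (clamp T s) => t t0 tT.
have LL : 0 <= dL + L * L by rewrite addr_ge0 // mulr_ge0.
pose h (s : RR) := \int[P]_w D s w.
have h0 r : 0 <= h r by apply: Rintegral_ge0.
have bh : bmf h := mean_distance_bmf.
apply: (gronwall bh LL (normr_ge0 (x - x'))) t0 tT => r r0 rT.
have bDs q : bmf (fun w => D q w).
  exact: (bmf_comp (pair1_measurable (q : RR)) distance_bmf).
have bI : bmf (fun z : Omega * RR => dL * D z.2 z.1 + L * (L * h z.2)).
  apply: bmfD; apply: (bmfM (bmf_cst _)).
    apply: (bmf_comp (h := fun z : Omega * RR => (z.2, z.1)) _ distance_bmf).
    exact: measurable_swap.
  apply: (bmfM (bmf_cst _)).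
  exact: (bmf_comp (h := fun z : Omega * RR => z.2) measurable_snd bh).
have bIw : bmf (fun w => \int[lebI 0 r]_q (dL * D q w + L * (L * h q))).
  exact: (bmf_int_inner P (lebI 0 r) bI).
apply: (@le_trans _ _ (\int[P]_w (`|x - x'| + \int[lebI 0 r]_q (dL * D q w + L * (L * h q))))).
  apply: bmf_int_le => //; first by apply: bmfD => //; exact: bmf_cst.
  by move=> w; apply: distance_path.
rewrite (bmf_intD P (bmf_cst `|x - x'|) bIw) (int_prob_cst P `|x - x'|) lerD2l.
rewrite (bmf_Fubini P (lebI 0 r) bI) /= -(bmf_intZ _ (dL + L * L) bh).
rewrite le_eqVlt; apply/orP; left; apply/eqP; apply: eq_Rintegral => q _.
have bq : bmf (fun w => dL * D q w) by exact: bmfM (bmf_cst _) (bDs q).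
rewrite (bmf_intD P bq (bmf_cst (L * (L * h q)))) (bmf_intZ P dL (bDs q)).
by rewrite (int_prob_cst P (L * (L * h q))) mulrDl !mulrA.
Qed.

Lemma nice_lipschitz s w : D s w <= lipschitzC * `|x - x'|.
Proof.
have LL : 0 <= dL + L * L by rewrite addr_ge0 // mulr_ge0.
have c0 : 0 <= gronwallC (dL + L * L) T * `|x - x'|.
  by rewrite mulr_ge0 ?gronwallC_ge0 // ltW.
apply: le_trans (distance_gronwall c0 mean_distance s w) _.
have g0 := gronwallC_ge0 dL0 (ltW T0).
rewrite /lipschitzC -mulrA; apply: ler_wpM2l => //.
by rewrite le_eqVlt; apply/orP; left; apply/eqP; ring.
Qed.

End first_differences.

(** * Second differences of solutions *)

Lemma rV_entryB {R : realType} {d : nat} (a b : 'rV[R]_d) i :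
  a ord0 i - b ord0 i = (a - b) ord0 i.
Proof. by rewrite !mxE. Qed.

Lemma rV_entryD {R : realType} {d : nat} (a b : 'rV[R]_d) i :
  (a + b) ord0 i = a ord0 i + b ord0 i.
Proof. by rewrite mxE. Qed.

Lemma row_entry {R : realType} {d : nat} (F : 'I_d -> R) i :
  (\row_j F j : 'rV[R]_d) ord0 i = F i.
Proof. by rewrite mxE. Qed.

Lemma row_int_split {R : realType} {d : nat} (Z : measurableTypeR R -> 'rV[R]_d) (a b c : R) :
  (forall i, bmf (fun s => Z s ord0 i)) -> a <= b -> b <= c ->
  \row_i \int[lebI a c]_s Z s ord0 i =
    \row_i (\int[lebI a b]_s Z s ord0 i) + \row_i \int[lebI b c]_s Z s ord0 i :> 'rV[R]_d.
Proof.
by move=> bZ ab bc; apply/rowP => i; rewrite rV_entryD !row_entry (lebI_int_split (bZ i) ab bc).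
Qed.

Lemma kick_split {V : zmodType} (c1 c2 : V -> V) y a z :
  (c1 (y + a + z) - c1 (y + a)) - (c2 (y + a) - c2 (y + a - z)) =
  (c1 (y + a + z) - c1 (y + a)) - (c2 (y + (a - z) + z) - c2 (y + (a - z))).
Proof. by rewrite (addrA y) subrK. Qed.

Lemma kick_difference {R : realType} {d : nat} (c1 c2 : 'rV[R]_d -> 'rV[R]_d) y a z z' :
  ((c1 (y + a + z) - c1 (y + a)) - (c2 (y + a) - c2 (y + a - z))) -
  ((c1 (y + a + z') - c1 (y + a)) - (c2 (y + a) - c2 (y + a - z'))) =
  (c1 (y + (a + z') + (z - z')) - c1 (y + (a + z'))) -
  (c2 (y + (a - z) + (z - z')) - c2 (y + (a - z))).
Proof.
have -> : y + (a + z') + (z - z') = y + a + z.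
  by rewrite (addrC z) !addrA addrK.
have -> : y + (a - z) + (z - z') = y + a - z' by rewrite !addrA subrK.
rewrite !(addrA y); move: (c1 _) (c1 _) (c1 _) (c2 _) (c2 _) (c2 _) => a1 a2 a3 b1 b2 b3.
by clear; vring.
Qed.

Lemma bmf_sum {R : realType} {dT} {O : measurableType dT} (I : Type) (r : seq I)
    (F : I -> O -> R) :
  (forall i, bmf (F i)) -> bmf (fun w => \sum_(i <- r) F i w).
Proof.
move=> bF; elim: r => [|i r IH].
  by under eq_fun do rewrite big_nil; exact: bmf_cst.
by under eq_fun do rewrite big_cons; exact: bmfD.
Qed.

Lemma bmf_int_sum {R : realType} {dT} {O : measurableType dT} (P : probability O R)
    (I : Type) (r : seq I) (F : I -> O -> R) :
  (forall i, bmf (F i)) ->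
  \int[P]_w (\sum_(i <- r) F i w) = \sum_(i <- r) \int[P]_w F i w.
Proof.
move=> bF; elim: r => [|i r IH].
  under eq_Rintegral do rewrite big_nil.
  by rewrite (int_prob_cst P 0) big_nil.
under eq_Rintegral do rewrite big_cons.
by rewrite (bmf_intD P (bF i) (bmf_sum r bF)) IH big_cons.
Qed.

Lemma increment_balance {R : realType} (x1 x2 x3 x4 b1 b2 b3 b4 i1 i2 : R) :
  x1 - x2 = i1 + (b1 - b2) -> x3 - x4 = i2 + (b3 - b4) ->
  x1 - (x2 - b2) - (x3 - (x4 - b4)) - (b1 - b3) = i1 - i2.
Proof. by move=> H1 H2; lra. Qed.

Lemma cancel_increment {V : zmodType} (c I1 I2 b1 b2 : V) :
  (c + (I1 + I2) + (b1 - b1)) - (c + I1 + (b2 - b2)) = I2.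
Proof. by rewrite !subrr !addr0 (addrA c) (addrAC (c + I1)) subrr add0r. Qed.

Lemma cancel_second_difference {V : zmodType} (x u I1 I2 b : V) :
  (x + u - x + I1 + (b - b)) + (x - u - x + I2 + (b - b)) = I1 + I2.
Proof.
rewrite subrr !addr0 (addrAC x u) subrr add0r (addrAC x (- u)) subrr add0r.
by rewrite addrACA subrr add0r.
Qed.

Section second_differences.
Context {R : realType} {disp : measure_display} {Omega : measurableType disp}.
Variables (P : probability Omega R) (d : nat).
Local Notation V := 'rV[R]_d.
Local Notation BV := (borel_rV R d).
Local Notation RR := (measurableTypeR R).
Variables (T : R) (G : R -> set (set Omega)) (B : R -> Omega -> V).
Variables (L : R) (f phi : R -> V -> V -> V).
Hypotheses (T0 : 0 < T) (nB : nice_noise P T G B).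
Hypotheses (cf : regular_coeff L f) (cphi : regular_coeff L phi).
Variables (R0 : R) (w0 : Omega).
Hypothesis w0R : forall s, `|B s w0| <= R0.
Local Notation beta := (beta P f phi).
Local Notation dL := (driftL L).
Local Notation LC := (lipschitzC T L).
Local Notation root4 x := (Num.sqrt (Num.sqrt x)).
Let L0 : 0 <= L. Proof. by case: cf. Qed.
Let dL0 : 0 <= dL. Proof. exact: driftL_ge0 cf. Qed.
Let LC0 : 0 <= LC. Proof. exact: lipschitzC_ge0 T0 cf. Qed.

Variables (x u : V) (X0 X1 X2 : R -> Omega -> V).
Hypotheses (nX0 : nice_solution P T G B f phi x X0).
Hypotheses (nX1 : nice_solution P T G B f phi (x + u) X1).
Hypotheses (nX2 : nice_solution P T G B f phi (x - u) X2).
Local Notation delta := `|u|.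
Hypotheses (u0 : 0 < delta) (u1 : delta <= 1).

Let D := LC * delta.
Let D0 : 0 <= D. Proof. exact: mulr_ge0 LC0 (normr_ge0 _). Qed.

Let D10 s w : `|X1 s w - X0 s w| <= D.
Proof.
have := nice_lipschitz T0 nB cf cphi w0R nX1 nX0 s w.
by rewrite (addrC x) addrK.
Qed.

Let D12 s w : `|X1 s w - X2 s w| <= 2 * D.
Proof.
have := nice_lipschitz T0 nB cf cphi w0R nX1 nX2 s w.
have -> : x + u - (x - u) = u + u by vring.
move/le_trans; apply; rewrite mulrCA; apply: ler_wpM2l => //.
by apply: le_trans (ler_normD _ _) _; rewrite mulr_natl mulr2n.
Qed.

Let mX0 : jointly_measurable X0. Proof. by case: nX0. Qed.
Let mX1 : jointly_measurable X1. Proof. by case: nX1. Qed.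
Let mX2 : jointly_measurable X2. Proof. by case: nX2. Qed.
Let iX0 : phi_integrable P phi X0. Proof. by case: nX0. Qed.
Let iX1 : phi_integrable P phi X1. Proof. by case: nX1. Qed.
Let iX2 : phi_integrable P phi X2. Proof. by case: nX2. Qed.

Let bD12 s : bmf (fun w => `|X1 s w - X2 s w|).
Proof.
split; last by exists (2 * D) => w; rewrite normr_id; exact: D12.
apply: (measurableT_comp measurable_rV_norm).
by apply: measurable_rVB; exact: jointly_measurable_slice.
Qed.

Let iD12 s : P.-integrable setT (fun w => (`|X1 s w - X2 s w|)%:E).
Proof. exact: bmf_integrable (bD12 s). Qed.

Let ED12 s : \int[P]_w `|X1 s w - X2 s w| <= 2 * D.
Proof.
apply: le_trans (ler_norm _) _; apply: bmf_int_ub => // w.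
by rewrite normr_id; exact: D12.
Qed.

Let gap_holder s y y' :
  `|beta X1 s y - beta X2 s y - beta X1 s y' + beta X2 s y'|
  <= holderC L * (2 * D) * Num.sqrt `|y - y'|.
Proof.
apply: le_trans (beta_dist_holder cf cphi iX1 iX2 (iD12 s) y y') _.
apply: ler_wpM2r; first exact: sqrtr_ge0.
by apply: ler_wpM2l => //; exact: (holderC_ge0 cf).
Qed.

Let measurable_beta_slice x' X s : nice_solution P T G B f phi x' X ->
  measurable_fun setT (fun y : BV => beta X s y : BV).
Proof.
move=> [mX _ _ iX _].
apply: (measurableT_comp (measurable_beta P cf cphi mX) (g := fun y : BV => (s : RR, y))).
exact: pair1_measurable.
Qed.

Let heat_kick (s a b : R) (y p p' v : V) i : 0 <= a -> a < b -> b <= T ->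
  `|heat P B a b (fun y : BV => ((beta X1 s ((y : V) + p + v) - beta X1 s ((y : V) + p))
      - (beta X2 s ((y : V) + p' + v) - beta X2 s ((y : V) + p'))) ord0 i) y|
  <= gaussC * d%:R * `|v| * (holderC L * (2 * D) + compC L * `|p - p'|)
       / root4 (b - a).
Proof.
move=> a0 ab bT.
have [hB _ _ _ _] := nB.
pose g (y : BV) : R := (beta X1 s y - beta X2 s y) ord0 i.
pose k (y : BV) : R := (beta X2 s ((y : V) + v) - beta X2 s y) ord0 i.
have mb1 := measurable_beta_slice s nX1; have mb2 := measurable_beta_slice s nX2.
have bg : bmf g.
  split; first exact: (measurableT_comp (measurable_rV_coord i) (measurable_rVB mb1 mb2)).
  exists (dL * 0 + L * (L * (2 * D))) => z; apply: le_trans (mx_entry_norm_le _ _ _) _.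
  apply: le_trans (beta_dist cf cphi iX1 iX2 (iD12 s) z z) _.
  by rewrite subrr normr0 lerD2l !ler_wpM2l.
have mvD (c : V) : measurable_fun setT (fun y : BV => (y : V) + c : BV).
  by apply: measurable_rVD; [exact: measurable_id|exact: measurable_cst].
have bk : bmf k.
  split.
    apply: (measurableT_comp (measurable_rV_coord i)); apply: measurable_rVB => //.
    exact: (measurableT_comp mb2 (mvD v)).
  exists (dL * `|v|) => z; apply: le_trans (mx_entry_norm_le _ _ _) _.
  by apply: le_trans (beta_lip cf cphi iX2 s _ _) _; rewrite (addrC z) addrK.
have gH y1 y2 : `|g y1 - g y2| <= holderC L * (2 * D) * Num.sqrt `|y1 - y2 : V|.
  apply: le_trans (gap_holder s y1 y2).
  have -> : g y1 - g y2 = (beta X1 s y1 - beta X2 s y1 - beta X1 s y2 + beta X2 s y2) ord0 i.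
    by rewrite /g !mxE; ring.
  exact: mx_entry_norm_le.
have kH y1 y2 : `|k y1 - k y2| <= compC L * `|v| * Num.sqrt `|y1 - y2 : V|.
  apply: le_trans (beta_increment cf cphi s y1 y2 v iX2).
  have -> : k y1 - k y2 = (beta X2 s ((y1 : V) + v) - beta X2 s y1
      - beta X2 s ((y2 : V) + v) + beta X2 s y2) ord0 i.
    by rewrite /k !mxE; ring.
  exact: mx_entry_norm_le.
have bS (h : BV -> R) (c : V) : bmf h ->
    bmf (fun w => h ((y + c : V) + incr B a b w : BV)).
  apply: bmf_comp; apply: measurable_rVD; first exact: measurable_cst.
  by apply: (measurable_incr hB) => //; exact: ltW.
have e : heat P B a b (fun y : BV => ((beta X1 s ((y : V) + p + v) - beta X1 s ((y : V) + p))
      - (beta X2 s ((y : V) + p' + v) - beta X2 s ((y : V) + p'))) ord0 i) y =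
    (heat P B a b g ((y + p) + v) - heat P B a b g (y + p)) +
    (heat P B a b k ((y + p') + (p - p')) - heat P B a b k (y + p')).
  have b1 := bS g (p + v) bg; have b2 := bS g p bg.
  have b3 := bS k (p' + (p - p')) bk; have b4 := bS k p' bk.
  pose F1 w := g ((y + (p + v) : V) + incr B a b w) - g ((y + p : V) + incr B a b w).
  pose F2 w := k ((y + (p' + (p - p')) : V) + incr B a b w) - k ((y + p' : V) + incr B a b w).
  have E1 : \int[P]_w F1 w = heat P B a b g (y + p + v) - heat P B a b g (y + p).
    by rewrite -(addrA y p v); exact: (bmf_intB P b1 b2).
  have E2 : \int[P]_w F2 w = heat P B a b k (y + p' + (p - p')) - heat P B a b k (y + p').
    by rewrite -(addrA y p' (p - p')); exact: (bmf_intB P b3 b4).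
  have bF1 : bmf F1 by exact: bmfB b1 b2.
  have bF2 : bmf F2 by exact: bmfB b3 b4.
  apply: (etrans _ (congr2 +%R E1 E2)); apply: (etrans _ (bmf_intD P bF1 bF2)).
  clear E1 E2 bF1 bF2; apply: eq_Rintegral => w _; rewrite /F1 /F2 /g /k; move: (incr B a b w) => z.
  have -> : p' + (p - p') = p by vring.
  rewrite (addrAC y z p) (addrAC y z p') (addrAC (y + p) z v) (addrAC (y + p') z v).
  move: (beta X1 s) (beta X2 s) => c1 c2; rewrite !addrA.
  move: (c1 _) (c1 _) (c2 _) (c2 _) => a1 a2 a3 a4; clear.
  by rewrite !mxE; ring.
rewrite e; apply: le_trans (ler_normD _ _) _.
have H1 := heat_holder_lip hB a0 ab bT (y + p) v bg
  (mulr_ge0 (holderC_ge0 cf) (mulr_ge0 (ler0n R 2) D0)) gH.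
have H2 := heat_holder_lip hB a0 ab bT (y + p') (p - p') bk
  (mulr_ge0 (compC_ge0 L0) (normr_ge0 v)) kH.
apply: le_trans (lerD H1 H2) _.
by rewrite le_eqVlt; apply/orP; left; apply/eqP; ring.
Qed.

Let q1 s y v := (beta X1 s (y + v) - beta X1 s y) - (beta X2 s y - beta X2 s (y - v)).

Let q1_lip_r s y v v' : `|q1 s y v - q1 s y v'| <= 2 * dL * `|v - v'|.
Proof.
have -> : q1 s y v - q1 s y v' = (beta X1 s (y + v) - beta X1 s (y + v')) +
    (beta X2 s (y - v) - beta X2 s (y - v')) by rewrite /q1; vring.
apply: le_trans (ler_normD _ _) _.
have H1 := beta_lip cf cphi iX1 s (y + v) (y + v').
have H2 := beta_lip cf cphi iX2 s (y - v) (y - v').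
have e1 : y + v - (y + v') = v - v' by vring.
have e2 : y - v - (y - v') = v' - v by vring.
rewrite e1 in H1; rewrite e2 (distrC v') in H2.
apply: le_trans (lerD H1 H2) _.
by rewrite le_eqVlt; apply/orP; left; apply/eqP; ring.
Qed.

Let q1_bound s y v : `|q1 s y v| <= 2 * dL * `|v|.
Proof.
have H1 := beta_lip cf cphi iX1 s (y + v) y.
have H2 := beta_lip cf cphi iX2 s y (y - v).
have e1 : y + v - y = v by vring.
have e2 : y - (y - v) = v by vring.
rewrite e1 in H1; rewrite e2 in H2.
apply: le_trans (ler_normB _ _) _; apply: le_trans (lerD H1 H2) _.
by rewrite le_eqVlt; apply/orP; left; apply/eqP; ring.
Qed.

Let q1_lip_l s y y' v : `|q1 s y v - q1 s y' v| <= 4 * dL * `|y - y'|.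
Proof.
have -> : q1 s y v - q1 s y' v = (beta X1 s (y + v) - beta X1 s (y' + v)) -
    (beta X1 s y - beta X1 s y') - (beta X2 s y - beta X2 s y') +
    (beta X2 s (y - v) - beta X2 s (y' - v)) by rewrite /q1; vring.
have H1 := beta_lip cf cphi iX1 s (y + v) (y' + v).
have H2 := beta_lip cf cphi iX2 s (y - v) (y' - v).
have H3 := beta_lip cf cphi iX1 s y y'; have H4 := beta_lip cf cphi iX2 s y y'.
have e1 : y + v - (y' + v) = y - y' by vring.
have e2 : y - v - (y' - v) = y - y' by vring.
rewrite e1 in H1; rewrite e2 in H2.
apply: le_trans (ler_normD _ _) _.
apply: le_trans (lerD (le_trans (ler_normB _ _) (lerD (le_trans (ler_normB _ _) (lerD H1 H3)) H4)) H2) _.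
by rewrite le_eqVlt; apply/orP; left; apply/eqP; ring.
Qed.

Let q1_holder s y v : `|v| <= D ->
  `|q1 s y v| <= (2 * holderC L + compC L) * (LC * Num.sqrt LC) * (delta * Num.sqrt delta).
Proof.
move=> vD.
have -> : q1 s y v = (beta X1 s (y + v) - beta X2 s (y + v) - beta X1 s y + beta X2 s y)
   + (beta X2 s (y + v) - beta X2 s y - beta X2 s (y - v + v) + beta X2 s (y - v)).
  by rewrite subrK /q1; vring.
apply: le_trans (ler_normD _ _) _.
have H1 := gap_holder s (y + v) y; have H2 := beta_increment cf cphi s y (y - v) v iX2.
have e1 : y + v - y = v by vring.
have e2 : y - (y - v) = v by vring.
rewrite e1 in H1; rewrite e2 in H2.
apply: le_trans (lerD H1 H2) _.
have sD : Num.sqrt `|v| <= Num.sqrt LC * Num.sqrt delta by rewrite -sqrtrM // ler_wsqrtr.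
have cC := compC_ge0 L0; have hC := holderC_ge0 cf.
have i1 : holderC L * (2 * D) * Num.sqrt `|v| <=
    holderC L * (2 * D) * (Num.sqrt LC * Num.sqrt delta).
  by apply: ler_wpM2l => //; apply: mulr_ge0 => //; apply: mulr_ge0.
have i2 : compC L * `|v| * Num.sqrt `|v| <= compC L * D * (Num.sqrt LC * Num.sqrt delta).
  by apply: ler_pM; rewrite ?sqrtr_ge0 ?mulr_ge0 // ler_wpM2l.
apply: le_trans (lerD i1 i2) _; rewrite /D.
by rewrite le_eqVlt; apply/orP; left; apply/eqP; ring.
Qed.

(* The reference path [A] is absorbed into [q], so that the increments of [xi]
   stay close to those of [B]; the cut-off only makes [q] bounded. *)
Let A s := X0 s w0 - B s w0.
Let xi s w := X0 s w - A s.
Let eta s w := 2^-1 *: (X1 s w - X2 s w).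
Let q i s y v : R := if `|v| <= D then q1 s (y + A s) v ord0 i else 0.

Let etaD s w : `|eta s w| <= D.
Proof.
rewrite /eta normrZ ger0_norm ?invr_ge0 // mulrC ler_pdivrMr // mulrC; exact: D12.
Qed.

Let mA : measurable_fun setT (A : RR -> BV).
Proof.
have [_ mB _ _ _] := nB.
by apply: measurable_rVB; exact: jointly_measurable_path.
Qed.

Definition noiseK : R :=
  4 * dL + 2 * dL * LC + gaussC * d%:R * LC ^+ 2 * (2 * holderC L + compC L)
  + 2 * gaussC * d%:R * LC * (holderC L + compC L)
  + dL * referenceC d T L R0 + (dL + L * L) * LC.

Let noiseK_ge (c : R) : c \in [:: 4 * dL; 2 * dL * LC;
  gaussC * d%:R * LC ^+ 2 * (2 * holderC L + compC L);
  2 * gaussC * d%:R * LC * (holderC L + compC L);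
  dL * referenceC d T L R0; (dL + L * L) * LC] -> 0 <= c <= noiseK.
Proof.
have cC := compC_ge0 L0; have hC := holderC_ge0 cf.
have rC := referenceC_ge0 T0 cf w0R.
have g0 : 0 <= gaussC :> R by exact: le_trans gaussC_ge2.
have LC0' := LC0; have dL0' := dL0; have L0' := L0.
have [a1 [a2 [a3 [a4 [a5 a6]]]]] : 0 <= 4 * dL /\ 0 <= 2 * dL * LC /\
  0 <= gaussC * d%:R * LC ^+ 2 * (2 * holderC L + compC L) /\
  0 <= 2 * gaussC * d%:R * LC * (holderC L + compC L) /\
  0 <= dL * referenceC d T L R0 /\ 0 <= (dL + L * L) * LC.
  move: dL LC LC0' dL0' (holderC L) (compC L) cC hC (referenceC d T L R0) rC gaussC g0.
  move=> a b b0 a0 h k k0 h0 r r0 g g0.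
  by do !split; repeat (apply: mulr_ge0 || apply: addr_ge0 || apply: exprn_ge0).
rewrite !inE /noiseK; move=> /or4P[/eqP->|/eqP->|/eqP->|/or3P[]/eqP->]; lra.
Qed.

Let noiseK_ge0 : 0 <= noiseK.
Proof.
by have /andP[H1 H2] := @noiseK_ge (4 * dL) (mem_head _ _); exact: le_trans H2.
Qed.

Let mxi : jointly_measurable xi.
Proof.
apply: measurable_rVB => //; apply: (measurableT_comp mA); exact: measurable_fst.
Qed.

Let meta : jointly_measurable eta.
Proof. by apply: measurable_rVZ; exact: measurable_rVB. Qed.

Let axi : adapted T G xi.
Proof.
have [_ aX _ _ _] := nX0 => s s0 sT.
by apply: measurable_rVB; [exact: aX|exact: measurable_cst].
Qed.

Let aeta : adapted T G eta.
Proof.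
have [_ aX1 _ _ _] := nX1; have [_ aX2 _ _ _] := nX2 => s s0 sT.
by apply: measurable_rVZ; apply: measurable_rVB; [exact: aX1|exact: aX2].
Qed.

Let bq i : bmf3 (q i).
Proof.
split; last first.
  exists (2 * dL * D) => z; rewrite /q; case: ifP => [zD|_].
    apply: le_trans (mx_entry_norm_le _ _ _) _; apply: le_trans (q1_bound _ _ _) _.
    by apply: ler_wpM2l => //; exact: (mulr_ge0 (ler0n R 2) dL0).
  by rewrite normr0; exact: (mulr_ge0 (mulr_ge0 (ler0n R 2) dL0) D0).
have m1 : measurable_fun setT (fun z : RR * (BV * BV) => z.1) by exact: measurable_fst.
have m2 : measurable_fun setT (fun z : RR * (BV * BV) => z.2.1).
  exact: (measurableT_comp measurable_fst measurable_snd).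
have m3 : measurable_fun setT (fun z : RR * (BV * BV) => z.2.2).
  exact: (measurableT_comp measurable_snd measurable_snd).
have mAz : measurable_fun setT (fun z : RR * (BV * BV) => A z.1 : BV).
  exact: (measurableT_comp mA m1).
have mb X x' (h : RR * (BV * BV) -> BV) : nice_solution P T G B f phi x' X ->
    measurable_fun setT h ->
    measurable_fun setT (fun z : RR * (BV * BV) => beta X z.1 (h z) : BV).
  move=> [mX _ _ iX _] mh.
  apply: (measurableT_comp (measurable_beta P cf cphi mX)
    (g := fun z : RR * (BV * BV) => (z.1, h z))).
  exact: measurable_fun_pair.
have myA : measurable_fun setT (fun z : RR * (BV * BV) => (z.2.1 : V) + A z.1 : BV).
  exact: measurable_rVD.
apply: measurable_fun_ifT.
- apply: measurable_fun_ler; last exact: measurable_cst.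
  exact: (measurableT_comp measurable_rV_norm m3).
- apply: (measurableT_comp (measurable_rV_coord i)).
  apply: measurable_rVB; apply: measurable_rVB.
  + by apply: (mb _ _ _ nX1); exact: measurable_rVD.
  + exact: (mb _ _ _ nX1).
  + exact: (mb _ _ _ nX2).
  + by apply: (mb _ _ _ nX2); exact: measurable_rVB.
- exact: measurable_cst.
Qed.

Let qE i s y v : `|v| <= D -> q i s y v = q1 s (y + A s) v ord0 i.
Proof. by rewrite /q => ->. Qed.

Let qM i (s : R) y v : 0 <= s -> s <= T -> `|v| <= D -> `|q i s y v| <= noiseK * delta.
Proof.
move=> _ _ vD; rewrite qE //; apply: le_trans (mx_entry_norm_le _ _ _) _.
apply: le_trans (q1_bound _ _ _) _.
have /andP[_ H] : 0 <= 2 * dL * LC <= noiseK by apply: noiseK_ge; rewrite !inE eqxx orbT.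
apply: le_trans (ler_wpM2r (normr_ge0 u) H).
rewrite -[leRHS]mulrA -/D; apply: ler_wpM2l => //; exact: (mulr_ge0 (ler0n R 2) dL0).
Qed.

Let qy i (s : R) y y' v : 0 <= s -> s <= T -> `|v| <= D ->
  `|q i s y v - q i s y' v| <= noiseK * `|y - y'|.
Proof.
move=> _ _ vD; rewrite !qE //.
rewrite rV_entryB.
apply: le_trans (mx_entry_norm_le _ _ _) _; apply: le_trans (q1_lip_l _ _ _ _) _.
have /andP[_ H] : 0 <= 4 * dL <= noiseK by apply: noiseK_ge; rewrite !inE eqxx.
have -> : y + A s - (y' + A s) = y - y' by move: (A s) => c; vring.
exact: ler_wpM2r.
Qed.

Let qu i (s : R) y v v' : 0 <= s -> s <= T -> `|v| <= D -> `|v'| <= D ->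
  `|q i s y v - q i s y v'| <= noiseK * `|v - v'|.
Proof.
move=> _ _ vD vD'; rewrite !qE //.
rewrite rV_entryB.
apply: le_trans (mx_entry_norm_le _ _ _) _; apply: le_trans (q1_lip_r _ _ _ _) _.
have /andP[_ H] : 0 <= 4 * dL <= noiseK by apply: noiseK_ge; rewrite !inE eqxx.
apply: ler_wpM2r => //; apply: le_trans H; apply: ler_wpM2r => //.
by rewrite ler_nat.
Qed.

Let heatqM i (s r v : R) y z : 0 <= s -> s <= T -> 0 <= r -> r < v -> v <= T ->
  `|z| <= D ->
  `|heat P B r v (fun y => q i s y z) y| <= noiseK * delta ^+ 2 / root4 (v - r).
Proof.
move=> _ _ r0 rv vT zD.
have rt : 0 <= (root4 (v - r))^-1 by rewrite invr_ge0 sqrtr_ge0.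
have := @heat_kick s r v y (A s) (A s - z) z i r0 rv vT.
have -> : A s - (A s - z) = z by move: (A s) => c; vring.
set lhs := `|_| => H.
have -> : `|heat P B r v (fun y => q i s y z) y| = lhs.
  congr `|_|; apply: eq_Rintegral => w _; move: (incr B r v w) => k.
  apply: etrans (qE _ _ _ zD) _.
  exact: (congr1 (fun v : V => v ord0 i)
    (kick_split (beta X1 s) (beta X2 s) (y + k) (A s) z)).
apply: le_trans H _; apply: ler_wpM2r => //.
have /andP[_ H] : 0 <= gaussC * d%:R * LC ^+ 2 * (2 * holderC L + compC L) <= noiseK.
  by apply: noiseK_ge; rewrite !inE eqxx !orbT.
apply: le_trans (ler_wpM2r (exprn_ge0 2 (normr_ge0 u)) H).
have g0 : 0 <= gaussC * d%:R :> R by rewrite mulr_ge0 // (le_trans _ gaussC_ge2).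
have cC := compC_ge0 L0; have hC := holderC_ge0 cf.
apply: (@le_trans _ _ (gaussC * d%:R * D * (holderC L * (2 * D) + compC L * D))).
  apply: ler_pM.
  - exact: mulr_ge0 g0 (normr_ge0 _).
  - exact: addr_ge0 (mulr_ge0 hC (mulr_ge0 (ler0n R 2) D0)) (mulr_ge0 cC (normr_ge0 _)).
  - exact: ler_wpM2l.
  - by rewrite lerD2l; exact: ler_wpM2l.
by rewrite /D le_eqVlt; apply/orP; left; apply/eqP; ring.
Qed.

Let heatqu i (s r v : R) y z z' : 0 <= s -> s <= T -> 0 <= r -> r < v -> v <= T ->
  `|z| <= D -> `|z'| <= D ->
  `|heat P B r v (fun y => q i s y z) y - heat P B r v (fun y => q i s y z') y|
    <= noiseK * delta * `|z - z'| / root4 (v - r).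
Proof.
move=> _ _ r0 rv vT zD zD'; have [hB _ _ _ _] := nB.
have rt : 0 <= (root4 (v - r))^-1 by rewrite invr_ge0 sqrtr_ge0.
have := @heat_kick s r v y (A s + z') (A s - z) (z - z') i r0 rv vT.
have -> : A s + z' - (A s - z) = z + z' by move: (A s) => c; vring.
set lhs := `|_| => H.
have bqz c : bmf (fun w => q i s (y + incr B r v w) c).
  apply: (bmf_comp (h := fun w => (s : RR, (y + incr B r v w : BV, c : BV))) _ (bq i)).
  apply: measurable_fun_pair; first exact: measurable_cst.
  apply: measurable_fun_pair; last exact: measurable_cst.
  apply: measurable_rVD; first exact: measurable_cst.
  by apply: (measurable_incr hB) => //; exact: ltW.
have -> : `|heat P B r v (fun y => q i s y z) y - heat P B r v (fun y => q i s y z') y| = lhs.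
  congr `|_|; rewrite /heat; apply: etrans (esym (bmf_intB P (bqz z) (bqz z'))) _.
  apply: eq_Rintegral => w _; move: (incr B r v w) => k.
  apply: etrans (congr2 (fun a b => a - b) (qE _ _ _ zD) (qE _ _ _ zD')) _.
  apply: etrans (rV_entryB _ _ _) _.
  exact: (congr1 (fun v : V => v ord0 i)
    (kick_difference (beta X1 s) (beta X2 s) (y + k) (A s) z z')).
apply: le_trans H _; apply: ler_wpM2r => //.
have /andP[_ H] : 0 <= 2 * gaussC * d%:R * LC * (holderC L + compC L) <= noiseK.
  by apply: noiseK_ge; rewrite !inE eqxx !orbT.
rewrite -(mulrA noiseK).
apply: le_trans (ler_wpM2r (mulr_ge0 (normr_ge0 u) (normr_ge0 (z - z'))) H).
have g0 : 0 <= gaussC * d%:R :> R by rewrite mulr_ge0 // (le_trans _ gaussC_ge2).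
have cC := compC_ge0 L0; have hC := holderC_ge0 cf.
apply: (@le_trans _ _ (gaussC * d%:R * `|z - z'| * (holderC L * (2 * D) + compC L * (D + D)))).
  apply: ler_wpM2l; first exact: mulr_ge0 g0 (normr_ge0 _).
  rewrite lerD2l; apply: ler_wpM2l => //.
  by apply: le_trans (ler_normD _ _) _; exact: lerD.
by rewrite /D le_eqVlt; apply/orP; left; apply/eqP; ring.
Qed.

Let xiK (r s : R) : 0 <= r -> r <= s -> s <= T ->
  (\int[P]_w (`|xi s w - xi r w - incr B r s w|)%:E <= (noiseK * (s - r))%:E)%E.
Proof.
move=> r0 rs sT; have [hB mB _ _ _] := nB.
have rT := le_trans rs sT; have s0 := le_trans r0 rs.
pose g (z : RR * Omega) := dL * `|X0 z.1 z.2 - X0 z.1 w0|.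
have mw0 : measurable_fun setT (fun s : RR => X0 s w0 : BV) by exact: jointly_measurable_path.
have mg0 : measurable_fun setT (fun z : RR * Omega => `|X0 z.1 z.2 - X0 z.1 w0|).
  apply: (measurableT_comp measurable_rV_norm); apply: measurable_rVB => //.
  exact: (measurableT_comp mw0 measurable_fst).
have mg : measurable_fun setT g by apply: measurable_funM => //; exact: measurable_cst.
have g0 z : 0 <= g z by exact: mulr_ge0 dL0 (normr_ge0 _).
have bg w : bmf (fun p : RR => g (p, w)).
  have [_ _ [_ pX] _ _] := nX0.
  split; first exact: (measurableT_comp mg (pair2_measurable _)).
  have [M XM] := pX w; have [M' XM'] := pX w0.
  exists (dL * (M + M')) => p; rewrite ger0_norm //; apply: ler_wpM2l => //.
  by apply: le_trans (ler_normB _ _) _; exact: lerD.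
have gE p : (\int[P]_w (g (p, w))%:E <= (dL * referenceC d T L R0)%:E)%E.
  under eq_integral do rewrite EFinM.
  rewrite ge0_integralZl //; last first.
    apply/measurable_EFinP; exact: (measurableT_comp mg0 (pair1_measurable _)).
  rewrite [leRHS]EFinM; apply: lee_wpmul2l; first by rewrite lee_fin.
  exact: (reference_bound T0 nB cf cphi w0R p nX0).
have /andP[rC H] : 0 <= dL * referenceC d T L R0 <= noiseK.
  by apply: noiseK_ge; rewrite !inE eqxx !orbT.
have := tonelli_bound rs rC mg g0 bg gE => H1.
have sr : 0 <= s - r by rewrite subr_ge0.
apply: le_trans (le_trans H1 _); last by rewrite lee_fin mulrC; exact: ler_wpM2r.
have mI : measurable_fun setT (fun w => \int[lebI r s]_p g (p, w)).
  rewrite /Rintegral; apply: (measurableT_comp (@fine_measurable _ _ measurableT)).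
  have := @measurable_fun_fubini_tonelli_G _ _ _ _ _ (lebI r s) (EFin \o g).
  by apply => //; exact/measurable_EFinP.
apply: ge0_le_integral => //.
- apply/measurable_EFinP; apply: (measurableT_comp measurable_rV_norm).
  apply: measurable_rVB; first apply: measurable_rVB.
  + exact: (jointly_measurable_slice s mxi).
  + exact: (jointly_measurable_slice r mxi).
  exact: (measurable_incr hB).
- exact/measurable_EFinP.
move=> w _; rewrite lee_fin.
have [bZ eZ] := nice_difference cf cphi w w0 nX0 nX0 (fun s y y' => nice_dist_self cf cphi s y y' nX0).
have -> : xi s w - xi r w - incr B r s w = \row_i \int[lebI r s]_p
    (beta X0 p (X0 p w) - beta X0 p (X0 p w0)) ord0 i.
  have E1 := eZ s s0 sT; have E2 := eZ r r0 rT.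
  apply/rowP => i; rewrite [RHS]mxE.
  have := lebI_int_split (bZ i) r0 rs => E3.
  have {}E3 : \int[lebI r s]_p (beta X0 p (X0 p w) - beta X0 p (X0 p w0)) ord0 i =
      \int[lebI 0 s]_p (beta X0 p (X0 p w) - beta X0 p (X0 p w0)) ord0 i -
      \int[lebI 0 r]_p (beta X0 p (X0 p w) - beta X0 p (X0 p w0)) ord0 i.
    by rewrite E3 addrAC subrr add0r.
  rewrite E3; move: (congr1 (fun v : V => v ord0 i) E1) (congr1 (fun v : V => v ord0 i) E2).
  rewrite subrr !add0r /xi /A /incr.
  move: (X0 s w) (X0 s w0) (X0 r w) (X0 r w0) (B s w) (B s w0) (B r w) (B r w0).
  move=> x1 x2 x3 x4 b1 b2 b3 b4.
  rewrite [((\row__ _) + _) ord0 i]mxE [(\row__ _) ord0 i]mxE.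
  rewrite [((\row__ _) + _) ord0 i]mxE [(\row__ _) ord0 i]mxE.
  move: (\int[_]_p _) (\int[_]_p _) => i1 i2.
  by rewrite !mxE; exact: increment_balance.
apply: lebI_row_bound => // p _ _.
by have := nice_dist_self cf cphi p (X0 p w) (X0 p w0) nX0; rewrite addr0.
Qed.

Let D20 s w : `|X2 s w - X0 s w| <= D.
Proof.
have := nice_lipschitz T0 nB cf cphi w0R nX2 nX0 s w.
by rewrite (addrC x) addrK normrN.
Qed.

Let gap12 s y y' : `|beta X1 s y - beta X2 s y'| <= dL * `|y - y'| + L * (L * (2 * D)).
Proof.
apply: le_trans (beta_dist cf cphi iX1 iX2 (iD12 s) y y') _.
by rewrite lerD2l !ler_wpM2l.
Qed.

Let etaK (r s : R) w : 0 <= r -> r <= s -> s <= T ->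
  `|eta s w - eta r w| <= noiseK * delta * (s - r).
Proof.
move=> r0 rs sT; have rT := le_trans rs sT; have s0 := le_trans r0 rs.
have [bZ eZ] := nice_difference cf cphi w w nX1 nX2 gap12.
have sr : 0 <= s - r by rewrite subr_ge0.
have /andP[c0 H] : 0 <= (dL + L * L) * LC <= noiseK.
  by apply: noiseK_ge; rewrite !inE eqxx !orbT.
have -> : eta s w - eta r w =
    2^-1 *: \row_i \int[lebI r s]_p (beta X1 p (X1 p w) - beta X2 p (X2 p w)) ord0 i.
  apply: etrans (esym (scalerBr _ _ _)) _; congr (2^-1 *: _).
  apply: etrans (congr2 (fun a b => a - b) (eZ s s0 sT) (eZ r r0 rT)) _.
  rewrite (@row_int_split _ _ (fun p => beta X1 p (X1 p w) - beta X2 p (X2 p w)) _ _ _ bZ r0 rs).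
  exact: cancel_increment.
rewrite normrZ ger0_norm ?invr_ge0 // mulrC ler_pdivrMr //.
have M0 : 0 <= dL * (2 * D) + L * (L * (2 * D)).
  have DD : 0 <= 2 * D := mulr_ge0 (ler0n R 2) D0.
  exact: addr_ge0 (mulr_ge0 dL0 DD) (mulr_ge0 L0 (mulr_ge0 L0 DD)).
apply: (@le_trans _ _ ((s - r) * (dL * (2 * D) + L * (L * (2 * D))))).
  apply: rV_norm_le => [|i]; first exact: mulr_ge0.
  rewrite mxE; apply: lebI_int_norm => // p _ _; apply: le_trans (mx_entry_norm_le _ _ _) _.
  by apply: le_trans (gap12 _ _ _) _; rewrite lerD2r; exact: ler_wpM2l.
have -> : (s - r) * (dL * (2 * D) + L * (L * (2 * D))) = (dL + L * L) * LC * (delta * (s - r) * 2).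
  by rewrite /D; ring.
have dsr : 0 <= delta * (s - r) * 2 by rewrite !mulr_ge0.
apply: le_trans (ler_wpM2r dsr H) _.
by rewrite le_eqVlt; apply/orP; left; apply/eqP; ring.
Qed.

Let noise_bound i t : 0 <= t -> t <= T ->
  \int[P]_w `|\int[lebI 0 t]_s q i s (xi s w) (eta s w)| <= noiseC d T noiseK * delta ^+ 2.
Proof.
move=> t0 tT; have [hB mB _ _ _] := nB.
exact: (noise_averaging hB mB mxi meta axi aeta noiseK_ge0 u0 u1 T0 (bq i)
  (fun s w _ _ => etaD s w) (@qM i) (@qy i) (@qu i) (@heatqM i) (@heatqu i) xiK etaK t0 tT).
Qed.

Let S s w : V := X1 s w + X2 s w - X0 s w - X0 s w.

Let SE s w : S s w = (X1 s w - X0 s w) + (X2 s w - X0 s w).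
Proof. by rewrite /S; move: (X1 s w) (X2 s w) (X0 s w) => a1 a2 a3; vring. Qed.

Let bSz : bmf (fun z : RR * Omega => `|S z.1 z.2|).
Proof.
split.
  apply: (measurableT_comp measurable_rV_norm); apply: measurable_rVB => //.
  by apply: measurable_rVB => //; exact: measurable_rVD.
exists (D + D) => z; rewrite normr_id SE.
by apply: le_trans (ler_normD _ _) _; exact: lerD.
Qed.

Let bSw s : bmf (fun w => `|S s w|).
Proof. by apply: (bmf_comp (h := fun w => (s : RR, w)) (pair1_measurable _) bSz). Qed.

Let bSs w : bmf (fun s : RR => `|S s w|).
Proof. by apply: (bmf_comp (h := fun s => (s : RR, w)) (pair2_measurable _) bSz). Qed.

Let h (s : RR) := \int[P]_w `|S s w|.

Let h0 s : 0 <= h s. Proof. exact: Rintegral_ge0. Qed.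

Let bh : bmf h.
Proof. by have := bmf_int_inner (@dirac _ RR point R) P bSz. Qed.

Let rem := L * L * D ^+ 2 + L * (L * D) ^+ 2.

Let rem0 : 0 <= rem.
Proof.
exact: addr_ge0 (mulr_ge0 (mulr_ge0 L0 L0) (exprn_ge0 2 D0))
  (mulr_ge0 L0 (exprn_ge0 2 (mulr_ge0 L0 D0))).
Qed.

Let Z s w : V := (beta X1 s (X1 s w) - beta X0 s (X0 s w))
  + (beta X2 s (X2 s w) - beta X0 s (X0 s w)).
Let W s w : V := Z s w - q1 s (X0 s w) (eta s w).

Let WE s w : `|W s w| <= dL * `|S s w| + (L * L * h s + rem).
Proof.
pose y := X0 s w; pose e := eta s w.
have Y1 : X1 s w - (y + e) = 2^-1 *: S s w.
  rewrite /e /eta /y /S; move: (X1 s w) (X2 s w) (X0 s w) => a1 a2 a3.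
  by apply/rowP => i; rewrite !mxE; field.
have Y2 : X2 s w - (y - e) = 2^-1 *: S s w.
  rewrite /e /eta /y /S; move: (X1 s w) (X2 s w) (X0 s w) => a1 a2 a3.
  by apply/rowP => i; rewrite !mxE; field.
have H1 := beta_lip cf cphi iX1 s (X1 s w) (y + e).
have H2 := beta_lip cf cphi iX2 s (X2 s w) (y - e).
rewrite Y1 normrZ ger0_norm ?invr_ge0 // in H1.
rewrite Y2 normrZ ger0_norm ?invr_ge0 // in H2.
have iD : P.-integrable setT (fun w => (`|X1 s w - X0 s w|)%:E).
  exact: (distance_integrable T0 nB cf cphi w0R nX1 nX0 s).
have H3 := beta_second_difference cf cphi y iX1 iX2 iX0 (bSw s) (D10 s) iD.
have -> : W s w = (beta X1 s (X1 s w) - beta X1 s (y + e)) +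
    (beta X2 s (X2 s w) - beta X2 s (y - e)) +
    (beta X1 s y + beta X2 s y - beta X0 s y - beta X0 s y).
  rewrite /W /Z /q1 -/y -/e; move: (beta X1 s) (beta X2 s) (beta X0 s) => c1 c2 c0.
  move: (c1 _) (c1 _) (c1 _) (c2 _) (c2 _) (c2 _) (c0 _) => a1 a2 a3 a4 a5 a6 a7.
  by vring.
apply: le_trans (ler_normD _ _) _; apply: le_trans (lerD (ler_normD _ _) (lexx _)) _.
apply: le_trans (lerD (lerD H1 H2) H3) _.
rewrite -/(S s _) -/(h s) /rem le_eqVlt; apply/orP; left; apply/eqP.
by field.
Qed.

Let bq_path i w : bmf (fun s : RR => q i s (xi s w) (eta s w)).
Proof.
apply: (bmf_comp (h := fun s : RR => (s, (xi s w : BV, eta s w : BV))) _ (bq i)).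
apply: measurable_fun_pair; first exact: measurable_id.
by apply: measurable_fun_pair; exact: jointly_measurable_path.
Qed.

Let gap10 s y y' : `|beta X1 s y - beta X0 s y'| <= dL * `|y - y'| + L * (L * D).
Proof.
have iD : P.-integrable setT (fun w => (`|X1 s w - X0 s w|)%:E).
  exact: (distance_integrable T0 nB cf cphi w0R nX1 nX0).
apply: le_trans (beta_dist cf cphi iX1 iX0 iD y y') _.
rewrite lerD2l !ler_wpM2l // -[leRHS](int_prob_cst P D).
apply: (le_Rintegral measurableT) => //; exact: bmf_integrable (bmf_cst D).
Qed.

Let gap20 s y y' : `|beta X2 s y - beta X0 s y'| <= dL * `|y - y'| + L * (L * D).
Proof.
have iD : P.-integrable setT (fun w => (`|X2 s w - X0 s w|)%:E).
  exact: (distance_integrable T0 nB cf cphi w0R nX2 nX0).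
apply: le_trans (beta_dist cf cphi iX2 iX0 iD y y') _.
rewrite lerD2l !ler_wpM2l // -[leRHS](int_prob_cst P D).
apply: (le_Rintegral measurableT) => //; exact: bmf_integrable (bmf_cst D).
Qed.

Let bZ w i : bmf (fun s : RR => Z s w ord0 i).
Proof.
have [b1 _] := nice_difference cf cphi w w nX1 nX0 gap10.
have [b2 _] := nice_difference cf cphi w w nX2 nX0 gap20.
rewrite (_ : (fun s => Z s w ord0 i) =
    (fun s => (beta X1 s (X1 s w) - beta X0 s (X0 s w)) ord0 i
      + (beta X2 s (X2 s w) - beta X0 s (X0 s w)) ord0 i)); first exact: bmfD.
by apply/funext => s; rewrite /Z [LHS]mxE.
Qed.

Let S_path t w i : 0 <= t -> t <= T -> S t w ord0 i = \int[lebI 0 t]_s Z s w ord0 i.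
Proof.
move=> t0 tT.
have [b1 e1] := nice_difference cf cphi w w nX1 nX0 gap10.
have [b2 e2] := nice_difference cf cphi w w nX2 nX0 gap20.
have E : S t w = \row_i (\int[lebI 0 t]_s (beta X1 s (X1 s w) - beta X0 s (X0 s w)) ord0 i)
    + \row_i \int[lebI 0 t]_s (beta X2 s (X2 s w) - beta X0 s (X0 s w)) ord0 i.
  apply: etrans (SE t w) _; apply: etrans (congr2 +%R (e1 t t0 tT) (e2 t t0 tT)) _.
  exact: cancel_second_difference.
apply: etrans (congr1 (fun v : V => v ord0 i) E) _.
apply: etrans (rV_entryD _ _ _) _.
apply: etrans (congr2 +%R (row_entry _ _) (row_entry _ _)) _.
apply: etrans (esym (bmf_intD _ (b1 i) (b2 i))) _.
by apply: eq_Rintegral => s _; exact: esym (rV_entryD _ _ _).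
Qed.

Let Z_split s w i : Z s w ord0 i = q i s (xi s w) (eta s w) + W s w ord0 i.
Proof.
rewrite qE ?etaD // /xi subrK -rV_entryD; congr (fun_of_matrix _ ord0 i).
by rewrite /W addrC subrK.
Qed.

Let bW w i : bmf (fun s : RR => W s w ord0 i).
Proof.
have := bmfB (bZ w i) (bq_path i w); congr bmf; apply/funext => s.
by rewrite Z_split addrAC subrr add0r.
Qed.

Let growth s w := dL * `|S s w| + (L * L * h s + rem).

Let bgrowth_s w : bmf (fun s : RR => growth s w).
Proof.
apply: bmfD; first exact: bmfM (bmf_cst _) (bSs w).
by apply: bmfD; [exact: bmfM (bmf_cst _) bh|exact: bmf_cst].
Qed.

Let growth0 s w : 0 <= growth s w.
Proof.
exact: addr_ge0 (mulr_ge0 dL0 (normr_ge0 _)) (addr_ge0 (mulr_ge0 (mulr_ge0 L0 L0) (h0 s)) rem0).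
Qed.

Let N t w := \sum_(i < d) `|\int[lebI 0 t]_s q i s (xi s w) (eta s w)|.

Let S_bound t w : 0 <= t -> t <= T ->
  `|S t w| <= N t w + \int[lebI 0 t]_s growth s w.
Proof.
move=> t0 tT; have I0 : 0 <= \int[lebI 0 t]_s growth s w by exact: Rintegral_ge0.
have N0 : 0 <= N t w by exact: sumr_ge0.
apply: rV_norm_le => [|i]; first exact: addr_ge0.
rewrite S_path //; under eq_Rintegral do rewrite Z_split.
rewrite (bmf_intD _ (bq_path i w) (bW w i)).
apply: le_trans (ler_normD _ _) _; apply: lerD.
  by rewrite /N (bigD1 i) //= lerDl sumr_ge0.
apply: lebI_int_bound => // s _ _.
by apply: le_trans (WE s w); exact: mx_entry_norm_le.
Qed.

Let bN i t : bmf (fun w => `|\int[lebI 0 t]_s q i s (xi s w) (eta s w)|).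
Proof.
apply: bmf_norm; apply: (bmf_int_inner P (lebI 0 t)
  (f := fun z : Omega * RR => q i z.2 (xi z.2 z.1) (eta z.2 z.1))).
apply: (bmf_comp (h := fun z : Omega * RR => (z.2, (xi z.2 z.1 : BV, eta z.2 z.1 : BV))) _ (bq i)).
apply: measurable_fun_pair; first exact: measurable_snd.
have sw (Y : R -> Omega -> V) : jointly_measurable Y ->
    measurable_fun setT (fun z : Omega * RR => Y z.2 z.1 : BV).
  move=> mY; apply: (measurableT_comp mY (g := fun z : Omega * RR => (z.2, z.1))).
  exact: measurable_swap.
by apply: measurable_fun_pair; exact: sw.
Qed.

Let S_clamp s w : S s w = S (clamp T s) w.
Proof.
have [_ _ [c0 _] _ _] := nX0; have [_ _ [c1 _] _ _] := nX1; have [_ _ [c2 _] _ _] := nX2.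
by rewrite /S c0 c1 c2.
Qed.

Definition remainderC : R := L * L * LC ^+ 2 + L * (L * LC) ^+ 2.

Let remE : rem = remainderC * delta ^+ 2.
Proof. by rewrite /rem /remainderC /D; ring. Qed.

Let remainderC0 : 0 <= remainderC.
Proof.
exact: addr_ge0 (mulr_ge0 (mulr_ge0 L0 L0) (exprn_ge0 2 LC0))
  (mulr_ge0 L0 (exprn_ge0 2 (mulr_ge0 L0 LC0))).
Qed.

Definition meanC : R :=
  gronwallC (dL + L * L) T * (d%:R * noiseC d T noiseK + T * remainderC).

Lemma mean_second_difference s :
  \int[P]_w `|X1 s w + X2 s w - X0 s w - X0 s w| <= meanC * delta ^+ 2.
Proof.
have -> : \int[P]_w `|X1 s w + X2 s w - X0 s w - X0 s w| = h (clamp T s).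
  by apply: eq_Rintegral => w _; rewrite -/(S s w) S_clamp.
have /andP[] := clamp_itv s (ltW T0); move: (clamp T s) => t t0 tT.
have LL : 0 <= dL + L * L := addr_ge0 dL0 (mulr_ge0 L0 L0).
pose al := (d%:R * noiseC d T noiseK + T * remainderC) * delta ^+ 2.
have al0 : 0 <= al.
  rewrite /al mulrDl; apply: addr_ge0; last first.
    exact: mulr_ge0 (mulr_ge0 (ltW T0) remainderC0) (exprn_ge0 2 (normr_ge0 u)).
  rewrite -mulrA; case: (leqP 1 d) => d0; last first.
    have -> : d%:R = 0 :> R by move: d0; rewrite ltnS leqn0 => /eqP ->.
    by rewrite mul0r.
  apply: mulr_ge0 => //; apply: le_trans (noise_bound (Ordinal d0) (lexx 0) (ltW T0)).
  exact: Rintegral_ge0.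
rewrite /meanC -(mulrA (gronwallC _ _)) -/al.
apply: (gronwall bh LL al0) t0 tT => r r0 rT.
have bI : bmf (fun z : Omega * RR => growth z.2 z.1).
  apply: bmfD.
    apply: (bmfM (bmf_cst _)).
    apply: (bmf_comp (h := fun z : Omega * RR => (z.2, z.1)) _ bSz); exact: measurable_swap.
  apply: bmfD; last exact: bmf_cst.
  apply: (bmfM (bmf_cst _)).
  exact: (bmf_comp (h := fun z : Omega * RR => z.2) measurable_snd bh).
have bIw : bmf (fun w => \int[lebI 0 r]_q growth q w) by exact: (bmf_int_inner P (lebI 0 r) bI).
have bNr : bmf (N r) by exact: bmf_sum.
apply: (@le_trans _ _ (\int[P]_w (N r w + \int[lebI 0 r]_q growth q w))).
  apply: bmf_int_le => //; first exact: bmfD.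
  by move=> w; exact: S_bound.
rewrite (bmf_intD P bNr bIw) (bmf_Fubini P (lebI 0 r) bI) /=.
have H1 : \int[P]_w N r w <= d%:R * (noiseC d T noiseK * delta ^+ 2).
  rewrite /N (bmf_int_sum P _ (fun i => bN i r)).
  apply: (@le_trans _ _ (\sum_(i < d) (noiseC d T noiseK * delta ^+ 2))).
    by apply: ler_sum => i _; exact: noise_bound.
  by rewrite sumr_const card_ord -[leLHS]mulr_natl.
have bLh : bmf (fun q : RR => (dL + L * L) * h q) by exact: bmfM (bmf_cst _) bh.
have H2 : \int[lebI 0 r]_q (\int[P]_w growth q w) =
    (dL + L * L) * \int[lebI 0 r]_q h q + r * rem.
  rewrite -(bmf_intZ _ (dL + L * L) bh).
  have -> : r * rem = \int[lebI 0 r]_q rem by rewrite lebI_int_cst // subr0.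
  apply: etrans (bmf_intD _ bLh (bmf_cst rem)).
  apply: eq_Rintegral => p _; rewrite /growth.
  have bp : bmf (fun w => dL * `|S p w|) by exact: bmfM (bmf_cst _) (bSw p).
  rewrite (bmf_intD P bp (bmf_cst (L * L * h p + rem))) (bmf_intZ P dL (bSw p)).
  by rewrite (int_prob_cst P (L * L * h p + rem)) mulrDl addrA.
apply: le_trans (lerD H1 (lexx _)) _; rewrite H2 addrA [leLHS]addrAC.
apply: lerD; last exact: lexx.
rewrite /al [leRHS]mulrDl -!mulrA lerD2l remE.
by apply: ler_wpM2r => //; exact: mulr_ge0 remainderC0 (exprn_ge0 2 (normr_ge0 u)).
Qed.

Definition sureC : R := gronwallC dL T * (T * ((2 * holderC L + compC L) * (LC * Num.sqrt LC)
  + (L * L * meanC + remainderC))).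

Lemma sure_second_difference s w :
  `|X1 s w + X2 s w - X0 s w - X0 s w| <= sureC * (delta * Num.sqrt delta).
Proof.
rewrite -/(S s w) S_clamp.
have /andP[] := clamp_itv s (ltW T0); move: (clamp T s) => t t0 tT.
have T0' := ltW T0.
pose e := delta * Num.sqrt delta.
have e0 : 0 <= e by rewrite mulr_ge0 ?sqrtr_ge0.
have de : delta ^+ 2 <= e.
  rewrite expr2; apply: ler_wpM2l => //.
  rewrite -[leLHS]ger0_norm // -sqrtr_sqr ler_wsqrtr // expr2.
  by rewrite -[leRHS]mulr1; exact: ler_wpM2l.
pose Q := (2 * holderC L + compC L) * (LC * Num.sqrt LC).
have Q0 : 0 <= Q.
  apply: mulr_ge0; last exact: mulr_ge0 LC0 (sqrtr_ge0 _).
  exact: addr_ge0 (mulr_ge0 (ler0n R 2) (holderC_ge0 cf)) (compC_ge0 L0).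
have hm r : h r <= meanC * delta ^+ 2 by exact: mean_second_difference.
have m0 : 0 <= meanC * delta ^+ 2 by exact: le_trans (h0 0) (hm 0).
have meanC0 : 0 <= meanC by move: m0; rewrite pmulr_lge0 // exprn_gt0.
pose c := Q + (L * L * meanC + remainderC).
have c0 : 0 <= c.
  exact: addr_ge0 Q0 (addr_ge0 (mulr_ge0 (mulr_ge0 L0 L0) meanC0) remainderC0).
have al0 : 0 <= T * c * e by exact: mulr_ge0 (mulr_ge0 T0' c0) e0.
rewrite /sureC -(mulrA (gronwallC _ _)) -/Q -/c -/e.
apply: (gronwall (bSs w) dL0 al0) t0 tT => r r0 rT.
apply: rV_norm_le => [|i].
  apply: addr_ge0 al0 (mulr_ge0 dL0 _); exact: Rintegral_ge0.
rewrite S_path //.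
have bdS : bmf (fun s : RR => dL * `|S s w|) by exact: bmfM (bmf_cst _) (bSs w).
apply: (@le_trans _ _ (\int[lebI 0 r]_q (c * e + dL * `|S q w|))).
  apply: lebI_int_bound => //; first by apply: bmfD => //; exact: bmf_cst.
  move=> q0 _ _; rewrite Z_split; apply: le_trans (ler_normD _ _) _.
  have H1 : `|q i q0 (xi q0 w) (eta q0 w)| <= Q * e.
    rewrite qE ?etaD //; apply: le_trans (mx_entry_norm_le _ _ _) _.
    by apply: q1_holder; exact: etaD.
  have H2 := le_trans (mx_entry_norm_le (W q0 w) ord0 i) (WE q0 w).
  apply: le_trans (lerD H1 H2) _; rewrite addrCA addrC; apply: lerD => //.
  rewrite /c mulrDl lerD2l mulrDl; apply: lerD.
    rewrite -(mulrA (L * L)); apply: ler_wpM2l; first exact: mulr_ge0.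
    by apply: le_trans (hm q0) _; exact: ler_wpM2l.
  by rewrite remE; exact: ler_wpM2l.
rewrite (bmf_intD _ (bmf_cst (c * e)) bdS) (bmf_intZ _ dL (bSs w)) lebI_int_cst // subr0.
rewrite lerD2r -(mulrA T); apply: ler_wpM2r => //; exact: mulr_ge0.
Qed.

End second_differences.

(** * Maps with second differences of order 3/2 *)

Section geometric_limits.
Context {R : realType}.
Implicit Types (r K c : R) (b : nat -> R).

Lemma geometric_squeeze r c (a : R) : 0 <= r -> r < 1 ->
  (forall n, a <= c * r ^+ n) -> a <= 0.
Proof.
move=> r0 r1 H.
have h : c * r ^+ n @[n --> \oo] --> (0 : R).
  have := @cvg_geometric R c r _; rewrite ger0_norm //; exact.
rewrite leNgt; apply/negP => a0.
move/cvgrPdist_lt: h => /(_ _ a0) [N _ /(_ N (leqnn N)) /=].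
by rewrite sub0r normrN ltNge => /negP; apply; apply: le_trans (H N) (ler_norm _).
Qed.

(* Adding and subtracting the geometric tail makes the sequence monotone, so a
   supremum provides the limit together with its rate. *)
Lemma geometric_limit b r K : 0 <= r -> r < 1 -> 0 <= K ->
  (forall n, `|b n.+1 - b n| <= K * r ^+ n) ->
  exists l, forall n, `|b n - l| <= K / (1 - r) * r ^+ n.
Proof.
move=> r0 r1 K0 H; have r1' : 0 < 1 - r by rewrite subr_gt0.
pose E n := K / (1 - r) * r ^+ n.
have E0 n : 0 <= E n by rewrite mulr_ge0 ?divr_ge0 ?exprn_ge0 // ltW.
have ES n : E n.+1 = E n - K * r ^+ n.
  by rewrite /E exprS; field; rewrite gt_eqF.
have lo n m : b n - E n <= b (n + m)%N - E (n + m)%N.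
  elim: m => [|m IH]; first by rewrite addn0.
  apply: le_trans IH _; rewrite addnS ES.
  by have := H (n + m)%N; rewrite ler_norml => /andP[H1 _]; lra.
have hi n m : b (n + m)%N + E (n + m)%N <= b n + E n.
  elim: m => [|m IH]; first by rewrite addn0.
  apply: le_trans IH; rewrite addnS ES.
  by have := H (n + m)%N; rewrite ler_norml => /andP[_ H1]; lra.
have lohi n m : b n - E n <= b m + E m.
  apply: le_trans (lo n m) _; rewrite addnC; apply: le_trans (hi m n).
  by rewrite lerD2l; have := E0 (m + n)%N; lra.
pose A := [set b n - E n | n in [set: nat]].
have A0 : A !=set0 by exists (b 0%N - E 0%N); exists 0%N.
have As : has_sup A.
  by split => //; exists (b 0%N + E 0%N) => _ [n _ <-]; exact: lohi.
exists (sup A) => n; rewrite ler_norml; apply/andP; split.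
  have : sup A <= b n + E n by apply: ge_sup => // _ [m _ <-]; exact: lohi.
  by rewrite -/(E n); lra.
have : b n - E n <= sup A by apply: sup_upper_bound => //; exists n.
by rewrite -/(E n); lra.
Qed.

End geometric_limits.

Section zygmund.
Context {R : realType} {d : nat}.
Local Notation V := 'rV[R]_d.
Variables (F : V -> V) (L C : R).
Hypotheses (L0 : 0 <= L) (C0 : 0 <= C).
Hypothesis FL : forall x v, `|F (x + v) - F x| <= L * `|v|.
Hypothesis FC : forall x v,
  `|F (x + v) + F (x - v) - F x - F x| <= C * (`|v| * Num.sqrt `|v|).

Let r : R := Num.sqrt 2^-1.

Let r0 : 0 <= r. Proof. exact: sqrtr_ge0. Qed.

Let r1 : r < 1.
Proof. by rewrite -[ltRHS]sqrtr1 ltr_sqrt // invf_lt1 // ltr1n. Qed.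

Let sqrt_dyadic n (h : R) : 0 <= h -> Num.sqrt (2 ^- n * h) = r ^+ n * Num.sqrt h.
Proof.
move=> h0; rewrite sqrtrM ?invr_ge0 ?exprn_ge0 //; congr (_ * _).
elim: n => [|n IH]; first by rewrite expr0 invr1 sqrtr1.
by rewrite exprS invfM sqrtrM ?invr_ge0 // IH -exprS.
Qed.

Let a n x v : V := 2 ^+ n *: (F (x + 2 ^- n *: v) - F x).

Let a_step n x v : `|a n.+1 x v - a n x v| <= C * (`|v| * Num.sqrt `|v|) * r ^+ n.
Proof.
pose k : V := 2 ^- n.+1 *: v.
have e : 2 ^- n *: v = k + k.
  rewrite /k -scalerDl; congr (_ *: _); rewrite exprS; field.
  by rewrite expf_neq0.
have -> : a n.+1 x v - a n x v =
    - (2 ^+ n *: (F (x + k + k) + F (x + k - k) - F (x + k) - F (x + k))).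
  rewrite /a e -/k addrK (addrA x) exprS.
  move: (F _) (F _) (F x) => f1 f2 f3; move: (2 ^+ n) => p.
  by apply/rowP => i; rewrite !mxE; ring.
have kn : `|k| = 2 ^- n.+1 * `|v|.
  by rewrite /k normrZ ger0_norm // invr_ge0 exprn_ge0.
have p0 : 0 <= 2 ^+ n :> R by rewrite exprn_ge0.
rewrite normrN normrZ ger0_norm //.
apply: le_trans (ler_wpM2l p0 (FC (x + k) k)) _.
rewrite kn sqrt_dyadic // exprS (exprS r).
have -> : 2 ^+ n * (C * ((2 * 2 ^+ n)^-1 * `|v| * (r * r ^+ n * Num.sqrt `|v|))) =
    (2^-1 * r) * (C * (`|v| * Num.sqrt `|v|) * r ^+ n).
  by field; rewrite expf_neq0.
rewrite -[leRHS]mul1r; apply: ler_wpM2r.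
  by rewrite !mulr_ge0 ?sqrtr_ge0 ?exprn_ge0.
by have := r0; have := r1; lra.
Qed.

Let K := C / (1 - r).

Let K0 : 0 <= K. Proof. by rewrite divr_ge0 // subr_ge0 ltW. Qed.

Let D_exists : exists D : V -> V -> V, forall x v n,
  `|a n x v - D x v| <= K * (`|v| * Num.sqrt `|v|) * r ^+ n.
Proof.
have H x v i : exists l, forall n,
    `|a n x v ord0 i - l| <= K * (`|v| * Num.sqrt `|v|) * r ^+ n.
  have c0 : 0 <= C * (`|v| * Num.sqrt `|v|) by rewrite !mulr_ge0 ?sqrtr_ge0.
  have [|l Hl] := @geometric_limit R (fun n => a n x v ord0 i) r _ r0 r1 c0.
    move=> n; apply: le_trans (a_step n x v).
    have -> : a n.+1 x v ord0 i - a n x v ord0 i = (a n.+1 x v - a n x v) ord0 i.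
      by move: (a n.+1 x v) (a n x v) => p q; rewrite !mxE.
    exact: mx_entry_norm_le.
  exists l => n; apply: le_trans (Hl n) _.
  by rewrite /K (mulrAC C).
pose c x v i := projT1 (cid (H x v i)).
exists (fun x v => \row_i c x v i) => x v n.
apply: rV_norm_le => [|i].
  exact: mulr_ge0 (mulr_ge0 K0 (mulr_ge0 (normr_ge0 _) (sqrtr_ge0 _))) (exprn_ge0 _ r0).
have := projT2 (cid (H x v i)) n; rewrite -/(c x v i).
by move: (a n x v) => p; rewrite !mxE.
Qed.

Let s32 (s : R) := s * Num.sqrt s.

Let s32_mono s t : 0 <= s -> s <= t -> s32 s <= s32 t.
Proof. by move=> s0 st; rewrite /s32 ler_pM ?sqrtr_ge0 // ler_wsqrtr. Qed.

Let mixed x v w s : `|v| + `|w| <= s ->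
  `|F (x + v + w) - F (x + v) - F (x + w) + F x| <= 2 * C * s32 s.
Proof.
move=> vw; pose p := 2^-1 *: (v + w); pose m := 2^-1 *: (v - w).
pose c := x + p.
have e1 : x + v + w = c + p by rewrite /c /p; apply/rowP => i; rewrite !mxE; field.
have e2 : x = c - p by rewrite /c /p; apply/rowP => i; rewrite !mxE; field.
have e3 : x + v = c + m by rewrite /c /p /m; apply/rowP => i; rewrite !mxE; field.
have e4 : x + w = c - m by rewrite /c /p /m; apply/rowP => i; rewrite !mxE; field.
have s0 : 0 <= s by apply: le_trans vw; rewrite addr_ge0.
have half (z : V) : `|z| <= s -> s32 `|2^-1 *: z| <= s32 s.
  move=> zs; apply: s32_mono => //; rewrite normrZ ger0_norm ?invr_ge0 //.
  by rewrite ler_pdivrMl //; lra.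
have H1 := FC c p; have H2 := FC c m.
have {}H1 : `|F (c + p) + F (c - p) - F c - F c| <= C * s32 s.
  apply: le_trans H1 _; rewrite ler_wpM2l //; apply: half.
  exact: le_trans (ler_normD _ _) vw.
have {}H2 : `|F (c + m) + F (c - m) - F c - F c| <= C * s32 s.
  apply: le_trans H2 _; rewrite ler_wpM2l //; apply: half.
  exact: le_trans (ler_normB _ _) vw.
rewrite e1 e3 e4 [in F x]e2.
have -> : F (c + p) - F (c + m) - F (c - m) + F (c - p) =
   (F (c + p) + F (c - p) - F c - F c) - (F (c + m) + F (c - m) - F c - F c).
  by move: (F _) (F _) (F _) (F _) (F _) => f1 f2 f3 f4 f5; vring.
apply: le_trans (ler_normB _ _) _; apply: le_trans (lerD H1 H2) _.
by rewrite le_eqVlt; apply/orP; left; apply/eqP; ring.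
Qed.

Section derivative.
Variable D : V -> V -> V.
Hypothesis aD : forall x v n,
  `|a n x v - D x v| <= K * (`|v| * Num.sqrt `|v|) * r ^+ n.

Let taylor x v : `|F (x + v) - F x - D x v| <= K * s32 `|v|.
Proof.
have := aD x v 0; rewrite /a expr0 mulr1 invr1 !scale1r; exact.
Qed.

Let D_bound x v : `|D x v| <= L * `|v|.
Proof.
rewrite -subr_le0; apply: (@geometric_squeeze _ r (K * s32 `|v|) _ r0 r1) => n.
have p0 : 0 < 2 ^+ n :> R by rewrite exprn_gt0.
have H : `|a n x v| <= L * `|v|.
  rewrite /a normrZ ger0_norm ?(ltW p0) // -ler_pdivlMl //.
  apply: le_trans (FL _ _) _; rewrite normrZ ger0_norm ?invr_ge0 ?(ltW p0) //.
  by rewrite mulrCA.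
have := aD x v n; rewrite -/(s32 _) distrC => H1.
rewrite lerBlDl -(subrK (a n x v) (D x v)) addrC.
by apply: le_trans (ler_normD _ _) _; exact: lerD.
Qed.

Let D_half x v : D x (2^-1 *: v) = 2^-1 *: D x v.
Proof.
apply/eqP; rewrite -subr_eq0 -normr_le0.
apply: (@geometric_squeeze _ r (2 * (K * s32 `|v|)) _ r0 r1) => n.
have e : a n x (2^-1 *: v) = 2^-1 *: a n.+1 x v.
  rewrite /a !scalerA exprS mulrA mulVf // mul1r; congr (_ *: (F (x + _) - _)).
  by rewrite invfM mulrC.
have H1 := aD x (2^-1 *: v) n; have H2 := aD x v n.+1.
rewrite e -/(s32 _) in H1; rewrite -/(s32 _) in H2.
have K1 : 0 <= K * s32 `|v| * r ^+ n.
  exact: mulr_ge0 (mulr_ge0 K0 (mulr_ge0 (normr_ge0 _) (sqrtr_ge0 _))) (exprn_ge0 _ r0).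
have H1' : `|2^-1 *: a n.+1 x v - D x (2^-1 *: v)| <= K * s32 `|v| * r ^+ n.
  apply: le_trans H1 _; apply: ler_wpM2r; first exact: exprn_ge0.
  apply: ler_wpM2l => //; apply: s32_mono => //.
  by rewrite normrZ ger0_norm ?invr_ge0 // ler_pdivrMl //; have := normr_ge0 v; lra.
have H2' : `|2^-1 *: (a n.+1 x v - D x v)| <= K * s32 `|v| * r ^+ n.
  rewrite normrZ ger0_norm ?invr_ge0 // ler_pdivrMl //; apply: le_trans H2 _.
  rewrite exprS mulrCA; have : r * (K * s32 `|v| * r ^+ n) <= 1 * (K * s32 `|v| * r ^+ n).
    by apply: ler_wpM2r => //; exact: ltW r1.
  lra.
have -> : D x (2^-1 *: v) - 2^-1 *: D x v =
    2^-1 *: (a n.+1 x v - D x v) - (2^-1 *: a n.+1 x v - D x (2^-1 *: v)).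
  move: (a _ _ _) (D x v) (D x _) => p q q'.
  by apply/rowP => i; rewrite !mxE; ring.
by apply: le_trans (ler_normB _ _) _; rewrite -mulrA; lra.
Qed.

Let D_dyadic n x v : D x (2 ^- n *: v) = 2 ^- n *: D x v.
Proof.
elim: n => [|n IH]; first by rewrite expr0 invr1 !scale1r.
by rewrite exprS invfM -!scalerA D_half IH.
Qed.

Let D_add x v w : D x (v + w) = D x v + D x w.
Proof.
apply/eqP; rewrite -subr_eq0 -normr_le0.
pose s := `|v| + `|w|; have s0 : 0 <= s by rewrite addr_ge0.
have main (v' w' : V) s' : `|v'| + `|w'| <= s' ->
    `|D x (v' + w') - (D x v' + D x w')| <= (3 * K + 2 * C) * s32 s'.
  move=> vw; have nv := normr_ge0 v'; have nw := normr_ge0 w'.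
  have T1 := taylor x (v' + w'); have T2 := taylor x v'; have T3 := taylor x w'.
  have M1 := mixed x vw.
  have K1 (z : V) : `|z| <= s' -> K * s32 `|z| <= K * s32 s'.
    by move=> zs; apply: ler_wpM2l => //; exact: s32_mono.
  have {}T1 := le_trans T1 (K1 _ (le_trans (ler_normD _ _) vw)).
  have {}T2 := le_trans T2 (K1 v' ltac:(lra)).
  have {}T3 := le_trans T3 (K1 w' ltac:(lra)).
  rewrite addrA in T1.
  have -> : D x (v' + w') - (D x v' + D x w') =
      (F (x + v' + w') - F (x + v') - F (x + w') + F x)
      - (F (x + v' + w') - F x - D x (v' + w'))
      + (F (x + v') - F x - D x v') + (F (x + w') - F x - D x w').
    move: (D x _) (D x _) (D x _) (F _) (F _) (F _) (F _) => d1 d2 d3 f1 f2 f3 f4.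
    by vring.
  apply: le_trans (ler_normD _ _) _; apply: le_trans (lerD (ler_normD _ _) T3) _.
  apply: le_trans (lerD (lerD (ler_normB _ _) T2) (lexx _)) _; lra.
apply: (@geometric_squeeze _ r ((3 * K + 2 * C) * s32 s) _ r0 r1) => n.
have p0 : 0 < 2 ^- n :> R by rewrite invr_gt0 exprn_gt0.
have := main (2 ^- n *: v) (2 ^- n *: w) (2 ^- n * s).
rewrite !normrZ ger0_norm ?(ltW p0) // -mulrDr lexx => /(_ isT).
rewrite -scalerDr !D_dyadic -scalerDr -scalerBr normrZ ger0_norm ?(ltW p0) //.
rewrite /s32 sqrt_dyadic // => H.
rewrite -(ler_pM2l p0); apply: le_trans H _.
by rewrite le_eqVlt; apply/orP; left; apply/eqP; ring.
Qed.

Let D0 x : D x 0 = 0.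
Proof. by apply: (@addIr _ (D x 0)); rewrite -D_add !add0r. Qed.

Let D_opp x v : D x (- v) = - D x v.
Proof. by apply/eqP; rewrite -addr_eq0 -D_add addNr D0. Qed.

Let D_nat x n v : D x (n%:R *: v) = n%:R *: D x v.
Proof.
elim: n => [|n IH]; first by rewrite !scale0r D0.
by rewrite -natr1 !scalerDl !scale1r D_add IH.
Qed.

Let D_pos x (t : R) v : 0 <= t -> D x (t *: v) = t *: D x v.
Proof.
move=> t0; apply/eqP; rewrite -subr_eq0 -normr_le0.
have H n : n%:R * `|D x (t *: v) - t *: D x v| <= 2 * L * `|v|.
  pose k := Num.truncn (n%:R * t).
  have /andP[k1 k2] : k%:R <= n%:R * t < k.+1%:R by rewrite truncn_itv // mulr_ge0.
  pose f := n%:R * t - k%:R.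
  have f0 : 0 <= f by rewrite subr_ge0.
  have f1 : f <= 1 by rewrite /f; move: k2; rewrite -natr1; lra.
  have e : n%:R *: (D x (t *: v) - t *: D x v) = D x (f *: v) - f *: D x v.
    rewrite scalerBr -D_nat !scalerA.
    have -> : n%:R * t = k%:R + f by rewrite /f addrC subrK.
    by rewrite !scalerDl D_add D_nat opprD addrACA subrr add0r.
  rewrite -[n%:R]ger0_norm // -normrZ e; apply: le_trans (ler_normB _ _) _.
  have H1 := D_bound x (f *: v); have H2 := D_bound x v.
  rewrite normrZ (ger0_norm f0) in H1; rewrite normrZ (ger0_norm f0).
  have nv := normr_ge0 v; have nD := normr_ge0 (D x v).
  have fv : L * (f * `|v|) <= L * `|v|.
    by apply: ler_wpM2l => //; rewrite -[leRHS]mul1r; exact: ler_wpM2r.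
  have fD : f * `|D x v| <= `|D x v| by rewrite -[leRHS]mul1r; exact: ler_wpM2r.
  lra.
rewrite leNgt; apply/negP => p0.
have := H (Num.truncn (2 * L * `|v| / `|D x (t *: v) - t *: D x v|)).+1.
rewrite leNgt => /negP; apply; rewrite -ltr_pdivrMr //.
have q0 : 0 <= 2 * L * `|v| / `|D x (t *: v) - t *: D x v|.
  by rewrite divr_ge0 // !mulr_ge0.
by have /andP[] := truncn_itv q0.
Qed.

Let D_scale x (t : R) v : D x (t *: v) = t *: D x v.
Proof.
have [t0|t0] := leP 0 t; first exact: D_pos.
rewrite -[t]opprK scaleNr D_opp D_pos ?scaleNr //.
by rewrite oppr_ge0 ltW.
Qed.

Let M x : 'M[R]_d := \matrix_(i, j) D x 'e_i ord0 j.

Let DM x v : D x v = v *m M x.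
Proof.
rewrite mulmx_sum_row [in LHS](row_sum_delta v).
rewrite (big_morph (D x) (D_add x) (D0 x)); apply: eq_bigr => i _.
by rewrite D_scale; congr (_ *: _); apply/rowP => j; rewrite !mxE.
Qed.

Let M_holder x y i j : `|M x i j - M y i j| <= 2 * (2 * K + 4 * C) * Num.sqrt 2 * Num.sqrt `|x - y|.
Proof.
have [->|xy] := eqVneq x y; first by rewrite !subrr !normr0 sqrtr0 mulr0.
pose s := `|x - y|; have s0 : 0 < s by rewrite normr_gt0 subr_eq0.
pose e : V := 'e_i.
have e1 : `|s *: e| <= s.
  rewrite normrZ ger0_norm ?(ltW s0) // -[leRHS]mulr1; apply: ler_wpM2l; first exact: ltW.
  apply: rV_norm_le => // k; rewrite mxE eqxx /=; case: eqP => _; rewrite ?normr1 ?normr0 //.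
have H : s * `|D x e - D y e| <= (2 * K + 4 * C) * s32 (2 * s).
  have T1 := taylor x (s *: e); have T2 := taylor y (s *: e).
  have K1 : K * s32 `|s *: e| <= K * s32 (2 * s).
    by apply: ler_wpM2l => //; apply: s32_mono => //; apply: le_trans e1 _; lra.
  have {}T1 := le_trans T1 K1; have {}T2 := le_trans T2 K1.
  have M1 : `|F (y + s *: e + (x - y)) - F (y + s *: e) - F (y + (x - y)) + F y| <=
      2 * C * s32 (2 * s).
    by apply: mixed; rewrite mulr_natl mulr2n; apply: lerD.
  have yx : y + (x - y) = x by rewrite addrC subrK.
  have yxe : y + s *: e + (x - y) = x + s *: e by vring.
  rewrite yxe yx in M1.
  rewrite -[s in s * _]ger0_norm ?(ltW s0) // -normrZ scalerBr -!D_scale.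
  have -> : D x (s *: e) - D y (s *: e) =
      (F (x + s *: e) - F (y + s *: e) - F x + F y)
      - (F (x + s *: e) - F x - D x (s *: e)) + (F (y + s *: e) - F y - D y (s *: e)).
    move: (D x _) (D y _) (F _) (F _) (F _) (F _) => d1 d2 f1 f2 f3 f4.
    by vring.
  apply: le_trans (ler_normD _ _) _; apply: le_trans (lerD (ler_normB _ _) T2) _.
  have : 0 <= C * s32 (2 * s) by rewrite mulr_ge0 // /s32 mulr_ge0 ?sqrtr_ge0 // mulr_ge0 // ltW.
  lra.
apply: (@le_trans _ _ `|D x e - D y e|).
  have -> : M x i j - M y i j = (D x e - D y e) ord0 j by rewrite !mxE.
  exact: mx_entry_norm_le.
rewrite -(ler_pM2l s0); apply: le_trans H _.
rewrite /s32 sqrtrM // -/s le_eqVlt; apply/orP; left; apply/eqP; ring.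
Qed.

Let near_le (v : V) e : 0 < e -> \forall w \near v, `|v - w| <= e.
Proof.
move=> e0; have /cvgrPdist_le /(_ _ e0) H : w @[w --> v] --> v by exact: cvg_id.
exact: H.
Qed.

Let zygmund_differential x :
  differentiable F x /\ jacobian F x = M x.
Proof.
have cM : continuous (mulmxr (M x) : V -> V).
  move=> v; have FF : Filter (nbhs v) := nbhs_filter v.
  apply/cvgrPdist_le => e e0.
  have L1 : 0 < L + 1 by rewrite ltr_wpDl.
  apply: filterS (near_le v (divr_gt0 e0 L1)) => w vw.
  rewrite /= -mulmxBl -DM; apply: le_trans (D_bound _ _) _.
  apply: (@le_trans _ _ ((L + 1) * (e / (L + 1)))).
    by apply: ler_pM => //; rewrite lerDl.
  by rewrite mulrC divfK // gt_eqF.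
have cF : F \o shift x = cst (F x) + (mulmxr (M x) : V -> V) +o_ 0 id.
  apply/eqaddoP => e e0.
  have K1 : 0 < K + 1 by rewrite ltr_wpDl.
  have eK : 0 < (e / (K + 1)) ^+ 2 by rewrite exprn_gt0 // divr_gt0.
  apply: filterS (near_le 0 eK) => v; rewrite sub0r normrN => vs.
  have -> : (F \o shift x - (cst (F x) + (mulmxr (M x) : V -> V))) v =
      F (x + v) - F x - D x v.
    by rewrite DM -[RHS]addrA -opprD (addrC x).
  apply: le_trans (taylor x v) _; rewrite /s32 mulrCA mulrC; apply: ler_wpM2r => //.
  apply: (@le_trans _ _ ((K + 1) * (e / (K + 1)))).
    apply: ler_pM => //; rewrite ?sqrtr_ge0 ?lerDl //.
    apply: le_trans (ler_wsqrtr vs) _.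
    by rewrite sqrtr_sqr ger0_norm // divr_ge0 // ltW.
  by rewrite mulrC divfK // gt_eqF.
have dE := diff_unique cM cF.
split; first by apply/diff_locallyP; rewrite dE.
apply/matrixP => i j; rewrite /jacobian /lin1_mx mxE dE /=.
by rewrite -rowE mxE.
Qed.

Let zygmund_C1' : C1 F.
Proof.
split => [x|x]; first by have [] := zygmund_differential x.
have -> : jacobian F = M by apply/funext => y; have [] := zygmund_differential y.
set c := 2 * (2 * K + 4 * C) * Num.sqrt 2.
have c0 : 0 <= c.
  apply: mulr_ge0 (mulr_ge0 (ler0n R 2) _) (sqrtr_ge0 _).
  exact: addr_ge0 (mulr_ge0 (ler0n R 2) K0) (mulr_ge0 (ler0n R 4) C0).
have c1 : 0 < c + 1 by rewrite ltr_wpDl.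
have FF : Filter (nbhs x) := nbhs_filter x.
apply/cvgrPdist_le => e e0.
have ec : 0 < (e / (c + 1)) ^+ 2 by rewrite exprn_gt0 // divr_gt0.
apply: filterS (near_le x ec) => y xy.
apply: mx_norm_le => [|i j]; first exact: ltW.
have -> : (M x - M y) i j = M x i j - M y i j.
  by move: (M x) (M y) => m1 m2; rewrite !mxE.
apply: le_trans (M_holder x y i j) _.
apply: (@le_trans _ _ ((c + 1) * (e / (c + 1)))).
  apply: ler_pM => //; rewrite ?sqrtr_ge0 ?lerDl //.
  apply: le_trans (ler_wsqrtr xy) _.
  by rewrite sqrtr_sqr ger0_norm // divr_ge0 // ltW.
by rewrite mulrC divfK // gt_eqF.
Qed.

Let difference_rate x i n j :
  `|2 ^+ n * (F (x + 2 ^- n *: 'e_i) - F x) ord0 j - jacobian F x i j| <= K * r ^+ n.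
Proof.
have [_ ->] := zygmund_differential x.
have := aD x 'e_i n; have e1 : `|'e_i : V| <= 1.
  by apply: rV_norm_le => // k; rewrite mxE eqxx /=; case: eqP => _; rewrite ?normr1 ?normr0.
move=> H; apply: (@le_trans _ _ (K * (`|'e_i : V| * Num.sqrt `|'e_i : V|) * r ^+ n)); last first.
  apply: ler_wpM2r; first exact: exprn_ge0.
  rewrite -[leRHS]mulr1; apply: ler_wpM2l => //; rewrite -[leRHS]mulr1.
  by apply: ler_pM; rewrite ?sqrtr_ge0 // -sqrtr1 ler_wsqrtr.
apply: le_trans H.
have -> : 2 ^+ n * (F (x + 2 ^- n *: 'e_i) - F x) ord0 j - M x i j =
    (a n x 'e_i - D x 'e_i) ord0 j.
  by rewrite /a; move: (F _) (F x) => f1 f2; rewrite !mxE.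
exact: mx_entry_norm_le.
Qed.

Let jacobian_bound x i j : `|jacobian F x i j| <= L.
Proof.
have [_ ->] := zygmund_differential x.
rewrite mxE; apply: le_trans (mx_entry_norm_le _ _ _) _.
apply: le_trans (D_bound _ _) _; rewrite -[leRHS]mulr1; apply: ler_wpM2l => //.
by apply: rV_norm_le => // k; rewrite mxE eqxx /=; case: eqP => _; rewrite ?normr1 ?normr0.
Qed.

Lemma derivative_summary : [/\ C1 F,
  forall x i n j,
    `|2 ^+ n * (F (x + 2 ^- n *: 'e_i) - F x) ord0 j - jacobian F x i j| <= K * r ^+ n
  & forall x i j, `|jacobian F x i j| <= L].
Proof. by split. Qed.

End derivative.

Theorem zygmund_C1 : [/\ C1 F,
  forall x i n j, `|2 ^+ n * (F (x + 2 ^- n *: 'e_i) - F x) ord0 j - jacobian F x i j|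
     <= C / (1 - Num.sqrt 2^-1) * Num.sqrt 2^-1 ^+ n
  & forall x i j, `|jacobian F x i j| <= L].
Proof. by have [D aD] := D_exists; exact: (derivative_summary aD). Qed.

End zygmund.

(** * From almost sure to sure statements *)

Section coefficient_extension.
Context {R : realType} {d : nat}.
Local Notation V := 'rV[R]_d.
Local Notation BV := (borel_rV R d).
Local Notation RR := (measurableTypeR R).
Variable T : R.

Definition zero_extend (f : R -> V -> V -> V) (s : R) (y z : V) : V :=
  if (0 <= s) && (s <= T) then f s y z else 0.

Lemma zero_extendE f s y z : 0 <= s -> s <= T -> zero_extend f s y z = f s y z.
Proof. by rewrite /zero_extend => -> ->. Qed.

Lemma measurable_zero_extend f :
  measurable_fun ((`[0, T]%classic : set RR) `*` [set: BV * BV])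
    (fun u => f u.1 u.2.1 u.2.2 : BV) ->
  measurable_fun setT (fun z : RR * (BV * BV) => zero_extend f z.1 z.2.1 z.2.2 : BV).
Proof.
move=> mf; have mD : measurable ((`[0, T]%classic : set RR) `*` [set: BV * BV]).
  by apply: measurableX => //; exact: measurable_itvRR.
apply: measurable_fun_if => //.
- apply: measurable_and; apply: measurable_fun_ler.
  + exact: measurable_cst.
  + exact: measurable_fst.
  + exact: measurable_fst.
  + exact: measurable_cst.
- suff -> : setT `&` (fun z : RR * (BV * BV) => (0 <= z.1) && (z.1 <= T)) @^-1` [set true] =
     (`[0, T]%classic : set RR) `*` [set: BV * BV] by [].
  apply/seteqP; split => z /=; rewrite in_itv /=; first by move=> [_ ->].
  by move=> [-> _].
Qed.

Lemma zero_extend_regular f : coeff_class T f ->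
  exists2 L0 : R, 0 <= L0 & forall L, L0 <= L -> regular_coeff L (zero_extend f).
Proof.
move=> [mf [C C0 [cy cz]]]; exists (d%:R * C + d%:R * C * d%:R) => [|L LL].
  by rewrite addr_ge0 // !mulr_ge0 // ltW.
have [C1 C2] : 0 <= d%:R * C /\ 0 <= d%:R * C * d%:R by have C0' := ltW C0; split; rewrite !mulr_ge0.
have L0 : 0 <= L by apply: le_trans LL; rewrite addr_ge0.
have l1 : d%:R * C <= L by apply: le_trans LL; rewrite lerDl.
have l2 : d%:R * C * d%:R <= L by apply: le_trans LL; rewrite lerDr.
split => //; first exact: measurable_zero_extend.
move=> s; case: (boolP ((0 <= s) && (s <= T))) => sT; last first.
  have -> : zero_extend f s = (fun _ _ => 0).
    by apply/funext => y; apply/funext => z; rewrite /zero_extend (negbTE sT).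
  by split=> [z y h|y z h|z y h k|y z h k]; rewrite !subr0 ?addr0 normr0 !mulr_ge0.
have -> : zero_extend f s = f s.
  by apply/funext => y; apply/funext => z; rewrite /zero_extend sT.
have sI : s \in `[0, T] by rewrite in_itv /= sT.
split.
- move=> z y h; apply: le_trans (C11b_lip (cy _ z sI) y h) _; exact: ler_wpM2r.
- move=> y z h; apply: le_trans (C11b_lip (cz _ y sI) z h) _; exact: ler_wpM2r.
- move=> z y h k; apply: le_trans (C11b_lip2 (cy _ z sI) y h k) _.
  by apply: ler_wpM2r => //; exact: ler_wpM2r.
- move=> y z h k; apply: le_trans (C11b_lip2 (cz _ y sI) z h k) _.
  by apply: ler_wpM2r => //; exact: ler_wpM2r.
Qed.

End coefficient_extension.

Section null_set_filtration.
Context {R : realType} {disp : measure_display} {Omega : measurableType disp}.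
Variables (P : probability Omega R) (d : nat).
Local Notation V := 'rV[R]_d.
Local Notation BV := (borel_rV R d).
Local Notation RR := (measurableTypeR R).

Definition sdiff (A A' : set Omega) := (A `\` A') `|` (A' `\` A).

Lemma measure_sdiff (A A' : set Omega) : measurable A -> measurable A' ->
  P.-negligible (sdiff A A') -> P A = P A'.
Proof.
move=> mA mA' [N [mN PN sN]].
have H (E : set Omega) : measurable E -> P E = P (E `\` N).
  move=> mE; have EN : P (E `&` N) = 0%E.
    apply/eqP; rewrite eq_le measure_ge0 andbT -PN.
    by apply: le_measure; rewrite ?inE //; exact: measurableI.
  apply: etrans (measureDI P mE mN) _.
  exact: etrans (congr1 (fun x => (P (E `\` N) + x)%E) EN) (adde0 _).
rewrite (H A mA) (H A' mA'); congr (P _); apply/seteqP; split => w [Aw Nw]; split => //.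
- by apply: contrapT => A'w; apply: Nw; apply: sN; left.
- by apply: contrapT => A'w; apply: Nw; apply: sN; right.
Qed.

Variables (T : R) (B : R -> Omega -> V).

(* [Num.min t T] because the marginals of [B] are controlled on [0, T] only. *)
Definition past_modulo_null (t : R) : set (set Omega) :=
  [set A | exists2 A', natural_filtration B (Num.min t T) A' & P.-negligible (sdiff A A')].

Lemma natural_filtration_mono s t : s <= t ->
  natural_filtration B s `<=` natural_filtration B t.
Proof.
move=> st; apply: sub_sigma_algebra2 => A [r [D [rs mD ->]]]; exists r, D; split => //.
by move: rs; rewrite !in_itv /= => /andP[-> rs]; exact: le_trans st.
Qed.

Lemma past_modulo_null_sigma t : sigma_algebra setT (past_modulo_null t).
Proof.
split.
- exists set0; first exact: sigma_algebra0.
  by rewrite /sdiff setDv setU0; exact: negligible_set0.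
- move=> A [A' nA' NA]; exists (setT `\` A'); first exact: sigma_algebraCD.
  apply: negligibleS NA => w [[[_ nA] nA'w]|[[_ nA'w] nAw]].
    by right; split => //; apply: contrapT => H; apply: nA'w.
  by left; split => //; apply: contrapT => H; apply: nAw.
- move=> A HA.
  have H n : exists A', natural_filtration B (Num.min t T) A' /\ P.-negligible (sdiff (A n) A').
    by have [A' h1 h2] := HA n; exists A'.
  have [A' HA'] := choice H.
  exists (\bigcup_n A' n).
    by apply: sigma_algebra_bigcup => n; case: (HA' n).
  apply: negligibleS (negligible_bigcup (fun n => (HA' n).2)) => w.
  case=> [[[n _ An] nA]|[[n _ An] nA]]; exists n => //.
    by left; split => // A'n; apply: nA; exists n.
  by right; split => // A'n; apply: nA; exists n.
Qed.

Lemma augmented_past_modulo_null t : t <= T ->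
  augmented_filtration P B t `<=` past_modulo_null t.
Proof.
move=> tT; apply: smallest_sub; first exact: past_modulo_null_sigma.
move=> A [nA|NA].
  exists A; first by rewrite min_l.
  by rewrite /sdiff setDv setU0; exact: negligible_set0.
exists set0; first exact: sigma_algebra0.
by rewrite /sdiff setD0 set0D setU0.
Qed.

Definition null_filtration (t : R) : set (set Omega) :=
  measurable `&` past_modulo_null t.

Hypothesis mB : forall t : R, t \in `[0, T] -> random_vector (B t).

Lemma natural_measurable t : natural_filtration B (Num.min t T) `<=` measurable.
Proof.
apply: smallest_sub; first exact: sigma_algebra_measurable.
move=> _ [s [D [st mD ->]]]; rewrite -[_ @^-1` _]setTI; apply: mB => //.
by move: st; rewrite !in_itv /= => /andP[->]; rewrite le_min => /andP[].
Qed.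

Lemma null_filtration_sigma t : sigma_algebra setT (null_filtration t).
Proof.
have [p0 pC pU] := past_modulo_null_sigma t.
split; first by split.
- by move=> A [mA pA]; split; [exact: measurableD|exact: pC].
- move=> A HA; split; first by apply: bigcup_measurable => n _; case: (HA n).
  by apply: pU => n; case: (HA n).
Qed.

Lemma null_filtration_mono s t : s <= t -> null_filtration s `<=` null_filtration t.
Proof.
move=> st A [mA [A' nA' NA]]; split => //; exists A' => //.
apply: natural_filtration_mono nA'.
by rewrite le_min !ge_min st lexx orbT.
Qed.

End null_set_filtration.

Section reduction.
Context {R : realType} {disp : measure_display} {Omega : measurableType disp}.
Variables (P : probability Omega R) (d : nat).
Local Notation V := 'rV[R]_d.
Local Notation BV := (borel_rV R d).
Local Notation RR := (measurableTypeR R).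
Local Notation leb := (@lebesgue_measure R).
Variables (T : R) (T0 : 0 < T) (B : R -> Omega -> V).
Hypothesis hB : brownian_motion P T B.
Variables (b phi : R -> V -> V -> V).
Hypotheses (hb : coeff_class T b) (hphi : coeff_class T phi).

Lemma bounded_noise : exists R0 : R, forall N, P.-negligible N ->
  exists w0, ~ N w0 /\ forall s, `|B (clamp T s) w0| <= R0.
Proof.
apply: contrapT => H.
have H1 (n : nat) : exists N, P.-negligible N /\
    forall w, ~ N w -> ~ forall s, `|B (clamp T s) w| <= n%:R.
  apply: contrapT => H2; apply: H; exists n%:R => N NN.
  apply: contrapT => H3; apply: H2; exists N; split => // w Nw H4.
  by apply: H3; exists w.
have [N HN] := choice H1.
have [_ _ cB _] := hB.
have NT : P.-negligible [set: Omega].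
  apply: negligibleS (negligibleU cB (negligible_bigcup (fun n => (HN n).1))) => w _.
  have [cw|ncw] := pselect ({within `[0, T], continuous (fun t => B t w)}); last by left.
  right; have [M HM] := continuous_clamp_bounded (ltW T0) cw.
  pose n := Num.bound M; exists n => //; apply: contrapT => Nw.
  apply: (HN n).2 Nw _ => s; apply: le_trans (HM s) _.
  have M0 : 0 <= M by exact: le_trans (normr_ge0 _) (HM 0).
  by apply: ltW; exact: archi_boundP.
have [A [mA PA sA]] := NT.
have : P [set: Omega] = 0%E.
  by apply/eqP; rewrite eq_le measure_ge0 andbT -PA; apply: le_measure; rewrite ?inE.
by rewrite probability_setT => /eqP; rewrite onee_eq0.
Qed.

Variables (N : set Omega) (w0 : Omega).
Hypotheses (mN : measurable N) (PN : P N = 0%E) (Nw0 : ~ N w0).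
Hypothesis goodB : forall w, ~ N w ->
  B 0 w = 0 /\ {within `[0, T], continuous (fun t => B t w)}.

(* Sending a null set to one good sample point makes almost sure properties
   hold at every sample point without changing any law. *)
Definition redirect (w : Omega) : Omega := if pselect (N w) then w0 else w.

Lemma redirect_good w : ~ N (redirect w).
Proof. by rewrite /redirect; case: pselect. Qed.

Lemma redirect_id w : ~ N w -> redirect w = w.
Proof. by rewrite /redirect; case: pselect. Qed.

Lemma redirect_preimage (A : set Omega) : P.-negligible (sdiff (redirect @^-1` A) A).
Proof.
exists N; split => // w; case: (pselect (N w)) => // Nw.
by rewrite /sdiff /= redirect_id //; case=> -[].
Qed.

Lemma measurable_redirect : measurable_fun setT redirect.
Proof.
move=> _ A mA; rewrite setTI.
have -> : redirect @^-1` A = (A `\` N) `|` (N `&` [set _ | A w0]).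
  apply/seteqP; split => w /=; rewrite /redirect; case: pselect => Nw.
  - by right.
  - by left.
  - by case=> [[]|[]].
  - by case=> [[]|[]].
apply: measurableU; first exact: measurableD.
apply: measurableI => //; case: (pselect (A w0)) => Aw.
  by rewrite (_ : [set _ | _] = setT) //; apply/seteqP; split.
by rewrite (_ : [set _ | _] = set0) //; apply/seteqP; split.
Qed.

Definition clean (X : R -> Omega -> V) (s : R) (w : Omega) : V := X (clamp T s) (redirect w).

Let clampT s : clamp T s \in `[0, T].
Proof. by rewrite in_itv /= clamp_itv // ltW. Qed.

Lemma clean_jointly_measurable X :
  (forall t : R, t \in `[0, T] -> random_vector (X t)) ->
  (forall w, ~ N w -> {within `[0, T], continuous (fun t => X t w)}) ->
  jointly_measurable (clean X).
Proof.
move=> mX cX; apply: caratheodory => [s|w].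
  exact: (measurableT_comp (mX _ (clampT s)) measurable_redirect).
exact: continuous_clamp (ltW T0) (cX _ (@redirect_good w)).
Qed.

Lemma clean_clamped X : clamped T (clean X).
Proof.
by move=> s w; rewrite /clean; have /andP[s0 sT] := clamp_itv s (ltW T0); rewrite (clamp_id s0 sT).
Qed.

Lemma clean_path_bounded X :
  (forall w, ~ N w -> {within `[0, T], continuous (fun t => X t w)}) ->
  path_bounded (clean X).
Proof. by move=> cX w; exact: (continuous_clamp_bounded (ltW T0) (cX _ (@redirect_good w))). Qed.

Let mB t : t \in `[0, T] -> random_vector (B t). Proof. by case: hB => + _ _ _; exact. Qed.

Let cleanE X s w : 0 <= s -> s <= T -> clean X s w = X s (redirect w).
Proof. by move=> s0 sT; rewrite /clean clamp_id. Qed.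

Lemma sdiff_trans (A A' A'' : set Omega) : P.-negligible (sdiff A A') ->
  P.-negligible (sdiff A' A'') -> P.-negligible (sdiff A A'').
Proof.
move=> n1 n2; apply: negligibleS (negligibleU n1 n2) => w.
case: (pselect (A' w)) => A'w; case=> -[h1 h2].
- by right; left.
- by left; right.
- by left; left.
- by right; right.
Qed.

Lemma clean_brownian : brownian_wrt P T (null_filtration P T B) (clean B).
Proof.
split.
- move=> t; split; first exact: null_filtration_sigma.
  by move=> A [].
- by move=> s t st; exact: null_filtration_mono.
- move=> t D t0 tT mD; have tI : t \in `[0, T] by rewrite in_itv /= t0.
  have -> : clean B t @^-1` D = redirect @^-1` (B t @^-1` D).
    by apply/seteqP; split => w /=; rewrite cleanE.
  split.
    have := measurableT_comp (mB tI) measurable_redirect.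
    by move=> /(_ measurableT D mD); rewrite setTI.
  exists (B t @^-1` D); last exact: redirect_preimage.
  apply: sub_sigma_algebra; exists t, D; split => //.
  by rewrite in_itv /= t0 /= le_min lexx.
- move=> s t F D s0 st tT [mF [F' nF' NF]] mD.
  have sT : s <= T := ltW (lt_le_trans st tT); have t0 : 0 <= t := le_trans s0 (ltW st).
  have mF' := natural_measurable mB nF'.
  rewrite min_l // in nF'.
  have [_ _ _ ind] := hB.
  have mbox (Y Z : Omega -> V) : random_vector Y -> random_vector Z ->
      measurable [set w | rV_box D (Y w - Z w)].
    move=> mY mZ; have := measurable_rVB mY mZ.
    by move=> /(_ measurableT _ (measurable_rV_box mD)); rewrite setTI.
  have sI : s \in `[0, T] by rewrite in_itv /= s0.
  have tI : t \in `[0, T] by rewrite in_itv /= t0.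
  rewrite (measure_sdiff mF mF' NF) -(ind s t F' D s0 st tT nF' mD).
  apply: measure_sdiff.
  + apply: measurableI => //; apply: mbox.
      by rewrite /random_vector; have := measurableT_comp (mB (clampT t)) measurable_redirect.
    by rewrite /random_vector; have := measurableT_comp (mB (clampT s)) measurable_redirect.
  + by apply: measurableI => //; exact: (mbox (B t) (B s) (mB tI) (mB sI)).
  apply: negligibleS (negligibleU NF (redirect_preimage [set w | rV_box D (B t w - B s w)])) => w.
  rewrite /sdiff /= !cleanE //.
  case: (pselect (F w)) => Fw; case: (pselect (F' w)) => F'w.
  + by case=> -[[h1 h2] h3]; right; [left|right]; split => // h4; apply: h3.
  + by move=> _; left; left.
  + by move=> _; left; right.
  + by case=> -[[]].
Qed.

Lemma clean_noise : nice_noise P T (null_filtration P T B) (clean B).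
Proof.
have cB w (Nw : ~ N w) := (goodB Nw).2.
split; [exact: clean_brownian|exact: clean_jointly_measurable|exact: clean_clamped| |].
  exact: clean_path_bounded.
move=> w; rewrite cleanE ?(ltW T0) //.
by case: (goodB (@redirect_good w)).
Qed.

Variables (x : V) (X : R -> Omega -> V).
Hypothesis hX : strong_solution P T B b phi x X.
Hypothesis goodX : forall w, ~ N w ->
  {within `[0, T], continuous (fun t => X t w)} /\
  (forall i, leb.-integrable (`[0, T]%classic : set RR)
     (fun s => (drift P b phi X w s ord0 i)%:E)) /\
  (forall t : R, t \in `[0, T] ->
     X t w = x + (\row_i Rintegral leb (`[0, t]%classic : set RR)
       (fun s => drift P b phi X w s ord0 i)) + B t w).

Lemma law_integral (Z : Omega -> V) (g : V -> R) : random_vector Z ->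
  measurable_fun setT (g : BV -> R) ->
  (law P Z).-integrable setT (fun z => (g z)%:E) ->
  P.-integrable setT (fun w => (g (Z w))%:E) /\
  (\int[law P Z]_z (g z)%:E = \int[P]_w (g (Z w))%:E)%E.
Proof.
move=> mZ mg ig.
have mE : measurable_fun [set: BV] (EFin \o g) by exact/measurable_EFinP.
have iP : P.-integrable setT (fun w => (g (Z w))%:E).
  apply/integrableP; split; first by apply/measurable_EFinP; exact: (measurableT_comp mg mZ).
  have /integrableP[_] := ig; rewrite /law => H.
  have := @ge0_integral_pushforward _ _ _ _ R _ mZ P setT (fun z => `|(g z)%:E|%E) measurableT.
  rewrite preimage_setT => E; move: H; rewrite E //.
  by apply: measurableT_comp.
split => //; rewrite /law (integral_pushforward mZ _ _ measurableT) ?preimage_setT //.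
Qed.

Lemma measurable_slice s y i : 0 <= s -> s <= T ->
  measurable_fun setT (fun z : BV => phi s y z ord0 i).
Proof.
move=> s0 sT; have [mphi _] := hphi.
have m := measurable_zero_extend mphi.
have mp : measurable_fun setT (fun z : BV => (s : RR, (y : BV, z))).
  apply: measurable_fun_pair; first exact: measurable_cst.
  by apply: measurable_fun_pair; [exact: measurable_cst|exact: measurable_id].
have := measurableT_comp (measurable_rV_coord i) (measurableT_comp m mp).
by apply: eq_measurable_fun => z _ /=; rewrite zero_extendE.
Qed.

Lemma clean_phi_integrable : phi_integrable P (zero_extend T phi) (clean X).
Proof.
move=> s y i.
have [mX aX _ iX _] := hX.
have [sT|sT] := boolP ((0 <= s) && (s <= T)); last first.
  rewrite (_ : (fun w => _) = (fun=> 0%:E)); first exact: integrable0.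
  by apply/funext => w; rewrite /zero_extend (negbTE sT) mxE.
have sI : s \in `[0, T] by rewrite in_itv.
have /andP[s0 s1] := sT.
have mg : measurable_fun setT (fun z : BV => phi s y z ord0 i) by exact: measurable_slice.
have [iP _] := law_integral (mX s sI) mg (iX s y i sI).
have mc : measurable_fun setT (fun w => (phi s y (X s (redirect w)) ord0 i)%:E).
  apply/measurable_EFinP; apply: (measurableT_comp mg).
  exact: (measurableT_comp (mX s sI) measurable_redirect).
apply/integrableP; split.
  apply: eq_measurable_fun mc => w _.
  by rewrite cleanE // zero_extendE.
have /integrableP[mP fP] := iP.
apply: le_lt_trans fP; rewrite le_eqVlt; apply/orP; left; apply/eqP.
apply: ae_eq_integral => //.
- apply: measurableT_comp => //; apply: eq_measurable_fun mc => w _.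
  by rewrite cleanE // zero_extendE.
- exact: measurableT_comp.
- exists N; split => // w /= H; apply: contrapT => Nw; apply: H => _.
  by rewrite cleanE // zero_extendE // redirect_id.
Qed.

Lemma clean_mean_field s y : 0 <= s -> s <= T ->
  mfield P (zero_extend T phi) (clean X) s y = mean_field P phi X s y.
Proof.
move=> s0 sT; have sI : s \in `[0, T] by rewrite in_itv /= s0.
have [mX aX _ iX _] := hX.
apply/rowP => i; rewrite !mxE; apply: (congr1 fine).
have mg : measurable_fun setT (fun z : BV => phi s y z ord0 i) by exact: measurable_slice.
have [iP ->] := law_integral (mX s sI) mg (iX s y i sI).
have /integrableP[mP _] := iP.
have /integrableP[mP' _] := clean_phi_integrable s y i.
apply: ae_eq_integral => //.
exists N; split => // w /= H; apply: contrapT => Nw; apply: H => _.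
by rewrite cleanE // zero_extendE // redirect_id.
Qed.

Lemma clean_drift s w : 0 <= s -> s <= T ->
  beta P (zero_extend T b) (zero_extend T phi) (clean X) s (clean X s w) =
  drift P b phi X (redirect w) s.
Proof.
by move=> s0 sT; rewrite /beta clean_mean_field // zero_extendE // cleanE.
Qed.

Lemma clean_solution :
  nice_solution P T (null_filtration P T B) (clean B) (zero_extend T b) (zero_extend T phi)
    x (clean X).
Proof.
have [mX aX _ iX _] := hX.
have cX w (Nw : ~ N w) := (goodX Nw).1.
split.
- exact: clean_jointly_measurable.
- move=> s s0 sT _ A mA; rewrite (past_measurableE clean_brownian) setTI.
  have sI : s \in `[0, T] by rewrite in_itv /= s0.
  have -> : clean X s @^-1` A = redirect @^-1` (X s @^-1` A).
    by apply/seteqP; split => w /=; rewrite cleanE.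
  split.
    have := measurableT_comp (mX s sI) measurable_redirect.
    by move=> /(_ measurableT A mA); rewrite setTI.
  have [A' nA' NA'] := augmented_past_modulo_null sT (aX s A sI mA).
  by exists A' => //; exact: sdiff_trans (redirect_preimage _) NA'.
- by split; [exact: clean_clamped|exact: clean_path_bounded].
- exact: clean_phi_integrable.
move=> w; have [_ [iD eD]] := goodX (@redirect_good w); split.
  move=> i; apply: eq_integrable (iD i); first exact: measurable_itvRR.
  by move=> s; rewrite inE /= in_itv /= => /andP[s0 sT]; rewrite clean_drift.
move=> t t0 tT; rewrite !cleanE // eD ?in_itv /= ?t0 //.
congr (_ + _ + _); apply/rowP => i; rewrite !mxE; apply: eq_Rintegral => s.
rewrite inE /= in_itv /= => /andP[s0 st].
by rewrite clean_drift // (le_trans st).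
Qed.

End reduction.

Section nice_estimates.
Context {R : realType} {disp : measure_display} {Omega : measurableType disp}.
Variables (P : probability Omega R) (d : nat).
Local Notation V := 'rV[R]_d.
Variables (T : R) (G : R -> set (set Omega)) (B : R -> Omega -> V).
Variables (L : R) (f phi : R -> V -> V -> V).
Hypotheses (T0 : 0 < T) (nB : nice_noise P T G B).
Hypotheses (cf : regular_coeff L f) (cphi : regular_coeff L phi).
Variables (R0 : R) (w0 : Omega).
Hypothesis w0R : forall s, `|B s w0| <= R0.

Definition fieldC : R := 2 * lipschitzC T L + `|meanC d T L R0| + `|sureC d T L R0|.

Lemma fieldC_lip : 0 <= lipschitzC T L <= fieldC.
Proof.
have LC0 := lipschitzC_ge0 T0 cf; rewrite LC0 /=.
have := normr_ge0 (meanC d T L R0); have := normr_ge0 (sureC d T L R0).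
by rewrite /fieldC; move: (lipschitzC T L) LC0 (`|_|) (`|_|) => a ? b c; lra.
Qed.

Variables (x u : V) (X0 X1 X2 : R -> Omega -> V).
Hypotheses (nX0 : nice_solution P T G B f phi x X0).
Hypotheses (nX1 : nice_solution P T G B f phi (x + u) X1).
Hypotheses (nX2 : nice_solution P T G B f phi (x - u) X2).

Lemma nice_first s w : `|X1 s w - X0 s w| <= fieldC * `|u|.
Proof.
have /andP[_ H] := fieldC_lip.
have := nice_lipschitz T0 nB cf cphi w0R nX1 nX0 s w.
by rewrite (addrC x) addrK => /le_trans; apply; exact: ler_wpM2r.
Qed.

Let second_by_first s w :
  `|X1 s w + X2 s w - X0 s w - X0 s w| <= 2 * lipschitzC T L * `|u|.
Proof.
have H1 := nice_lipschitz T0 nB cf cphi w0R nX1 nX0 s w.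
have H2 := nice_lipschitz T0 nB cf cphi w0R nX2 nX0 s w.
rewrite (addrC x) addrK in H1; rewrite (addrC x) addrK normrN in H2.
have -> : X1 s w + X2 s w - X0 s w - X0 s w = (X1 s w - X0 s w) + (X2 s w - X0 s w).
  by move: (X1 s w) (X2 s w) (X0 s w) => a1 a2 a3; vring.
apply: le_trans (ler_normD _ _) _; apply: le_trans (lerD H1 H2) _.
by rewrite le_eqVlt; apply/orP; left; apply/eqP; ring.
Qed.

Let constants : [/\ 0 <= 2 * lipschitzC T L, 2 * lipschitzC T L <= fieldC,
  meanC d T L R0 <= fieldC & sureC d T L R0 <= fieldC].
Proof.
have LC0 := lipschitzC_ge0 T0 cf.
have H1 := ler_norm (meanC d T L R0); have H2 := ler_norm (sureC d T L R0).
have H3 := normr_ge0 (meanC d T L R0); have H4 := normr_ge0 (sureC d T L R0).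
rewrite /fieldC; move: (lipschitzC T L) LC0 (meanC d T L R0) H1 H3 (sureC d T L R0) H2 H4.
move=> a a0 m; move: (`|m|) => m' H1 H3 k; move: (`|k|) => k' H2 H4.
by split; lra.
Qed.

Lemma nice_second s w :
  `|X1 s w + X2 s w - X0 s w - X0 s w| <= fieldC * (`|u| * Num.sqrt `|u|).
Proof.
have [l0 l1 _ l2] := constants.
have [u1|u1] := leP `|u| 1; last first.
  apply: le_trans (second_by_first s w) _.
  apply: ler_pM => //; rewrite -[leLHS]mulr1; apply: ler_wpM2l => //.
  by rewrite -sqrtr1 ler_wsqrtr // ltW.
have [u0|u0] := leP `|u| 0.
  have -> : u = 0 by apply/eqP; rewrite -normr_le0.
  move: (second_by_first s w); have -> : u = 0 by apply/eqP; rewrite -normr_le0.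
  by rewrite normr0 sqrtr0 !mulr0.
apply: le_trans (sure_second_difference T0 nB cf cphi w0R nX0 nX1 nX2 u0 u1 s w) _.
by apply: ler_wpM2r => //; rewrite mulr_ge0 ?sqrtr_ge0.
Qed.

Lemma nice_mean_second s :
  (\int[P]_w (`|X1 s w + X2 s w - X0 s w - X0 s w|)%:E <= (fieldC * `|u| ^+ 2)%:E)%E.
Proof.
have [l0 l1 l2 _] := constants.
have [mX0 _ _ _ _] := nX0; have [mX1 _ _ _ _] := nX1; have [mX2 _ _ _ _] := nX2.
have bS : bmf (fun w => `|X1 s w + X2 s w - X0 s w - X0 s w|).
  split; last by exists (2 * lipschitzC T L * `|u|) => w; rewrite normr_id.
  apply: (measurableT_comp measurable_rV_norm).
  apply: measurable_rVB; last exact: (jointly_measurable_slice s mX0).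
  apply: measurable_rVB; last exact: (jointly_measurable_slice s mX0).
  by apply: measurable_rVD; [exact: (jointly_measurable_slice s mX1)|exact: (jointly_measurable_slice s mX2)].
rewrite -(bmf_intE P bS) lee_fin.
have ub : \int[P]_w `|X1 s w + X2 s w - X0 s w - X0 s w| <= 2 * lipschitzC T L * `|u|.
  by apply: le_trans (ler_norm _) _; apply: bmf_int_ub => // w; rewrite normr_id.
have [u1|u1] := leP `|u| 1; last first.
  apply: le_trans ub _; apply: ler_pM => //.
  by rewrite expr2 -[leLHS]mulr1; apply: ler_wpM2l => //; exact: ltW.
have [u0|u0] := leP `|u| 0.
  apply: le_trans ub _; have -> : u = 0 by apply/eqP; rewrite -normr_le0.
  by rewrite normr0 expr0n /= !mulr0.
apply: le_trans (mean_second_difference T0 nB cf cphi w0R nX0 nX1 nX2 u0 u1 s) _.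
by apply: ler_wpM2r => //; rewrite exprn_ge0.
Qed.

End nice_estimates.

Section field_estimates.
Context {R : realType} {disp : measure_display} {Omega : measurableType disp}.
Variables (P : probability Omega R) (d : nat).
Local Notation V := 'rV[R]_d.
Variables (T : R) (T0 : 0 < T) (B : R -> Omega -> V).
Hypothesis hB : brownian_motion P T B.
Variables (b phi : R -> V -> V -> V).
Hypotheses (hb : coeff_class T b) (hphi : coeff_class T phi).
Variable X : V -> R -> Omega -> V.
Hypothesis hX : forall x, strong_solution P T B b phi x (X x).

Lemma field_estimates : exists2 C : R, 0 <= C & forall x u,
  [/\ {ae P, forall w, forall t, 0 <= t -> t <= T ->
        `|X (x + u) t w - X x t w| <= C * `|u|},
      {ae P, forall w, forall t, 0 <= t -> t <= T ->
        `|X (x + u) t w + X (x - u) t w - X x t w - X x t w|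
          <= C * (`|u| * Num.sqrt `|u|)} &
      forall t, 0 <= t -> t <= T ->
        (\int[P]_w (`|X (x + u) t w + X (x - u) t w - X x t w - X x t w|)%:E
           <= (C * `|u| ^+ 2)%:E)%E].
Proof.
have [Lb Lb0 Hb] := zero_extend_regular hb.
have [Lp Lp0 Hp] := zero_extend_regular hphi.
pose L := Lb + Lp.
have cb : regular_coeff L (zero_extend T b) by apply: Hb; rewrite lerDl.
have cp : regular_coeff L (zero_extend T phi) by apply: Hp; rewrite lerDr.
have [R0 HR0] := bounded_noise T0 hB.
exists (fieldC d T L R0).
  have /andP[H1 H2] : 0 <= lipschitzC T L <= fieldC d T L R0 by apply: (fieldC_lip T0 cb).
  exact: le_trans H2.
move=> x u; have [_ B0 cB _] := hB.
have ae3 z : P.-negligible (~` [set w |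
  {within `[0, T], continuous (fun t => X z t w)} /\
  (forall i, lebesgue_measure.-integrable (`[0, T]%classic : set (measurableTypeR R))
     (fun s => (drift P b phi (X z) w s ord0 i)%:E)) /\
  (forall t : R, t \in `[0, T] ->
     X z t w = z + (\row_i Rintegral lebesgue_measure (`[0, t]%classic : set (measurableTypeR R))
       (fun s => drift P b phi (X z) w s ord0 i)) + B t w)]).
  have [_ _ cX _ eX] := hX z.
  apply: negligibleS (negligibleU cX eX) => w nH.
  case: (pselect ({within `[0, T], continuous (fun t => X z t w)})) => cw; last by left.
  by right => -[e1 e2]; apply: nH.
have [N [mN PN sN]] := negligibleU (negligibleU B0 cB)
  (negligibleU (ae3 x) (negligibleU (ae3 (x + u)) (ae3 (x - u)))).
have NN : P.-negligible N by exists N; split.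
have [w0 [Nw0 w0R]] := HR0 N NN.
have good w : ~ N w -> [/\ B 0 w = 0, {within `[0, T], continuous (fun t => B t w)} &
    forall z, z \in [:: x; x + u; x - u] ->
  {within `[0, T], continuous (fun t => X z t w)} /\
  (forall i, lebesgue_measure.-integrable (`[0, T]%classic : set (measurableTypeR R))
     (fun s => (drift P b phi (X z) w s ord0 i)%:E)) /\
  (forall t : R, t \in `[0, T] ->
     X z t w = z + (\row_i Rintegral lebesgue_measure (`[0, t]%classic : set (measurableTypeR R))
       (fun s => drift P b phi (X z) w s ord0 i)) + B t w)].
  move=> Nw; split.
  - by apply: contrapT => H; apply: Nw; apply: sN; left; left.
  - by apply: contrapT => H; apply: Nw; apply: sN; left; right.
  - move=> z; rewrite !inE => /or3P[]/eqP->; apply: contrapT => H; apply: Nw; apply: sN; right.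
    + by left.
    + by right; left.
    + by right; right.
have goodB w : ~ N w -> B 0 w = 0 /\ {within `[0, T], continuous (fun t => B t w)}.
  by move=> /good[].
pose c (Y : R -> Omega -> V) := clean T N w0 Y.
have nB : nice_noise P T (null_filtration P T B) (c B).
  exact: clean_noise.
have nX z : z \in [:: x; x + u; x - u] -> nice_solution P T (null_filtration P T B) (c B)
    (zero_extend T b) (zero_extend T phi) z (c (X z)).
  move=> zI; apply: clean_solution => // w Nw.
  by have [_ _ /(_ z zI)] := good w Nw.
have cR s : `|c B s w0| <= R0 by rewrite /c /clean redirect_id.
have nX0 := nX x (mem_head _ _).
have nX1 := nX (x + u) ltac:(by rewrite !inE eqxx orbT).
have nX2 := nX (x - u) ltac:(by rewrite !inE eqxx !orbT).
have cE z t w : 0 <= t -> t <= T -> ~ N w -> c (X z) t w = X z t w.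
  by move=> t0 tT Nw; rewrite /c /clean clamp_id // redirect_id.
split.
- exists N; split => // w H; apply: contrapT => Nw; apply: H => t t0 tT.
  rewrite -!cE //; exact: (nice_first T0 nB cb cp cR nX0 nX1 t w).
- exists N; split => // w H; apply: contrapT => Nw; apply: H => t t0 tT.
  rewrite -!cE //; exact: (nice_second T0 nB cb cp cR nX0 nX1 nX2 t w).
- move=> t t0 tT; have := nice_mean_second T0 nB cb cp cR nX0 nX1 nX2 t.
  apply: le_trans; rewrite le_eqVlt; apply/orP; left; apply/eqP.
  have tI : t \in `[0, T] by rewrite in_itv /= t0.
  have m z : measurable_fun setT (X z t : Omega -> borel_rV R d).
    by have [mX _ _ _ _] := hX z; exact: mX.
  have mc z : z \in [:: x; x + u; x - u] ->
      measurable_fun setT (c (X z) t : Omega -> borel_rV R d).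
    by move=> /nX[mX _ _ _ _]; exact: (jointly_measurable_slice t mX).
  apply: ae_eq_integral => //.
  + apply/measurable_EFinP; apply: (measurableT_comp measurable_rV_norm).
    by apply: measurable_rVB => //; apply: measurable_rVB => //; exact: measurable_rVD.
  + apply/measurable_EFinP; apply: (measurableT_comp measurable_rV_norm).
    have m0 := mc x (mem_head _ _).
    have m1 := mc (x + u) ltac:(by rewrite !inE eqxx orbT).
    have m2 := mc (x - u) ltac:(by rewrite !inE eqxx !orbT).
    by apply: measurable_rVB => //; apply: measurable_rVB => //; exact: measurable_rVD.
  + exists N; split => // w /= H; apply: contrapT => Nw; apply: H => _.
    by rewrite !cE.
Qed.

End field_estimates.

(** * The modification and its Jacobian *)

Section random_fields.
Context {R : realType} {disp : measure_display} {Omega : measurableType disp}.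
Variables (P : probability Omega R) (d : nat).
Local Notation V := 'rV[R]_d.
Local Notation BV := (borel_rV R d).
Variables (Z : V -> Omega -> V) (C : R).
Hypotheses (C0 : 0 <= C) (mZ : forall x, measurable_fun setT (Z x : Omega -> BV)).
Hypothesis Z1 : forall x u, {ae P, forall w, `|Z (x + u) w - Z x w| <= C * `|u|}.
Hypothesis Z2 : forall x u, {ae P, forall w,
  `|Z (x + u) w + Z (x - u) w - Z x w - Z x w| <= C * (`|u| * Num.sqrt `|u|)}.

Lemma negligible_countable (I : countType) (N : I -> set Omega) :
  (forall i, P.-negligible (N i)) -> P.-negligible (\bigcup_i N i).
Proof.
move=> NN; pose F n := if unpickle n is Some i then N i else set0.
apply: negligibleS (negligible_bigcup (F := F) _) => [w [i _ Ni]|n].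
  by exists (pickle i) => //; rewrite /F pickleK.
by rewrite /F; case: unpickle => [i|] //; exact: negligible_set0.
Qed.

Let rv (q : 'rV[rat]_d) : V := map_mx ratr q.

Let rvD q q' : rv q + rv q' = rv (q + q').
Proof. by rewrite /rv map_mxD. Qed.

Let rvB q q' : rv q - rv q' = rv (q - q').
Proof. by rewrite /rv map_mxB. Qed.

Let approx (x : V) n : exists q, `|x - rv q| <= 2^-1 ^+ n.
Proof.
have h0 : 0 < 2^-1 ^+ n :> R by rewrite exprn_gt0 // invr_gt0.
have H i : exists q : rat, `|x ord0 i - ratr q| <= 2^-1 ^+ n.
  have xx : x ord0 i < x ord0 i + 2^-1 ^+ n by rewrite ltrDl.
  have [q] := rat_in_itvoo xx; rewrite in_itv /= => /andP[q1 q2].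
  by exists q; rewrite ler_norml; apply/andP; split; lra.
have [q Hq] := choice H.
exists (\row_i q i); apply: rV_norm_le => [|i]; first exact: ltW.
by rewrite !mxE.
Qed.

Let ap (x : V) n := projT1 (cid (approx x n)).

Let apP x n : `|x - rv (ap x n)| <= 2^-1 ^+ n.
Proof. exact: projT2 (cid (approx x n)). Qed.

Let bad (i : 'rV[rat]_d * 'rV[rat]_d) : set Omega :=
  ~` [set w | `|Z (rv i.1 + rv i.2) w - Z (rv i.1) w| <= C * `|rv i.2| ] `|`
  ~` [set w | `|Z (rv i.1 + rv i.2) w + Z (rv i.1 - rv i.2) w - Z (rv i.1) w - Z (rv i.1) w|
     <= C * (`|rv i.2| * Num.sqrt `|rv i.2|) ].

Let badN : P.-negligible (\bigcup_i bad i).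
Proof. by apply: negligible_countable => i; exact: negligibleU (Z1 _ _) (Z2 _ _). Qed.

Let N := projT1 (cid badN).
Let NE : [/\ measurable N, P N = 0%E & \bigcup_i bad i `<=` N].
Proof. exact: projT2 (cid badN). Qed.

Let Z' x w : V := if w \in N then 0 else Z x w.

Let Z'1 q q' w : `|Z' (rv q) w - Z' (rv q') w| <= C * `|rv q - rv q'|.
Proof.
rewrite /Z'; case: ifPn => wN; first by rewrite subrr normr0 mulr_ge0.
move: wN; rewrite notin_setE => Nw; apply: contrapT => H; apply: Nw.
have [_ _ sN] := NE; apply: sN; exists (q', q - q') => //; left => /= H'; apply: H.
by move: H'; rewrite -rvB (addrC (rv q')) subrK.
Qed.

Let Z'2 q v w : `|Z' (rv q + rv v) w + Z' (rv q - rv v) w - Z' (rv q) w - Z' (rv q) w|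
  <= C * (`|rv v| * Num.sqrt `|rv v|).
Proof.
rewrite /Z'; case: ifPn => wN.
  by rewrite addr0 !subr0 normr0 !mulr_ge0 ?sqrtr_ge0.
move: wN; rewrite notin_setE => Nw; apply: contrapT => H; apply: Nw.
by have [_ _ sN] := NE; apply: sN; exists (q, v) => //; right.
Qed.

Let mZ' x : measurable_fun setT (Z' x : Omega -> BV).
Proof.
have [mN _ _] := NE.
apply: measurable_fun_if => //.
- apply: (measurable_fun_bool true).
  rewrite setTI (_ : _ @^-1` _ = N) //.
  by apply/seteqP; split => w /=; [move=> /set_mem|move=> ?; exact: mem_set].
- exact: measurable_funTS.
Qed.

Let Z'E x : {ae P, forall w, Z' x w = Z x w}.
Proof.
have [mN PN _] := NE; exists N; split => // w H; apply: contrapT => Nw; apply: H.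
by rewrite /= /Z' ifN // notin_setE.
Qed.

Let K : R := 3 * C / (1 - 2^-1).

Let h0 : 0 <= 2^-1 :> R. Proof. by rewrite invr_ge0. Qed.
Let h1 : 2^-1 < 1 :> R. Proof. by rewrite invf_lt1 // ltr1n. Qed.

Let Y_exists : exists Y : V -> Omega -> V, forall x w n,
  `|Z' (rv (ap x n)) w - Y x w| <= K * 2^-1 ^+ n.
Proof.
have C3 : 0 <= 3 * C by rewrite mulr_ge0.
have H x w i : exists l, forall n,
    `|Z' (rv (ap x n)) w ord0 i - l| <= K * 2^-1 ^+ n.
  apply: geometric_limit => // n.
  rewrite rV_entryB; apply: le_trans (mx_entry_norm_le _ _ _) _.
  apply: le_trans (Z'1 _ _ _) _.
  have -> : rv (ap x n.+1) - rv (ap x n) = (x - rv (ap x n)) - (x - rv (ap x n.+1)).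
    by move: (rv _) (rv _) => a1 a2; vring.
  rewrite -(mulrA 3) mulrCA; apply: ler_wpM2l => //; apply: le_trans (ler_normB _ _) _.
  apply: le_trans (lerD (apP x n) (apP x n.+1)) _.
  have p0 : 0 <= 2^-1 ^+ n :> R by rewrite exprn_ge0.
  by rewrite exprS; lra.
exists (fun x w => \row_i projT1 (cid (H x w i))) => x w n.
apply: rV_norm_le => [|i].
  apply: mulr_ge0; last exact: exprn_ge0.
  by rewrite /K divr_ge0 // subr_ge0 ltW.
by rewrite -rV_entryB row_entry; exact: projT2 (cid (H x w i)) n.
Qed.

Lemma field_modification : exists Y : V -> Omega -> V,
  [/\ forall x, measurable_fun setT (Y x : Omega -> BV) /\ {ae P, forall w, Y x w = Z x w},
      forall w x v, `|Y (x + v) w - Y x w| <= C * `|v| &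
      forall w x v, `|Y (x + v) w + Y (x - v) w - Y x w - Y x w|
        <= C * (`|v| * Num.sqrt `|v|)].
Proof.
have [Y HY] := Y_exists.
have K0 : 0 <= K by rewrite divr_ge0 ?mulr_ge0 // subr_ge0 ltW.
have Yq q w : Y (rv q) w = Z' (rv q) w.
  apply/eqP; rewrite -subr_eq0 -normr_le0.
  apply: (@geometric_squeeze _ 2^-1 (K + C) _ h0 h1) => n.
  have -> : Y (rv q) w - Z' (rv q) w =
      - (Z' (rv (ap (rv q) n)) w - Y (rv q) w) - (Z' (rv q) w - Z' (rv (ap (rv q) n)) w).
    by move: (Y _ _) (Z' _ _) (Z' _ _) => a1 a2 a3; vring.
  apply: le_trans (ler_normB _ _) _; rewrite normrN mulrDl; apply: lerD; first exact: HY.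
  apply: le_trans (Z'1 _ _ _) _; exact: ler_wpM2l.
have Y1 w x y : `|Y x w - Y y w| <= C * `|x - y|.
  rewrite -subr_le0; apply: (@geometric_squeeze _ 2^-1 (K + K + C * 2) _ h0 h1) => n.
  rewrite lerBlDl.
  have e1 : Y x w - Y y w = - (Z' (rv (ap x n)) w - Y x w) + (Z' (rv (ap y n)) w - Y y w)
      + (Z' (rv (ap x n)) w - Z' (rv (ap y n)) w).
    by move: (Y _ _) (Y _ _) (Z' _ _) (Z' _ _) => a1 a2 a3 a4; vring.
  have e2 : rv (ap x n) - rv (ap y n) = (x - y) + (- (x - rv (ap x n)) + (y - rv (ap y n))).
    by move: (rv _) (rv _) => a1 a2; vring.
  rewrite e1; apply: le_trans (ler_normD _ _) _.
  apply: le_trans (lerD (ler_normD _ _) (Z'1 _ _ _)) _; rewrite normrN.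
  apply: le_trans (lerD (lerD (HY x w n) (HY y w n)) (ler_wpM2l C0 (_ : _ <= `|x - y| + (2^-1 ^+ n + 2^-1 ^+ n)))) _.
    rewrite e2; apply: le_trans (ler_normD _ _) _; rewrite lerD2l.
    by apply: le_trans (ler_normD _ _) _; rewrite normrN; apply: lerD.
  by rewrite le_eqVlt; apply/orP; left; apply/eqP; ring.
exists Y; split.
- move=> x; split.
    apply: measurable_to_rV => i.
    apply: (@measurable_fun_cvg _ _ _ _ (fun n w => Z' (rv (ap x n)) w ord0 i)) => [n|w _].
      exact: (measurableT_comp (measurable_rV_coord i) (mZ' _)).
    apply/cvgrPdist_le => e e0.
    have cg : K * 2^-1 ^+ n @[n --> \oo] --> (0 : R).
      by have := @cvg_geometric R K 2^-1 _; rewrite ger0_norm //; exact.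
    move/cvgrPdist_le: cg => /(_ e e0); apply: filterS => n; rewrite sub0r normrN => He.
    have H : `|Y x w ord0 i - Z' (rv (ap x n)) w ord0 i| <= K * 2^-1 ^+ n.
      rewrite rV_entryB; apply: le_trans (mx_entry_norm_le _ _ _) _.
      by rewrite distrC; exact: HY.
    exact: le_trans H (le_trans (ler_norm _) He).
  have H n : {ae P, forall w, `|Z x w - Z (rv (ap x n)) w| <= C * 2^-1 ^+ n}.
    apply: negligibleS (Z1 (rv (ap x n)) (x - rv (ap x n))) => w /= H H'; apply: H.
    rewrite (addrC (rv _)) subrK in H'; apply: le_trans H' _.
    exact: ler_wpM2l.
  apply: negligibleS (negligibleU (negligible_bigcup H)
    (negligible_bigcup (fun n => Z'E (rv (ap x n))))) => w nE.
  apply: contrapT => nH; apply: nE; apply/eqP; rewrite -subr_eq0 -normr_le0.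
  apply: (@geometric_squeeze _ 2^-1 (K + C) _ h0 h1) => n.
  have a1 : `|Z x w - Z (rv (ap x n)) w| <= C * 2^-1 ^+ n.
    by apply: contrapT => H1; apply: nH; left; exists n.
  have a2 : Z' (rv (ap x n)) w = Z (rv (ap x n)) w.
    by apply: contrapT => H1; apply: nH; right; exists n.
  have a3 := HY x w n; rewrite a2 in a3.
  have -> : Y x w - Z x w = - (Z (rv (ap x n)) w - Y x w) - (Z x w - Z (rv (ap x n)) w).
    by move: (Y _ _) (Z _ _) (Z _ _) => b1 b2 b3; vring.
  apply: le_trans (ler_normB _ _) _; rewrite normrN mulrDl; exact: lerD.
- move=> w x v; apply: le_trans (Y1 w _ _) _.
  by rewrite (addrC x) addrK.
- move=> w x v.
  pose r : R := Num.sqrt 2^-1.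
  have r0 : 0 <= r := sqrtr_ge0 _.
  have r1 : r < 1 by rewrite -[ltRHS]sqrtr1 ltr_sqrt.
  have hr n : 2^-1 ^+ n = r ^+ n * r ^+ n.
    by rewrite -exprMn -expr2 sqr_sqrtr.
  have hr1 n : 2^-1 ^+ n <= r ^+ n.
    by rewrite hr -[leRHS]mulr1; apply: ler_wpM2l; rewrite ?exprn_ge0 // exprn_ile1 // ltW.
  pose s := `|v|; pose c := C * (s + Num.sqrt s + 1) + 6 * C.
  rewrite -subr_le0; apply: (@geometric_squeeze _ r c _ r0 r1) => n; rewrite lerBlDl.
  pose q := ap x n; pose p := ap v n.
  have hx : `|x - rv q| <= r ^+ n := le_trans (apP x n) (hr1 n).
  have hv : `|v - rv p| <= r ^+ n := le_trans (apP v n) (hr1 n).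
  have S := Z'2 q p w; rewrite rvD rvB -!Yq -rvD -rvB in S.
  have pv : `|rv p| <= s + r ^+ n * r ^+ n.
    rewrite -hr -(subrK v (rv p)) addrC; apply: le_trans (ler_normD _ _) _.
    by rewrite lerD2l distrC; exact: apP.
  have rn0 : 0 <= r ^+ n by rewrite exprn_ge0.
  have rn1 : r ^+ n <= 1 by rewrite exprn_ile1 // ltW.
  have s0 : 0 <= s by exact: normr_ge0.
  have ss0 : 0 <= Num.sqrt s := sqrtr_ge0 _.
  have sq : Num.sqrt `|rv p| <= Num.sqrt s + r ^+ n.
    apply: le_trans (ler_wsqrtr pv) _.
    have sr0 : 0 <= Num.sqrt s + r ^+ n by exact: addr_ge0.
    rewrite -[leRHS]ger0_norm // -sqrtr_sqr; apply: ler_wsqrtr.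
    rewrite sqrrD sqr_sqrtr // expr2 lerD2r lerDl.
    by rewrite mulrn_wge0 // mulr_ge0.
  have {}S : `|Y (rv q + rv p) w + Y (rv q - rv p) w - Y (rv q) w - Y (rv q) w|
      <= C * (s * Num.sqrt s) + C * (s + Num.sqrt s + 1) * r ^+ n.
    apply: le_trans S _; rewrite -mulrA -mulrDr; apply: ler_wpM2l => //.
    apply: (@le_trans _ _ ((s + r ^+ n * r ^+ n) * (Num.sqrt s + r ^+ n))).
      by apply: ler_pM; rewrite ?sqrtr_ge0.
    have m1 : r ^+ n * r ^+ n * Num.sqrt s <= r ^+ n * Num.sqrt s.
      by apply: ler_wpM2r => //; rewrite -[leRHS]mulr1; exact: ler_wpM2l.
    have m2 : r ^+ n * r ^+ n * r ^+ n <= r ^+ n.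
      by rewrite -[leRHS]mul1r; apply: ler_wpM2r => //; rewrite -[leRHS]mulr1; exact: ler_pM.
    lra.
  have e1 : x + v - (rv q + rv p) = (x - rv q) + (v - rv p).
    by move: (rv _) (rv _) => a1 a2; vring.
  have e2 : x - v - (rv q - rv p) = (x - rv q) - (v - rv p).
    by move: (rv _) (rv _) => a1 a2; vring.
  have D1 : `|Y (x + v) w - Y (rv q + rv p) w| <= C * (r ^+ n + r ^+ n).
    apply: le_trans (Y1 w _ _) _; rewrite e1; apply: ler_wpM2l => //.
    by apply: le_trans (ler_normD _ _) _; exact: lerD.
  have D2 : `|Y (x - v) w - Y (rv q - rv p) w| <= C * (r ^+ n + r ^+ n).
    apply: le_trans (Y1 w _ _) _; rewrite e2; apply: ler_wpM2l => //.
    by apply: le_trans (ler_normB _ _) _; exact: lerD.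
  have D3 : `|Y x w - Y (rv q) w| <= C * r ^+ n.
    by apply: le_trans (Y1 w _ _) _; exact: ler_wpM2l.
  have -> : Y (x + v) w + Y (x - v) w - Y x w - Y x w =
      (Y (rv q + rv p) w + Y (rv q - rv p) w - Y (rv q) w - Y (rv q) w)
      + (Y (x + v) w - Y (rv q + rv p) w) + (Y (x - v) w - Y (rv q - rv p) w)
      - (Y x w - Y (rv q) w) - (Y x w - Y (rv q) w).
    move: (Y _ _) (Y _ _) (Y x w) (Y _ _) (Y _ _) (Y _ _) => a1 a2 a3 a4 a5 a6.
    by vring.
  apply: le_trans (ler_normB _ _) _; apply: le_trans (lerD (ler_normB _ _) D3) _.
  apply: le_trans (lerD (lerD (ler_normD _ _) D3) (lexx _)) _.
  apply: le_trans (lerD (lerD (lerD (ler_normD _ _) D2) (lexx _)) (lexx _)) _.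
  apply: le_trans (lerD (lerD (lerD (lerD S D1) (lexx _)) (lexx _)) (lexx _)) _.
  by rewrite /c -/s le_eqVlt; apply/orP; left; apply/eqP; ring.
Qed.

End random_fields.

Lemma mx_entryB {A : zmodType} m n (M N : 'M[A]_(m, n)) i j :
  (M - N) i j = M i j - N i j.
Proof. by rewrite !mxE. Qed.

Lemma triangle_split {A : zmodType} (a1 a2 s1 s2 : A) :
  a1 - a2 = (s1 - s2) - (s1 - a1) + (s2 - a2).
Proof.
by rewrite opprB (addrC (s1 - s2)) !addrA !subrK.
Qed.

Section jacobian_field.
Context {R : realType} {disp : measure_display} {Omega : measurableType disp}.
Variables (P : probability Omega R) (d : nat).
Local Notation V := 'rV[R]_d.
Local Notation BV := (borel_rV R d).
Variables (Y : V -> Omega -> V) (C : R).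
Hypotheses (C0 : 0 <= C) (mY : forall x, measurable_fun setT (Y x : Omega -> BV)).
Hypothesis Y1 : forall w x v, `|Y (x + v) w - Y x w| <= C * `|v|.
Hypothesis Y2 : forall w x v,
  `|Y (x + v) w + Y (x - v) w - Y x w - Y x w| <= C * (`|v| * Num.sqrt `|v|).
Hypothesis YE : forall x v,
  \int[P]_w `|Y (x + v) w + Y (x - v) w - Y x w - Y x w| <= C * `|v| ^+ 2.

Definition field_jacobian (x : V) (w : Omega) : 'M[R]_d := jacobian (Y^~ w) x.

Let r : R := Num.sqrt 2^-1.
Let K : R := C / (1 - r).

Let r0 : 0 <= r. Proof. exact: sqrtr_ge0. Qed.
Let r1 : r < 1. Proof. by rewrite -[ltRHS]sqrtr1 ltr_sqrt // invf_lt1 // ltr1n. Qed.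

Let zyg w := zygmund_C1 C0 C0 (Y1 w) (Y2 w).

Let K0 : 0 <= K. Proof. by rewrite divr_ge0 // subr_ge0 ltW. Qed.

Lemma field_C1 w : C1 (Y^~ w). Proof. by case: (zyg w). Qed.

Lemma field_jacobian_bound x w i j : `|field_jacobian x w i j| <= C.
Proof. by case: (zyg w) => _ _; exact. Qed.

Let slope n x i w : V := 2 ^+ n *: (Y (x + 2 ^- n *: 'e_i) w - Y x w).

Let slope_rate x i n j w : `|slope n x i w ord0 j - field_jacobian x w i j| <= K * r ^+ n.
Proof.
have [_ H _] := zyg w; apply: le_trans (H x i n j); rewrite /slope.
have -> : forall (a : R) (v : V), (a *: v) ord0 j = a * v ord0 j by move=> a v; rewrite mxE.
by [].
Qed.

Let mslope n x i : measurable_fun setT (slope n x i : Omega -> BV).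
Proof. by apply: measurable_rVZ; exact: measurable_rVB. Qed.

Lemma measurable_field_jacobian x i j :
  measurable_fun setT (fun w => field_jacobian x w i j : measurableTypeR R).
Proof.
apply: (@measurable_fun_cvg _ _ _ _ (fun n w => slope n x i w ord0 j)) => [n|w _].
  exact: (measurableT_comp (measurable_rV_coord j) (mslope n x i)).
apply/cvgrPdist_le => e e0.
have cg : K * r ^+ n @[n --> \oo] --> (0 : R).
  by have := @cvg_geometric R K r _; rewrite ger0_norm //; exact.
move/cvgrPdist_le: cg => /(_ e e0); apply: filterS => n; rewrite sub0r normrN => He.
have H := slope_rate x i n j w; rewrite distrC in H.
exact: le_trans H (le_trans (ler_norm _) He).
Qed.

Let mixed x h k w : V := Y (x + k + h) w - Y (x + k) w - (Y (x + h) w - Y x w).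

Let mixedD x h k1 k2 w : mixed x h (k1 + k2) w = mixed x h k1 w + mixed (x + k1) h k2 w.
Proof.
rewrite /mixed addrA.
by move: (Y _ _) (Y _ _) (Y _ _) (Y _ _) (Y _ _) (Y _ _) => a1 a2 a3 a4 a5 a6; vring.
Qed.

Let bmf_mixed x h k : bmf (fun w => `|mixed x h k w|).
Proof.
split; first by apply: (measurableT_comp measurable_rV_norm); do !apply: measurable_rVB.
exists (C * `|h| + C * `|h|) => w; rewrite normr_id.
by apply: le_trans (ler_normB _ _) _; exact: lerD.
Qed.

Let mixed_mean x h k s : `|h| <= s -> `|k| <= s ->
  \int[P]_w `|mixed x h k w| <= 2 * C * s ^+ 2.
Proof.
move=> hs ks; have s0 : 0 <= s := le_trans (normr_ge0 h) hs.
pose p := 2^-1 *: (h + k); pose m := 2^-1 *: (h - k); pose c := x + p.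
have e1 : x + k + h = c + p by rewrite /c /p; apply/rowP => i; rewrite !mxE; field.
have e2 : x = c - p by rewrite /c /p; apply/rowP => i; rewrite !mxE; field.
have e3 : x + h = c + m by rewrite /c /p /m; apply/rowP => i; rewrite !mxE; field.
have e4 : x + k = c - m by rewrite /c /p /m; apply/rowP => i; rewrite !mxE; field.
have bS v : bmf (fun w => `|Y (c + v) w + Y (c - v) w - Y c w - Y c w|).
  split.
    apply: (measurableT_comp measurable_rV_norm).
    by apply: measurable_rVB => //; apply: measurable_rVB => //; exact: measurable_rVD.
  by exists (C * (`|v| * Num.sqrt `|v|)) => w; rewrite normr_id.
have half (z : V) : `|z| <= 2 * s -> `|2^-1 *: z| ^+ 2 <= s ^+ 2.
  move=> zs; rewrite lerXn2r ?nnegrE // normrZ ger0_norm ?invr_ge0 //.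
  by rewrite ler_pdivrMl.
have hk : `|h| + `|k| <= 2 * s by lra.
apply: (@le_trans _ _ (\int[P]_w (`|Y (c + p) w + Y (c - p) w - Y c w - Y c w| +
    `|Y (c + m) w + Y (c - m) w - Y c w - Y c w|))).
  apply: bmf_int_le; [exact: bmf_mixed|exact: bmfD|move=> w].
  rewrite /mixed e4 e3 -[in Y (c - m + h)]e4 e1 [in Y x w]e2.
  have -> : Y (c + p) w - Y (c - m) w - (Y (c + m) w - Y (c - p) w) =
     (Y (c + p) w + Y (c - p) w - Y c w - Y c w) - (Y (c + m) w + Y (c - m) w - Y c w - Y c w).
    by move: (Y _ _) (Y _ _) (Y _ _) (Y _ _) (Y _ _) => y1 y2 y3 y4 y5; vring.
  exact: ler_normB.
rewrite (bmf_intD P (bS p) (bS m)).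
have H1 : \int[P]_w `|Y (c + p) w + Y (c - p) w - Y c w - Y c w| <= C * s ^+ 2.
  apply: le_trans (YE c p) _; apply: ler_wpM2l => //; apply: half.
  exact: le_trans (ler_normD _ _) hk.
have H2 : \int[P]_w `|Y (c + m) w + Y (c - m) w - Y c w - Y c w| <= C * s ^+ 2.
  apply: le_trans (YE c m) _; apply: ler_wpM2l => //; apply: half.
  exact: le_trans (ler_normB _ _) hk.
by apply: le_trans (lerD H1 H2) _; rewrite le_eqVlt; apply/orP; left; apply/eqP; ring.
Qed.

Let mixed_chain x h k s N : `|h| <= s -> `|k| <= s ->
  \int[P]_w `|mixed x h (N%:R *: k) w| <= N%:R * (2 * C * s ^+ 2).
Proof.
move=> hs ks; elim: N => [|N IH].
  rewrite mul0r scale0r -[leRHS](int_prob_cst P 0).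
  apply: bmf_int_le; [exact: bmf_mixed|exact: bmf_cst|move=> w].
  by rewrite /mixed addr0 subrr normr0.
apply: (@le_trans _ _ (\int[P]_w (`|mixed x h (N%:R *: k) w| + `|mixed (x + N%:R *: k) h k w|))).
  apply: bmf_int_le; [exact: bmf_mixed|by apply: bmfD; exact: bmf_mixed|move=> w].
  by rewrite -natr1 scalerDl scale1r mixedD; exact: ler_normD.
rewrite (bmf_intD P (bmf_mixed _ _ _) (bmf_mixed _ _ _)) -natr1 mulrDl mul1r.
by apply: lerD => //; exact: mixed_mean.
Qed.

(* The two increments may have very different lengths, so the longer one is cut
   into pieces comparable to the shorter one before polarising. *)
Lemma field_jacobian_mean x y i j :
  \int[P]_w `|field_jacobian x w i j - field_jacobian y w i j| <= 2 * C * `|x - y|.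
Proof.
have bJ z : bmf (fun w => field_jacobian z w i j).
  by split; [exact: measurable_field_jacobian|exists C => w; exact: field_jacobian_bound].
have bD : bmf (fun w => `|field_jacobian x w i j - field_jacobian y w i j|).
  exact: bmf_norm (bmfB (bJ x) (bJ y)).
rewrite -subr_le0; apply: (@geometric_squeeze _ r (2 * C + 2 * K) _ r0 r1) => n.
rewrite lerBlDl.
pose s : R := 2 ^- n; pose h : V := s *: 'e_i.
have p0 : 0 < 2 ^+ n :> R by rewrite exprn_gt0.
have s0 : 0 < s by rewrite invr_gt0.
have sr : s <= r ^+ n.
  have -> : s = r ^+ n * r ^+ n by rewrite -exprMn -expr2 sqr_sqrtr ?invr_ge0 // exprVn.
  by rewrite -[leRHS]mulr1; apply: ler_wpM2l; rewrite ?exprn_ge0 // exprn_ile1 // ltW.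
have hs : `|h| <= s.
  rewrite /h normrZ ger0_norm ?(ltW s0) // -[leRHS]mulr1; apply: ler_wpM2l; first exact: ltW.
  by apply: rV_norm_le => // k; rewrite mxE eqxx /=; case: eqP => _; rewrite ?normr1 ?normr0.
pose N := (Num.truncn (`|x - y| / s)).+1.
have q0 : 0 <= `|x - y| / s by rewrite divr_ge0 // ltW.
have /andP[N1 N2] := truncn_itv q0; rewrite -/N in N2.
have N0 : 0 < N%:R :> R by rewrite ltr0n.
have Nle : N%:R * s <= `|x - y| + s.
  rewrite /N -natr1 mulrDl mul1r lerD2r.
  by rewrite -ler_pdivlMr.
pose k := N%:R^-1 *: (x - y).
have ks : `|k| <= s.
  rewrite /k normrZ ger0_norm ?invr_ge0 ?(ltW N0) // ler_pdivrMl //.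
  by rewrite ltr_pdivrMr // in N2; exact: ltW.
have Nk : N%:R *: k = x - y by rewrite /k scalerA mulfV ?scale1r // gt_eqF.
have Hm := mixed_chain y N hs ks; rewrite Nk in Hm.
have yx : y + (x - y) = x by rewrite addrC subrK.
have bM := bmf_mixed y h (x - y).
have bR : bmf (fun w => 2 ^+ n * `|mixed y h (x - y) w|) by exact: bmfM (bmf_cst _) bM.
apply: (@le_trans _ _ (\int[P]_w (2 ^+ n * `|mixed y h (x - y) w| + 2 * K * r ^+ n))).
  apply: bmf_int_le => //; first by apply: bmfD => //; exact: bmf_cst.
  move=> w; have H1 := slope_rate x i n j w; have H2 := slope_rate y i n j w.
  have H3 : `|slope n x i w ord0 j - slope n y i w ord0 j| <= 2 ^+ n * `|mixed y h (x - y) w|.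
    rewrite rV_entryB; apply: le_trans (mx_entry_norm_le _ _ _) _.
    by rewrite /slope /mixed yx -scalerBr normrZ ger0_norm // ltW.
  rewrite (triangle_split _ _ (slope n x i w ord0 j) (slope n y i w ord0 j)).
  apply: le_trans (ler_normD _ _) _; apply: le_trans (lerD (ler_normB _ _) H2) _.
  apply: le_trans (lerD (lerD H3 H1) (lexx _)) _.
  by rewrite le_eqVlt; apply/orP; left; apply/eqP; ring.
rewrite (bmf_intD P bR (bmf_cst (2 * K * r ^+ n))) (bmf_intZ P (2 ^+ n) bM).
rewrite (int_prob_cst P (2 * K * r ^+ n)).
have H4 : 2 ^+ n * \int[P]_w `|mixed y h (x - y) w| <= 2 * C * (`|x - y| + r ^+ n).
  apply: le_trans (ler_wpM2l (ltW p0) Hm) _.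
  have -> : 2 ^+ n * (N%:R * (2 * C * s ^+ 2)) = 2 * C * (N%:R * s).
    by rewrite /s; field; rewrite expf_neq0.
  apply: ler_wpM2l; first by rewrite mulr_ge0.
  by apply: le_trans Nle _; rewrite lerD2l.
apply: le_trans (lerD H4 (lexx _)) _.
by rewrite le_eqVlt; apply/orP; left; apply/eqP; ring.
Qed.

Lemma enorm_sum m n (A : 'M[R]_(m, n)) :
  enorm A <= (m * n)%:R * \sum_i \sum_j `|A i j|.
Proof.
apply: le_trans (enorm_le A) _; apply: ler_wpM2l => //.
apply: mx_norm_le => [|i j]; first by apply: sumr_ge0 => i _; exact: sumr_ge0.
rewrite (bigD1 i) //= (bigD1 j) //= -addrA lerDl; apply: addr_ge0; apply: sumr_ge0 => // k _.
exact: sumr_ge0.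
Qed.

Lemma measurable_enorm m n (A : Omega -> 'M[R]_(m, n)) :
  (forall i j, measurable_fun setT (fun w => A w i j : measurableTypeR R)) ->
  measurable_fun setT (fun w => enorm (A w)).
Proof.
move=> mA; apply: measurableT_comp; first exact: continuous_measurable_fun (@sqrt_continuous R).
apply: measurable_sum => i; apply: measurable_sum => j.
under eq_fun do rewrite expr2; exact: (measurable_funM (mA i j) (mA i j)).
Qed.

Lemma field_jacobian_enorm_mean x y :
  ('E_P[fun w => enorm (field_jacobian x w - field_jacobian y w)]
    <= ((d * d)%:R * (d%:R * (d%:R * (2 * C))) * enorm (x - y))%:E)%E.
Proof.
have mJ i j : measurable_fun setT
    (fun w => (field_jacobian x w - field_jacobian y w) i j : measurableTypeR R).
  have := measurable_funB (measurable_field_jacobian x i j) (measurable_field_jacobian y i j).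
  by apply: eq_measurable_fun => w _; rewrite mx_entryB.
have bJ i j : bmf (fun w => `|(field_jacobian x w - field_jacobian y w) i j|).
  split; first by apply: measurableT_comp => //; exact: mJ.
  exists (C + C) => w; rewrite normr_id mx_entryB.
  by apply: le_trans (ler_normB _ _) _; apply: lerD; exact: field_jacobian_bound.
have bS : bmf (fun w => \sum_i \sum_j `|(field_jacobian x w - field_jacobian y w) i j|).
  by apply: bmf_sum => i; exact: bmf_sum.
have bE : bmf (fun w => enorm (field_jacobian x w - field_jacobian y w)).
  split; first exact: measurable_enorm.
  have [_ [M HM]] := bS; exists ((d * d)%:R * M) => w.
  rewrite ger0_norm ?enorm_ge0 //; apply: le_trans (enorm_sum _) _.
  by apply: ler_wpM2l => //; exact: le_trans (ler_norm _) (HM w).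
rewrite unlock -(bmf_intE P bE) lee_fin.
apply: (@le_trans _ _ (\int[P]_w ((d * d)%:R *
    \sum_i \sum_j `|(field_jacobian x w - field_jacobian y w) i j|))).
  apply: bmf_int_le => //; first exact: bmfM (bmf_cst _) bS.
  by move=> w; exact: enorm_sum.
rewrite (bmf_intZ P (d * d)%:R bS) -!mulrA; apply: ler_wpM2l => //.
rewrite (bmf_int_sum P _ (fun i => bmf_sum _ (bJ i))).
apply: (@le_trans _ _ (\sum_(i < d) \sum_(j < d) (2 * C * enorm (x - y)))).
  apply: ler_sum => i _; rewrite (bmf_int_sum P _ (bJ i)); apply: ler_sum => j _.
  apply: le_trans (ler_wpM2l _ (mx_norm_enorm (x - y))); last by rewrite mulr_ge0.
  apply: le_trans (field_jacobian_mean x y i j).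
  rewrite le_eqVlt; apply/orP; left; apply/eqP; apply: eq_Rintegral => w _.
  by rewrite mx_entryB.
rewrite !sumr_const !card_ord -[leLHS]mulrnA -[leLHS]mulr_natl natrM.
by rewrite le_eqVlt; apply/orP; left; apply/eqP; ring.
Qed.

Lemma field_jacobian_moment (p : R) x : 0 <= p ->
  ('E_P[fun w => (enorm (field_jacobian x w) `^ p)%R]
    <= (((d * d)%:R * C) `^ p)%:E)%E.
Proof.
move=> p0; rewrite unlock.
have mE : measurable_fun setT (fun w => enorm (field_jacobian x w) `^ p).
  apply: (measurableT_comp (measurable_powR p)).
  by apply: measurable_enorm => i j; exact: measurable_field_jacobian.
apply: (@le_trans _ _ (\int[P]_w (((d * d)%:R * C) `^ p)%:E)%E); last first.
  by rewrite integral_cst // [X in (_ * X)%E](probability_setT P) mule1.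
apply: ge0_le_integral => //.
- by move=> w _; rewrite lee_fin powR_ge0.
- exact/measurable_EFinP.
move=> w _; rewrite lee_fin; apply: ge0_ler_powR => //; rewrite ?nnegrE ?enorm_ge0 ?mulr_ge0 //.
apply: le_trans (enorm_le _) _; apply: ler_wpM2l => //.
by apply: mx_norm_le => // i j; exact: field_jacobian_bound.
Qed.

End jacobian_field.

Theorem proposition4p1 (R : realType) (disp : measure_display)
  (Omega : measurableType disp) (P : probability Omega R)
  (d : nat) (T : R) (hd : (1 <= d)%N) (hT : 0 < T)
  (B : R -> Omega -> 'rV[R]_d) (hB : brownian_motion P T B)
  (b phi : R -> 'rV[R]_d -> 'rV[R]_d -> 'rV[R]_d)
  (hb : coeff_class T b) (hphi : coeff_class T phi)
  (X : 'rV[R]_d -> R -> Omega -> 'rV[R]_d)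
  (hX : forall x, strong_solution P T B b phi x (X x)) :
  exists J : 'rV[R]_d -> R -> Omega -> 'M[R]_d,
    [/\ C1_first_variation P T X J,
        (forall K : set 'rV[R]_d, compact K ->
           exists2 C : R, 0 < C &
             forall (t : R) (x y : 'rV[R]_d), t \in `[0, T] -> K x -> K y ->
               ('E_P[fun w => enorm (J x t w - J y t w)]
                  <= (C * enorm (x - y))%:E)%E) &
        (forall (K : set 'rV[R]_d) (p : R), compact K -> 1 <= p ->
           (ereal_sup
              [set ereal_sup
                 [set 'E_P[fun w => (enorm (J x t w) `^ p)%R] `^ p^-1 | x in K]
              | t in (`[0%R, T]%classic : set R)] < +oo)%E)].
Proof.
have [C C0 HC] := field_estimates hT hB hb hphi hX.
have mX x t : t \in `[0, T] -> random_vector (X x t) by case: (hX x) => + _ _ _ _; exact.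
have modification t : exists Y : 'rV[R]_d -> Omega -> 'rV[R]_d, t \in `[0, T] ->
    [/\ forall x, random_vector (Y x) /\ {ae P, forall w, Y x w = X x t w},
        forall w x v, `|Y (x + v) w - Y x w| <= C * `|v|,
        forall w x v, `|Y (x + v) w + Y (x - v) w - Y x w - Y x w|
          <= C * (`|v| * Num.sqrt `|v|) &
        forall x v, \int[P]_w `|Y (x + v) w + Y (x - v) w - Y x w - Y x w|
          <= C * `|v| ^+ 2].
  have [tI|tI] := boolP (t \in `[0, T]); last by exists (fun _ _ => 0).
  have /andP[t0 tT] : 0 <= t <= T by move: tI; rewrite in_itv.
  have Z1 x u : {ae P, forall w, `|X (x + u) t w - X x t w| <= C * `|u|}.
    by have [H _ _] := HC x u; apply: filterS H => w; apply.
  have Z2 x u : {ae P, forall w,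
      `|X (x + u) t w + X (x - u) t w - X x t w - X x t w| <= C * (`|u| * Num.sqrt `|u|)}.
    by have [_ H _] := HC x u; apply: filterS H => w; apply.
  have [Y [mY Y1 Y2]] := field_modification C0 (fun x => mX x t tI) Z1 Z2.
  exists Y => _; split => // x v.
  have bS : bmf (fun w => `|Y (x + v) w + Y (x - v) w - Y x w - Y x w|).
    split; last by exists (C * (`|v| * Num.sqrt `|v|)) => w; rewrite normr_id.
    apply: (measurableT_comp measurable_rV_norm).
    have m z := (mY z).1.
    by apply: measurable_rVB => //; apply: measurable_rVB => //; exact: measurable_rVD.
  rewrite -lee_fin (bmf_intE P bS).
  have [_ _ /(_ t t0 tT)] := HC x v; apply: le_trans.
  rewrite le_eqVlt; apply/orP; left; apply/eqP; apply: ae_eq_integral => //.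
  + by apply/measurable_EFinP; exact: bS.1.
  + apply/measurable_EFinP; apply: (measurableT_comp measurable_rV_norm).
    have m z := mX z t tI.
    by apply: measurable_rVB; [apply: measurable_rVB; [apply: measurable_rVD|]|]; exact: m.
  have [_ h1] := mY (x + v); have [_ h2] := mY (x - v); have [_ h3] := mY x.
  by apply: filterS3 h1 h2 h3 => w /= -> -> ->.
have [Y HY] := choice modification.
exists (fun x t w => field_jacobian (Y t) x w); split.
- exists (fun x t w => Y t x w); split.
  + by move=> x t /HY[+ _ _ _]; exact.
  + move=> x t i j /HY[mY Y1 Y2 _].
    exact: (measurable_field_jacobian C0 (fun x => (mY x).1) Y1 Y2).
  + move=> t /HY[_ Y1 Y2 _]; apply: aeW => w; split => //.
    exact: (field_C1 C0 Y1 Y2).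
- move=> K _; pose C' := (d * d)%:R * (d%:R * (d%:R * (2 * C))).
  exists (C' + 1) => [|t x y /HY[mY Y1 Y2 YE] _ _]; first by rewrite ltr_wpDl // !mulr_ge0.
  apply: le_trans (field_jacobian_enorm_mean C0 (fun x => (mY x).1) Y1 Y2 YE x y) _.
  by rewrite lee_fin; apply: ler_wpM2r; rewrite ?enorm_ge0 // lerDl.
- move=> K p _ p1; have p0 : 0 <= p by exact: le_trans p1.
  apply: (@le_lt_trans _ _ (((((d * d)%:R * C) `^ p)%:E `^ p^-1)%E)); last first.
    by rewrite poweR_EFin ltry.
  apply: ge_ereal_sup => _ [t /= tI <-]; apply: ge_ereal_sup => _ [x _ <-].
  have [mY Y1 Y2 _] := HY t tI.
  have q0 : 0 <= p^-1 by rewrite invr_ge0.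
  rewrite -poweR_EFin; apply: (gt0_ler_poweR q0).
  + rewrite in_itv /= leey andbT unlock; apply: integral_ge0 => w _.
    by rewrite lee_fin powR_ge0.
  + by rewrite in_itv /= leey andbT lee_fin powR_ge0.
  by apply: field_jacobian_moment => // z; exact: (mY z).1.
Qed.
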